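(* Let $Q$ be a non-associative commutative Moufang loop with multiplication group $\mathfrak M$. Then the following conditions are equivalent: (1) $Q$ satisfies the maximum condition for subloops; (2) $\mathfrak M$ is finitely generated; (3) $\mathfrak M$ satisfies the maximum condition for subgroups; (4) every normal subgroup of $\mathfrak M$ is finitely generated; (5) at least one maximal abelian subgroup of $\mathfrak M$ is finitely generated. Moreover, for every positive integer $n$ such that $\mathfrak M$ contains a nilpotent subgroup of class $n$, (1) is equivalent to: (6) every nilpotent subgroup of $\mathfrak M$ of class $n$ is finitely generated; and for every positive integer $s$ such that $\mathfrak M$ contains a solvable subgroup of (derived length) class $s$, (1) is equivalent to: (7) every solvable subgroup of $\mathfrak M$ of class $s$ is finitely generated.
   Context: A commutative Moufang loop (CML) is a commutative loop $(Q,\cdot)$ with identity $1$ satisfying $x^2\cdot yz = xy\cdot xz$ for all $x,y,z$. For $x\in Q$ the translation $L(x)$ is the permutation $y\mapsto xy$ of $Q$; the multiplication group $\mathfrak M=\mathfrak M(Q)$ is the permutation group generated by all $L(x)$, $x\in Q$. A loop satisfies the maximum condition for subloops if every ascending chain of subloops stabilizes; similarly for subgroups of a group. *)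

(* Defs.v *)
From Stdlib Require Import List Arith.
Set Implicit Arguments.

Section Loops.
Variable Q : Type.
Variable mul : Q -> Q -> Q.
Variable e : Q.

Definition is_loop : Prop :=
  (forall x, mul e x = x /\ mul x e = x) /\
  (forall a b, exists! x, mul a x = b) /\
  (forall a b, exists! y, mul y a = b).

Definition is_CML : Prop :=
  is_loop /\
  (forall x y, mul x y = mul y x) /\
  (forall x y z, mul (mul x x) (mul y z) = mul (mul x y) (mul x z)).

Definition non_associative : Prop :=
  exists x y z, mul (mul x y) z <> mul x (mul y z).

Definition subloop (S : Q -> Prop) : Prop :=
  S e /\
  (forall a b, S a -> S b -> S (mul a b)) /\
  (forall a b x, S a -> S b -> mul a x = b -> S x) /\
  (forall a b y, S a -> S b -> mul y a = b -> S y).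

Definition loop_max_condition : Prop :=
  forall C : nat -> Q -> Prop,
    (forall i, subloop (C i)) ->
    (forall i x, C i x -> C (S i) x) ->
    exists N, forall m, N <= m -> forall x, C m x <-> C N x.

Definition L (x : Q) : Q -> Q := fun y => mul x y.
End Loops.

Section PermGroups.
Variable Q : Type.
Definition perm := Q -> Q.
Definition pset := perm -> Prop.

Definition comp (f g : perm) : perm := fun x => f (g x).
Definition idp : perm := fun x => x.

Definition is_inv (f g : perm) : Prop :=
  (forall x, g (f x) = x) /\ (forall x, f (g x) = x).

Inductive gen (S : pset) : pset :=
| gen_id : gen S idp
| gen_in : forall f, S f -> gen S f
| gen_comp : forall f g, gen S f -> gen S g -> gen S (comp f g)
| gen_inv : forall f g, gen S f -> is_inv f g -> gen S g.

Definition subset (A B : pset) : Prop := forall f, A f -> B f.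

Definition is_subgroup (H : pset) : Prop :=
  H idp /\ (forall f g, H f -> H g -> H (comp f g)) /\
  (forall f g, H f -> is_inv f g -> H g).

Definition subgroup_of (G H : pset) : Prop := is_subgroup H /\ subset H G.

Definition fin_gen (H : pset) : Prop :=
  exists l : list perm, forall f, H f <-> gen (fun g => In g l) f.

Definition group_max_condition (G : pset) : Prop :=
  forall C : nat -> pset,
    (forall i, subgroup_of G (C i)) ->
    (forall i, subset (C i) (C (S i))) ->
    exists N, forall m, N <= m -> forall f, C m f <-> C N f.

Definition normal_subgroup_of (G H : pset) : Prop :=
  subgroup_of G H /\
  forall f fi h, G f -> is_inv f fi -> H h -> H (comp fi (comp h f)).

Definition abelian (H : pset) : Prop :=
  forall f g, H f -> H g -> comp f g = comp g f.

Definition max_abelian_subgroup_of (G H : pset) : Prop :=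
  subgroup_of G H /\ abelian H /\
  forall K, subgroup_of G K -> abelian K -> subset H K -> subset K H.

Definition commg (A B : pset) : pset :=
  gen (fun h => exists a b ai bi, A a /\ B b /\ is_inv a ai /\ is_inv b bi /\
                   h = comp ai (comp bi (comp a b))).

Definition trivial (H : pset) : Prop := forall f, H f -> f = idp.

Fixpoint lcs (H : pset) (i : nat) : pset :=
  match i with 0 => H | S i => commg (lcs H i) H end.

Fixpoint dser (H : pset) (i : nat) : pset :=
  match i with 0 => H | S i => commg (dser H i) (dser H i) end.

Definition nilpotent_class (H : pset) (n : nat) : Prop :=
  trivial (lcs H n) /\ forall m, m < n -> ~ trivial (lcs H m).

Definition derived_length (H : pset) (s : nat) : Prop :=
  trivial (dser H s) /\ forall m, m < s -> ~ trivial (dser H m).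
End PermGroups.

Definition Mlt (Q : Type) (mul : Q -> Q -> Q) : pset Q :=
  gen (fun f => exists x, f = L mul x).

(* Main.v *)
Require Import Defs.
From Stdlib Require Import List Arith.
From Corelib Require Import ssreflect ssrbool.
From Stdlib Require Import Lia Classical ClassicalEpsilon FunctionalExtensionality
  PropExtensionality ProofIrrelevance ListDec FinFun.
Set Implicit Arguments.
Set Bullet Behavior "None".
Set SsrOldRewriteGoalsOrder.
Import ListNotations.

(** Write [t_x] for [L x].  Modulo its centre, [Q] with [x ∘ y = (xy)^-1] is a commutative
    idempotent distributive system in which [x ∘ (x ∘ y) = y].  Such a system generated by
    a finite set is finite.  Indeed let it be generated by a finite subsystem [A] and one
    more element.  A finite system has a nontrivial central element [z]; if [z] is central
    in [A], then the conjugates of [t_z] commute, by identities that are checked by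
    reflection.  They generate an abelian normal subgroup of exponent 3; induction applies
    to the quotient by it, and it is finite by Dietzmann's argument.  Hence for finitely
    generated [Q] the group [M] is a finite extension of its finitely generated abelian
    centre, and all its subgroups are finitely generated.

    Conversely, let a finitely generated subgroup [H] of [M] contain its centralizer; it is
    centre-by-finite, so the centre of [M] is finitely generated.  In a finitely generated
    subloop [K] choose a maximal abelian normal [B].  The translations by [B] generate,
    with their commutators, an abelian group on which [H] acts as a finite 3-group, so it
    lies in a term of the upper [H]-central series of bounded index, and these terms are
    finite modulo the centre.  As [B] is its own centralizer in [K], the order of [K] modulo
    the centre is bounded, so [Q] modulo its centre is finite.  For (5), [H] is the maximal
    abelian subgroup; for (6) and (7), [H] is the product of a subgroup of the given class
    and a maximal abelian subgroup of its centralizer. *)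

(** * Distributive Hall triple systems *)

(** The number 3 has one source: cubes of [Q] are central, so [(xy)^-1] is idempotent modulo the
    centre. The maps [x ↦ a ∘ x] are then involutive automorphisms. Inner maps are automorphisms
    too, so each associativity statement becomes a fixed-point statement and passes from generators
    to the subsystem they generate. In the local finiteness part the group of reflections is not
    known to be nilpotent, or even finite; the commuting conjugates supply an abelian normal
    subgroup to start from. In the converse the difficulty is uniformity: only the translations by
    one finite list [xs] are under control, while the nilpotency class of a finitely generated
    subloop [K] depends on [K]. The sets [eng j], Engel conditions with respect to [xs] alone, make
    no mention of [K] and are finite modulo the centre. Nilpotency of [K] serves only to reach some
    [eng j]; how large [j] must be is read off from the number of conjugates under the group of
    [xs], which is finite modulo the centre. *)

Definition hts (X : Type) (op : X -> X -> X) :=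
  (forall x y, op x y = op y x) /\ (forall x, op x x = x) /\
  (forall x y, op x (op x y) = y) /\
  (forall x y z, op x (op y z) = op (op x y) (op x z)).

Section Identities.
Variables (X : Type) (op : X -> X -> X).
Hypothesis Hop : hts op.
Local Notation "a ∘ b" := (op a b) (at level 40, left associativity).

Lemma opC a b : a ∘ b = b ∘ a. Proof. by case: Hop => ->. Qed.
Lemma opI a : a ∘ a = a. Proof. by case: Hop => _ [->]. Qed.
Lemma opK a b : a ∘ (a ∘ b) = b. Proof. by case: Hop => _ [_ [->]]. Qed.
Lemma opD a b c : a ∘ (b ∘ c) = (a ∘ b) ∘ (a ∘ c). Proof. by case: Hop => _ [_ [_ ->]]. Qed.
Lemma opIl a b c : a ∘ b = a ∘ c -> b = c.
Proof. by move=> E; rewrite -(opK a b) E opK. Qed.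

(* A line [(i, j, k)] asserts [p_i ∘ p_j = p_k]; the axioms make this symmetric in
   [i], [j], [k].  A step [(x, a, b)] applies distributivity to [x] and the line
   through [a], [b]: the images of its three points are again collinear.  Certificates
   list the points (by how they are obtained from earlier ones) and the steps. *)
Definition pair2 := (nat * nat)%type.
Definition line := (pair2 * nat)%type.

Fixpoint look (t : list line) (a b : nat) : option nat :=
  match t with
  | [] => None
  | (i, j, k) :: t =>
    let hit x y := orb (andb (x =? a) (y =? b)) (andb (x =? b) (y =? a)) in
    match a =? b, hit i j, hit i k, hit j k with
    | true, _, _, _ => Some a
    | _, true, _, _ => Some k
    | _, _, true, _ => Some j
    | _, _, _, true => Some i
    | _, _, _, _ => look t a b
    end
  end.

(** Distributivity only equates [p_x ∘ p_c] with [p_a' ∘ p_b']; a new line arises when one of the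
    two sides is already named, and otherwise the step is void. *)
Definition step (t : list line) (s : line) : list line :=
  let '(x, a, b) := s in
  match look t x a, look t x b, look t a b with
  | Some a', Some b', Some c =>
    match look t x c, look t a' b' with
    | Some d, _ => (a', b', d) :: t
    | None, Some d => (x, c, d) :: t
    | None, None => t
    end
  | _, _, _ => t
  end.

Fixpoint def_lines (n : nat) (defs : list pair2) : list line :=
  match defs with
  | [] => []
  | (i, j) :: defs => (i, j, n) :: def_lines (S n) defs
  end.

Definition valid (p : nat -> X) (l : line) := let '(i, j, k) := l in p i ∘ p j = p k.

Lemma look_sound p t a b c : Forall (valid p) t -> look t a b = Some c -> p a ∘ p b = p c.
Proof.
elim: t => [//|[[i j] k] t IH] /Forall_cons_iff [V Vt] /=.
case: Nat.eqb_spec => [<- [<-]|_]; first exact: opI.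
have hitP x y : orb (andb (x =? a) (y =? b)) (andb (x =? b) (y =? a)) = true ->
    p a ∘ p b = p x ∘ p y.
  move=> /Bool.orb_true_iff [] /andb_prop [/Nat.eqb_eq -> /Nat.eqb_eq ->] //.
  exact: opC.
have Vik : p i ∘ p k = p j by rewrite -V opK.
have Vjk : p j ∘ p k = p i by rewrite -V (opC (p i)) opK.
case E1: (orb _ _); first by move=> [<-]; rewrite (hitP _ _ E1).
case E2: (orb _ _); first by move=> [<-]; rewrite (hitP _ _ E2).
case E3: (orb _ _); first by move=> [<-]; rewrite (hitP _ _ E3).
exact: IH.
Qed.

Lemma step_sound p t s : Forall (valid p) t -> Forall (valid p) (step t s).
Proof.
move=> Vt; case: s => [[x a] b] /=.
case Ea: look => [a'|] //; case Eb: look => [b'|] //; case Ec: look => [c|] //.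
have {}Ea := look_sound _ _ Vt Ea; have {}Eb := look_sound _ _ Vt Eb.
have {}Ec := look_sound _ _ Vt Ec.
have D : p x ∘ p c = p a' ∘ p b' by rewrite -Ec opD Ea Eb.
case E: look => [d|].
  by constructor=> //=; rewrite -D (look_sound _ _ Vt E).
case E': look => [d|] //.
by constructor=> //=; rewrite D (look_sound _ _ Vt E').
Qed.

Fixpoint points (x0 : X) (l : list X) (defs : list pair2) : list X :=
  match defs with
  | [] => l
  | (i, j) :: defs => points x0 (l ++ [nth i l x0 ∘ nth j l x0]) defs
  end.

Fixpoint defs_wf (n : nat) (defs : list pair2) : bool :=
  match defs with
  | [] => true
  | (i, j) :: defs => andb (andb (i <? n) (j <? n)) (defs_wf (S n) defs)
  end.

Lemma points_prefix x0 l defs k : k < length l -> nth k (points x0 l defs) x0 = nth k l x0.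
Proof.
elim: defs l => [//|[i j] defs IH] l lt /=.
by rewrite IH ?app_nth1 // length_app; lia.
Qed.

Lemma def_lines_valid x0 l defs : defs_wf (length l) defs = true ->
  Forall (valid (fun k => nth k (points x0 l defs) x0)) (def_lines (length l) defs).
Proof.
elim: defs l => [|[i j] defs IH] l /= wf; first by constructor.
move/andb_prop: wf => [/andb_prop [/Nat.ltb_lt lti /Nat.ltb_lt ltj] wf].
have E : length (l ++ [nth i l x0 ∘ nth j l x0]) = S (length l) by rewrite length_app /=; lia.
constructor; last by rewrite -E; apply: IH; rewrite E.
rewrite /valid (@points_prefix x0 _ defs i) ?E; last lia.
rewrite (@points_prefix x0 _ defs j) ?E; last lia.
rewrite (@points_prefix x0 _ defs (length l)) ?E; last lia.
by rewrite (app_nth1 _ _ _ lti) (app_nth1 _ _ _ ltj) app_nth2 // Nat.sub_diag.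
Qed.

Fixpoint holds (p : nat -> X) (t : list line) : Prop :=
  match t with [] => True | l :: t => valid p l /\ holds p t end.

(** Both side conditions are closed computations, discharged by [eq_refl]. In every use point 0 is
    the unit [e], and the generators precede the derived points. *)
Lemma certificate (gens : list X) x0 defs hyps steps goal :
  defs_wf (length gens) defs = true ->
  let p k := nth k (points x0 gens defs) x0 in
  let '(i, j, k) := goal in
  look (fold_left step steps (hyps ++ def_lines (length gens) defs)) i j = Some k ->
  holds p hyps -> valid p goal.
Proof.
move=> wf p; case: goal => [[i j] k] L H; apply: look_sound L.
have : Forall (valid p) (hyps ++ def_lines (length gens) defs).
  apply/Forall_app; split; last exact: def_lines_valid.
  by elim: hyps H => [|h hyps IH] /= H; constructor; [case: H|apply: IH; case: H].
elim: steps (_ ++ _) => [//|s steps IH] t Vt /=.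
by apply: IH; exact: step_sound.
Qed.

Variable e : X.
Local Notation J y w x := (y ∘ (e ∘ (w ∘ (y ∘ (e ∘ (w ∘ x)))))).

(* In the loop [xy = e ∘ (x ∘ y)] with unit [e], [x], [y] and [w] associate. *)
Definition asc x y w := y ∘ (e ∘ (w ∘ x)) = w ∘ (e ∘ (y ∘ x)).

Lemma asc_swap x y w : asc x y w -> asc y x w.
Proof.
rewrite /asc (opC x y) => H.
exact: (@certificate [e; x; y; w] e
  [(3,1); (0,4); (2,1); (0,6); (3,7); (3,2); (0,9); (0,1); (0,2); (0,3); (1,5); (2,4)]
  [(2,5,8)]
  [(0,2,1); (0,3,1); (11,1,5); (2,4,1); (2,4,0); (7,12,8); (6,7,15); (1,6,14)]
  (1,10,8) eq_refl eq_refl (conj H I)).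
Qed.

Lemma asc_flip x y w : asc x y w -> asc x w y. Proof. by []. Qed.

(** Seed for [cen_asc_J]: the points are arbitrary, so [y] may later be replaced by a product. *)
Lemma asc_J q y z : asc q y (J z y q).
Proof.
exact: (@certificate [e; q; y; z] e
  [(2,1); (0,4); (3,5); (2,6); (0,7); (3,8); (9,1); (0,10); (9,5); (0,2); (0,3); (2,3); (0,6); (1,5);
   (2,5); (1,7); (0,9); (2,8); (3,7); (4,6); (4,7); (1,11); (1,12)]
  []
  [(0,6,3); (0,6,2); (4,1,5); (2,5,3); (0,9,3); (7,2,8); (13,2,8); (15,3,7); (14,3,7); (2,4,6);
   (5,4,6); (16,4,6); (5,14,9); (23,15,2); (6,4,7); (7,4,14); (10,1,11); (19,1,12); (1,12,5);
   (21,19,6); (26,13,17); (1,26,4)]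
  (2,11,12) eq_refl eq_refl I).
Qed.

(** As [e ∘ u] is the inverse of [u], the left side is up to inversion the associator
    [u^-1 · J v w u]. Its cyclic symmetry moves a chosen argument into the place on which the inner
    map acts. *)
Lemma J_cycle u v w : (e ∘ u) ∘ J v w u = (e ∘ v) ∘ J w u v.
Proof.
exact: (@certificate [e; u; v; w] e
  [(0,1); (3,1); (0,5); (2,6); (3,7); (0,8); (2,9); (0,2); (1,2); (0,12); (3,13); (1,14); (0,15);
   (3,16); (11,17); (0,3); (2,4); (0,7); (2,5); (1,8); (3,6); (0,10); (2,8); (1,11); (3,9); (4,8)]
  []
  [(0,12,1); (1,2,4); (1,13,3); (0,7,2); (0,7,3); (11,2,5); (5,3,6); (5,4,2); (0,10,2); (11,2,8);
   (7,2,8); (7,26,11); (0,7,10); (2,1,11); (0,1,11); (8,3,9); (19,3,9); (21,8,11); (15,5,16); (3,28,5);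
   (1,9,0); (0,4,8); (23,4,8); (0,17,3); (15,19,7); (10,29,9); (4,23,13)]
  (4,10,18) eq_refl eq_refl I).
Qed.

(** Writes [s_k s_g = t_k^-1 t_g] as a translation times a commutator of translations, the form
    needed in [cen_grp_conj]. *)
Lemma op_op_translation k g y :
  let r := (e ∘ g) ∘ k in k ∘ (g ∘ y) = e ∘ (r ∘ J g r y).
Proof.
move=> r; symmetry.
exact: (@certificate [e; g; k; y] e
  [(0,1); (4,2); (5,3); (0,6); (1,7); (5,8); (0,9); (1,10); (5,11); (1,3); (2,13); (1,2); (0,5); (2,3);
   (1,6); (0,8); (1,9); (0,11)]
  []
  [(4,0,5); (2,3,1); (1,6,0); (4,0,8); (0,8,5); (5,4,6); (16,5,19); (1,9,0); (4,0,11); (16,4,9);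
   (0,16,21)]
  (0,12,14) eq_refl eq_refl I).
Qed.

(* When an automorphism fixing [e], [c] and [r] maps [q] to [p], the two hypotheses are
   instances of one another. *)
Lemma asc_shift c r q p (rq := e ∘ (r ∘ q)) (rp := e ∘ (r ∘ p)) :
  asc q c p -> asc rq c rp -> asc r c (e ∘ ((e ∘ q) ∘ p)).
Proof.
rewrite /asc (opC p q) (opC p (_ ∘ (_ ∘ _))) (opC rp rq) (opC rp (_ ∘ (_ ∘ _))) => H1 H2.
rewrite (opC _ r) (opC (e ∘ _) (e ∘ (c ∘ r))).
exact: (@certificate [e; c; r; q; p] e
  [(3,4); (0,5); (1,3); (0,7); (8,4); (2,3); (0,10); (2,4); (0,12); (11,13); (0,14); (1,11); (0,16);
   (17,13); (0,3); (19,4); (0,20); (2,21); (0,22); (1,2); (0,24); (25,21); (0,1); (0,4); (1,4); (1,5);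
   (2,6); (1,8); (2,8); (2,9); (3,9); (1,12); (5,8); (1,13); (4,10); (5,9); (1,14); (4,11); (3,14);
   (0,18); (1,17); (4,14); (5,13); (3,17); (4,17); (7,14); (5,17); (6,16); (5,18); (8,15); (3,22);
   (9,16); (2,25); (4,23); (4,25); (4,26); (6,25); (15,16); (2,29); (9,25); (2,7); (0,65); (10,25)]
  [(1,6,9); (1,15,18)]
  [(0,14,11); (2,10,12); (3,19,4); (6,0,20); (19,0,20); (0,1,3); (0,1,11); (5,0,4); (19,0,4); (21,0,4);
   (4,1,6); (1,5,3); (1,5,0); (1,5,2); (8,7,29); (5,2,6); (27,1,8); (9,1,8); (29,1,8); (7,1,8);
   (30,1,8); (2,9,4); (21,3,9); (29,21,30); (1,12,2); (4,5,8); (8,5,19); (1,13,0); (12,4,10); (3,4,10);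
   (30,5,9); (8,5,9); (21,5,9); (6,5,9); (20,30,0); (1,14,11); (1,14,0); (4,11,0); (3,14,0); (15,0,18);
   (27,0,18); (0,18,13); (0,18,24); (44,12,15); (27,44,10); (1,17,14); (14,4,3); (5,13,0); (39,6,19);
   (3,17,10); (17,5,3); (0,6,16); (30,5,18); (5,18,13); (0,8,15); (8,15,2); (3,22,2); (39,10,28);
   (0,10,28); (0,55,3); (16,9,1); (24,2,25); (27,24,18); (27,24,29); (41,57,38); (4,23,19); (21,6,25);
   (40,6,25); (40,61,21); (41,15,16); (0,15,16); (44,15,16); (0,36,24); (25,62,44); (4,2,29); (2,29,6);
   (4,36,14); (63,46,31); (9,25,2); (25,9,4); (41,64,45); (2,7,1); (2,7,29); (51,63,53); (0,65,10);
   (0,65,42); (11,66,55); (25,10,4); (41,59,56); (10,41,67); (0,10,54); (29,11,20); (4,29,58)]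
  (1,23,26) eq_refl eq_refl (conj H1 (conj H2 I))).
Qed.

End Identities.

(** * Finite predicates *)

Definition fin (T : Type) (P : T -> Prop) := exists l, forall x, P x -> In x l.

Lemma eq_dec (T : Type) (x y : T) : {x = y} + {x <> y}.
Proof. apply excluded_middle_informative. Qed.

Lemma fin_sub (T : Type) (P P' : T -> Prop) :
  (forall x, P x -> P' x) -> fin P' -> fin P.
Proof. by move=> sPP' [l Hl]; exists l => x /sPP'; apply: Hl. Qed.

Lemma fin_image (S T : Type) (f : S -> T) (P : S -> Prop) (P' : T -> Prop) :
  (forall y, P' y -> exists x, P x /\ y = f x) -> fin P -> fin P'.
Proof.
move=> Hf [l Hl]; exists (map f l) => y /Hf [x [/Hl Hx ->]]; exact: in_map.
Qed.

Lemma fin_inj (S T : Type) (f : S -> T) (P : S -> Prop) (P' : T -> Prop) :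
  (forall x, P x -> P' (f x)) ->
  (forall x y, P x -> P y -> f x = f y -> x = y) -> fin P' -> fin P.
Proof.
move=> Hf inj [l Hl].
have {}Hl x : P x -> In (f x) l by move=> /Hf; exact: Hl.
clear P' Hf; elim: l P inj Hl => [|y l IH] P inj Hl.
  by exists [] => x /Hl.
have [l' Hl'] : fin (fun x => P x /\ f x <> y).
  apply: IH; first by move=> x x' [? ?] [? ?]; exact: inj.
  by move=> x [/Hl [->|] //].
case: (classic (exists x, P x /\ f x = y)) => [[x [Px fx]]|none].
  exists (x :: l') => x' Px'; case: (classic (f x' = y)) => [fx'|nfx'].
    by left; apply: inj => //; rewrite fx fx'.
  by right; apply: Hl'.
by exists l' => x Px; apply: Hl'; split=> // fx; apply: none; exists x.
Qed.

Lemma fin_prod (S T : Type) (P : S -> Prop) (P' : T -> Prop) :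
  fin P -> fin P' -> fin (fun xy => P (fst xy) /\ P' (snd xy)).
Proof.
move=> [l Hl] [l' Hl']; exists (list_prod l l') => [[x y] [/= /Hl Hx /Hl' Hy]].
exact: in_prod.
Qed.

Definition upd (S T : Type) (g : S -> T) x y u :=
  match eq_dec u x with left _ => y | right _ => g u end.

Lemma fin_functions (S T : Type) (l : list S) (P : T -> Prop) : fin P ->
  exists L, forall f : S -> T, (forall x, In x l -> P (f x)) ->
    exists g, In g L /\ forall x, In x l -> f x = g x.
Proof.
move=> [lT HT]; elim: l => [|x l [L HL]].
  case: (classic (inhabited (S -> T))) => [[f0]|none].
    by exists [f0] => f _; exists f0; split=> //; left.
  by exists [] => f; case: none.
exists (flat_map (fun g => map (upd g x) lT) L) => f Hf.
have [g [gL Hg]] := HL f (fun x' Hx' => Hf x' (or_intror Hx')).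
exists (upd g x (f x)); split.
  apply/in_flat_map; exists g; split=> //; apply: (in_map (upd g x)).
  by apply: HT; apply: Hf; left.
move=> x' /= Hx'; rewrite /upd; case: (eq_dec x' x) => [-> //|ne].
by apply: Hg; case: Hx' => // E; case: ne.
Qed.

(** Descent on the length of a covering list. Applied to complements it also yields maximal objects,
    as in [upper_stable] and [good_max]. *)
Lemma fin_minimal (T : Type) (F : (T -> Prop) -> Prop) (P0 : T -> Prop) :
  F P0 -> fin P0 ->
  exists P, F P /\ (forall x, P x -> P0 x) /\
    forall P', F P' -> (forall x, P' x -> P x) -> forall x, P x -> P' x.
Proof.
move=> F0 [l Hl]; have [n Hn] : exists n, length l <= n by exists (length l).
elim: n l P0 F0 Hl Hn => [|n IH] l P0 F0 Hl Hn.
  exists P0; split=> //; split=> // P' _ _ x /Hl.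
  by case: l Hn {Hl} => //= ? l; lia.
case: (classic (exists P', F P' /\ (forall x, P' x -> P0 x) /\ exists x, P0 x /\ ~ P' x)).
  move=> [P' [F' [sP' [x [P0x nP'x]]]]].
  have [|||P [FP [sP minP]]] // := IH (remove (@eq_dec T) x l) P'.
  - by move=> x' Hx'; apply: in_in_remove; [move=> E; subst; exact: nP'x|apply/Hl/sP'].
  - by have := remove_length_lt (@eq_dec T) l x (Hl x P0x); lia.
  by exists P; split=> //; split=> // y /sP; exact: sP'.
move=> none; exists P0; split=> //; split=> // P' F' sP' x P0x.
by apply: NNPP => nP'x; apply: none; exists P'; do 2 split => //; exists x.
Qed.

(** * Permutations *)

(** The inverse is stored, so that group identities reduce pointwise to cancellations, which [grp]
    performs; by [sym_ext] equality is still that of the functions. *)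
Record sym (X : Type) := Sym {
  fn :> X -> X;
  fv : X -> X;
  fnK : forall x, fv (fn x) = x;
  fvK : forall x, fn (fv x) = x }.

Declare Scope sym_scope.
Delimit Scope sym_scope with sym.

Definition sym_id (X : Type) : sym X := @Sym X (fun x => x) (fun x => x) (fun _ => eq_refl) (fun _ => eq_refl).
Definition sym_inv (X : Type) (f : sym X) : sym X := Sym (fv f) (fn f) (fvK f) (fnK f).
Definition sym_mul (X : Type) (f g : sym X) : sym X.
Proof.
refine (@Sym X (fun x => f (g x)) (fun x => fv g (fv f x)) _ _) => x.
- by rewrite !fnK.
- by rewrite !fvK.
Defined.

Notation "f * g" := (sym_mul f g) : sym_scope.
Notation "f ^-1" := (sym_inv f) (at level 3, left associativity, format "f ^-1") : sym_scope.
Notation "1" := (sym_id _) : sym_scope.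
Local Open Scope sym_scope.

Lemma sym_ext (X : Type) (f g : sym X) : (forall x, f x = g x) -> f = g.
Proof.
case: f => f f' fK f'K; case: g => g g' gK g'K /= E.
have {}E : f = g by apply: functional_extensionality.
have E' : f' = g'.
  by apply: functional_extensionality => x; rewrite -{1}(g'K x) -E fK.
by subst; f_equal; apply: proof_irrelevance.
Qed.

Ltac grp := apply: sym_ext => ?; rewrite /= ?fnK ?fvK; do ?[rewrite fnK | rewrite fvK]; try reflexivity.

Section SymGroup.
Variable X : Type.
Implicit Types f g h : sym X.

Lemma mulA f g h : f * (g * h) = f * g * h. Proof. by grp. Qed.
Lemma mul1 f : 1 * f = f. Proof. by grp. Qed.
Lemma mulr1 f : f * 1 = f. Proof. by grp. Qed.
Lemma mulV f : f * f^-1 = 1. Proof. by grp. Qed.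
Lemma mulVl f : f^-1 * f = 1. Proof. by grp. Qed.
Lemma mulK f g : g * f * f^-1 = g. Proof. by grp. Qed.
Lemma mulKV f g : g * f^-1 * f = g. Proof. by grp. Qed.
Lemma mulVK f g : f^-1 * (f * g) = g. Proof. by grp. Qed.
Lemma mulKl f g : f * (f^-1 * g) = g. Proof. by grp. Qed.
Lemma invM f g : (f * g)^-1 = g^-1 * f^-1. Proof. by grp. Qed.
Lemma invV f : f^-1^-1 = f. Proof. by grp. Qed.
Lemma inv1 : (1 : sym X)^-1 = 1. Proof. by grp. Qed.
Lemma invK f x : f^-1 (f x) = x. Proof. exact: fnK. Qed.
Lemma invKr f x : f (f^-1 x) = x. Proof. exact: fvK. Qed.
Lemma mulIl f g h : f * g = f * h -> g = h.
Proof. by move=> E; rewrite -(mulVK f g) E mulVK. Qed.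
Lemma mulIr f g h : g * f = h * f -> g = h.
Proof. by move=> E; rewrite -(mulK f g) E mulK. Qed.
Lemma inv_eq f g : f * g = 1 -> f = g^-1.
Proof. by move=> E; apply: (@mulIr g); rewrite E mulVl. Qed.

Lemma cube_inv f : f * f * f = 1 -> f^-1 * f^-1 = f.
Proof. by move=> E; rewrite -invM; symmetry; apply: inv_eq; rewrite mulA. Qed.

Definition commutes f g := f * g = g * f.

Lemma commutes_sym f g : commutes f g -> commutes g f. Proof. by []. Qed.
Lemma commutesM f g h : commutes f g -> commutes f h -> commutes f (g * h).
Proof. by rewrite /commutes => fg fh; rewrite mulA fg -mulA fh mulA. Qed.
Lemma commutesV f g : commutes f g -> commutes f g^-1.
Proof. by rewrite /commutes => fg; apply: (@mulIr g); rewrite -!mulA fg mulVl mulr1 mulVK. Qed.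
Lemma commutes1 f : commutes f 1. Proof. by rewrite /commutes mulr1 mul1. Qed.
Lemma commutesJ f g h : commutes f g -> commutes (h * f * h^-1) (h * g * h^-1).
Proof. by rewrite /commutes !mulA !mulKV -!mulA => fg; rewrite (mulA f) fg !mulA. Qed.

Lemma commutes_cube f g : commutes f g -> f * g * (f * g) * (f * g) = f * f * f * (g * g * g).
Proof.
move=> c; have {}c : g * f = f * g by [].
transitivity (f * (g * f) * (g * f) * g); first by grp.
rewrite c; transitivity (f * f * (g * f) * g * g); first by grp.
by rewrite c; grp.
Qed.

(** [f^-1 * h * f^-1] is the shape that [tr_mul] gives to the translation by a product: a factor
    that commutes with [g] only conjugates the commutator. *)
Lemma commutator_twist f g h : commutes f g ->
  g^-1 * (f^-1 * h * f^-1)^-1 * g * (f^-1 * h * f^-1) = f * (g^-1 * h^-1 * g * h) * f^-1.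
Proof.
move=> fg; have gf : g^-1 * f = f * g^-1 by symmetry; exact: commutesV.
rewrite (_ : _ * _ = (g^-1 * f) * h^-1 * (f * g * f^-1) * h * f^-1); last by grp.
by rewrite gf fg mulK; grp.
Qed.

Definition subgrp (H : sym X -> Prop) :=
  H 1 /\ (forall f g, H f -> H g -> H (f * g)) /\ (forall f, H f -> H f^-1).

Inductive span (S : sym X -> Prop) : sym X -> Prop :=
| span1 : span S 1
| span_in f : S f -> span S f
| spanM f g : span S f -> span S g -> span S (f * g)
| spanV f : span S f -> span S f^-1.

Lemma span_subgrp S : subgrp (span S).
Proof. by split; [exact: span1|split; [exact: spanM|exact: spanV]]. Qed.

Lemma span_min (S H : sym X -> Prop) : subgrp H -> (forall f, S f -> H f) -> forall f, span S f -> H f.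
Proof. by move=> [H1 [HM HV]] sSH f; elim=> *; auto. Qed.

Lemma span_mono (S S' : sym X -> Prop) : (forall f, S f -> span S' f) -> forall f, span S f -> span S' f.
Proof. by apply: span_min; apply: span_subgrp. Qed.

Lemma centralizer_subgrp (S : sym X -> Prop) : subgrp (fun f => forall g, S g -> commutes f g).
Proof.
split; first by move=> g _; rewrite /commutes mulr1 mul1.
split=> [f g Hf Hg h Sh|f Hf h Sh].
  by apply/commutes_sym/commutesM; apply/commutes_sym; auto.
by apply/commutes_sym/commutesV; apply/commutes_sym; auto.
Qed.

Lemma span_commutes (S : sym X -> Prop) g :
  (forall f, S f -> commutes g f) -> forall f, span S f -> commutes g f.
Proof.
move=> H f Sf; apply/commutes_sym; move: f Sf.
apply: (@span_min S (fun f => commutes f g)); last by move=> f /H /commutes_sym.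
have [C1 [CM CV]] := @centralizer_subgrp (fun f => f = g).
split; first by exact: C1.
by split=> [f h Hf Hh|f Hf]; [apply: CM|apply: CV] => // ? ->.
Qed.

Lemma span_abelian (S : sym X -> Prop) :
  (forall f g, S f -> S g -> commutes f g) -> forall f g, span S f -> span S g -> commutes f g.
Proof.
move=> H f g Sf; apply: span_commutes => {}g Sg.
by apply/commutes_sym; move: f Sf; apply: span_commutes => f Sf; apply: H.
Qed.

Lemma span_conj (S S' : sym X -> Prop) h :
  (forall f, S f -> span S' (h * f * h^-1)) -> forall f, span S f -> span S' (h * f * h^-1).
Proof.
move=> H f; elim=> {f}.
- by rewrite mulr1 mulV; exact: span1.
- exact: H.
- move=> f g _ Hf _ Hg; rewrite (_ : _ * _ = (h * f * h^-1) * (h * g * h^-1)); last by grp.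
  exact: spanM.
- move=> f _ Hf; rewrite (_ : _ * _ = (h * f * h^-1)^-1); last by grp.
  exact: spanV.
Qed.

(** Each new generator has its cube in [N], so its powers 1, [a], [a * a] multiply the number of
    cosets by at most 3. The explicit count is what [eng_uniform] needs. *)
Lemma span_cover3 (N : sym X -> Prop) (l : list (sym X)) : subgrp N ->
  (forall n f, N n -> In f l -> commutes n f) ->
  (forall f g, In f l -> In g l -> commutes f g) -> (forall f, In f l -> N (f * f * f)) ->
  exists L, length L <= 3 ^ length l /\
    forall f, span (fun g => N g \/ In g l) f -> exists g, In g L /\ exists n, N n /\ f = n * g.
Proof.
move=> sN; have [N1 [NM NV]] := sN; elim: l => [|a l IH] Nl cl cub.
  exists [1]; split=> // f Sf; exists 1; split; first by left.
  exists f; split; last by rewrite mulr1.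
  by apply: (span_min sN) Sf => g [|[]].
have [|||L [len HL]] := IH.
- by move=> n f Nn fl; apply: Nl => //; right.
- by move=> f g fl gl; apply: cl; right.
- by move=> f fl; apply: cub; right.
set S := span (fun g => N g \/ In g l) in HL.
have a3 : N (a * a * a) by apply: cub; left.
have ca f : S f -> commutes a f.
  apply: span_commutes => {}f [Nf|fl]; first by apply/commutes_sym/Nl => //; left.
  by apply: cl; [left|right].
pose A := [1; a; a * a].
have caA k f : In k A -> S f -> commutes k f.
  move=> kA Sf; have c := ca f Sf.
  by case: kA => [<-|[<-|[<-|[]]]] //; apply/commutes_sym; apply: commutesM.
have SN n : N n -> S n by move=> Nn; apply: span_in; left.
pose P f := exists k h, S h /\ In k A /\ f = k * h.
have AA k k' : In k A -> In k' A -> P (k * k').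
  have mk n : N n -> forall k0 g, In k0 A -> g = k0 * n -> P g.
    by move=> Nn k0 g kA ->; exists k0, n; split; [exact: SN|split].
  move=> [<-|[<-|[<-|[]]]] [<-|[<-|[<-|[]]]]; rewrite ?mul1 ?mulr1.
  - by apply: (mk 1 N1 1); [left|rewrite mulr1].
  - by apply: (mk 1 N1 a); [right; left|rewrite mulr1].
  - by apply: (mk 1 N1 (a * a)); [right; right; left|rewrite mulr1].
  - by apply: (mk 1 N1 a); [right; left|rewrite mulr1].
  - by apply: (mk 1 N1 (a * a)); [right; right; left|rewrite mulr1].
  - by apply: (mk _ a3 1); [left|rewrite mul1 mulA].
  - by apply: (mk 1 N1 (a * a)); [right; right; left|rewrite mulr1].
  - by apply: (mk _ a3 1); [left|rewrite mul1].
  - by apply: (mk _ a3 a); [right; left|rewrite !mulA].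
have AV k : In k A -> P k^-1.
  have S3 : S (a * a * a)^-1 by apply/SN/NV.
  move=> [<-|[<-|[<-|[]]]].
  - by exists 1, 1; split; [exact: span1|split; [left|rewrite inv1 mul1]].
  - by exists (a * a), (a * a * a)^-1; split=> //; split; [right; right; left|grp].
  - by exists a, (a * a * a)^-1; split=> //; split; [right; left|grp].
have PM f : span (fun g => N g \/ In g (a :: l)) f -> P f.
  elim=> {f} [|f [Nf|[<-|fl]]|f g _ [k [h [Sh [kA ->]]]] _ [k' [h' [Sh' [kA' ->]]]]|f _ [k [h [Sh [kA ->]]]]].
  - by exists 1, 1; split; [exact: span1|split; [left|rewrite mul1]].
  - by exists 1, f; split; [exact: SN|split; [left|rewrite mul1]].
  - by exists a, 1; split; [exact: span1|split; [right; left|rewrite mulr1]].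
  - by exists 1, f; split; [apply: span_in; right|split; [left|rewrite mul1]].
  - have [k0 [h0 [Sh0 [kA0 E]]]] := AA k k' kA kA'.
    exists k0, (h0 * (h * h')); split; first by apply: spanM => //; apply: spanM.
    by split=> //; rewrite [RHS]mulA -E -!mulA (mulA h) -(caA k' h kA' Sh) -mulA.
  - have [k0 [h0 [Sh0 [kA0 E]]]] := AV k kA.
    exists k0, (h0 * h^-1); split; first by apply: spanM => //; exact: spanV.
    by split=> //; rewrite [RHS]mulA -E -invM (caA k h kA Sh).
exists (flat_map (fun h => map (fun k => k * h) A) L); split.
  rewrite (flat_map_constant_length (c := 3)) => [|h _] //=.
  lia.
move=> f /PM [k [h [Sh [kA ->]]]]; have [g [gL [n [Nn E]]]] := HL h Sh.
exists (k * g); split; first by apply/in_flat_map; exists g; split=> //; exact: (in_map (fun k => k * g)).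
exists n; split=> //; rewrite E !mulA; congr (_ * _); apply: caA => //; exact: SN.
Qed.

Lemma span_fin3 (l : list (sym X)) :
  (forall f g, In f l -> In g l -> commutes f g) -> (forall f, In f l -> f * f * f = 1) ->
  fin (span (fun f => In f l)).
Proof.
move=> cl cub; have [||||L [_ HL]] := @span_cover3 (fun f => f = 1) l => //.
- by split=> //; split=> [f g -> ->|f ->]; rewrite ?mul1 ?inv1.
- by move=> n f -> _; apply/commutes_sym/commutes1.
exists L => f Sf; have [|g [gL [n [-> ->]]]] := HL f; last by rewrite mul1.
by apply: span_mono Sf => g gl; apply: span_in; right.
Qed.

End SymGroup.

Ltac hgrp H := apply: sym_ext => ?; rewrite /= ?fnK ?fvK;
  do ?[rewrite (opK H) | rewrite fnK | rewrite fvK]; try reflexivity.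

(** * The group generated by the reflections *)

Section Reflections.
Variables (X : Type) (op : X -> X -> X).
Hypothesis Hop : hts op.
Local Notation "a ∘ b" := (op a b) (at level 40, left associativity).
Local Notation opK := (opK Hop).
Local Notation opC := (opC Hop).

Definition sr (a : X) : sym X := Sym (op a) (op a) (opK a) (opK a).

Lemma srV a : (sr a)^-1 = sr a. Proof. by hgrp Hop. Qed.
Lemma sr_mul a : sr a * sr a = 1. Proof. by hgrp Hop. Qed.
Lemma sr_op a b : sr (a ∘ b) = sr a * sr b * sr a.
Proof. by apply: sym_ext => x /=; rewrite -{1}(opK a x) -(opD Hop). Qed.

Definition refl := span (fun f => exists a, f = sr a).
Definition ev := span (fun f => exists a b, f = sr a * sr b).

Lemma refl_sr a : refl (sr a). Proof. by apply: span_in; exists a. Qed.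

Lemma ev_refl f : ev f -> refl f.
Proof.
by apply: span_mono => {}f [a [b ->]]; apply: spanM; exact: refl_sr.
Qed.

Definition aut (f : X -> X) := forall a b, f (a ∘ b) = f a ∘ f b.

Lemma autV (f : sym X) : aut f -> aut f^-1.
Proof. by move=> Hf a b; rewrite -(fnK f (f^-1 a ∘ f^-1 b)) Hf /= !fvK. Qed.

Lemma refl_aut f : refl f -> aut f.
Proof.
elim=> {f}.
- by [].
- by move=> f [c ->] a b /=; rewrite (opD Hop).
- by move=> f g _ Hf _ Hg a b /=; rewrite Hg Hf.
- by move=> f _ Hf; exact: autV.
Qed.

Lemma aut_sr (f : sym X) a : aut f -> f * sr a * f^-1 = sr (f a).
Proof. by move=> Hf; apply: sym_ext => x /=; rewrite Hf fvK. Qed.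

Lemma ev_conj f g : refl f -> ev g -> ev (f * g * f^-1).
Proof.
move=> /refl_aut Hf; apply: span_conj => {}g [a [b ->]].
rewrite (_ : _ * _ = (f * sr a * f^-1) * (f * sr b * f^-1)); last by grp.
by rewrite !aut_sr //; apply: span_in; eexists; eexists.
Qed.

Definition sw (w : list X) := fold_right (fun a f => sr a * f) 1 w.

Lemma sw_app u v : sw (u ++ v) = sw u * sw v.
Proof. by elim: u => [|a u IH] /=; rewrite ?mul1 // IH mulA. Qed.

Lemma sw_rev u : sw (rev u) = (sw u)^-1.
Proof.
elim: u => [|a u IH] /=; first by rewrite inv1.
by rewrite sw_app IH /= mulr1 invM srV.
Qed.

Lemma sw_refl w : refl (sw w).
Proof. by elim: w => [|a w IH] /=; [exact: span1|apply: spanM => //; exact: refl_sr]. Qed.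

Lemma refl_sw f : refl f -> exists w, f = sw w.
Proof.
elim=> {f}.
- by exists [].
- by move=> f [a ->]; exists [a]; rewrite /= mulr1.
- by move=> f g _ [u ->] _ [v ->]; exists (u ++ v); rewrite sw_app.
- by move=> f _ [u ->]; exists (rev u); rewrite sw_rev.
Qed.

Inductive clos (A : X -> Prop) : X -> Prop :=
| clos_in a : A a -> clos A a
| clos_op a b : clos A a -> clos A b -> clos A (a ∘ b).

Definition closed (A : X -> Prop) := forall a b, A a -> A b -> A (a ∘ b).

Lemma clos_min A B : closed B -> (forall a, A a -> B a) -> forall a, clos A a -> B a.
Proof. by move=> cB sAB a; elim=> *; auto. Qed.

Lemma clos_mono (A B : X -> Prop) : (forall a, A a -> B a) -> forall a, clos A a -> clos B a.
Proof. by move=> sAB; apply: clos_min; [exact: clos_op|move=> a /sAB; exact: clos_in]. Qed.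

Lemma fix_closed (f : X -> X) : aut f -> closed (fun a => f a = a).
Proof. by move=> Hf a b Ha Hb; rewrite Hf Ha Hb. Qed.

Variable e : X.

(* The translation by [a] in the loop [xy = e ∘ (x ∘ y)], and the commutator of the
   translations by [y] and [w]. *)
Definition tr (a : X) := sr e * sr a.
Definition Js (y w : X) := sr y * sr e * sr w * sr y * sr e * sr w.

Lemma tr_e a : tr a e = a. Proof. by rewrite /= (opC a) opK. Qed.

Lemma tr_ev a : ev (tr a). Proof. by apply: span_in; exists e, a. Qed.

Lemma refl_tr a : refl (tr a). Proof. exact/ev_refl/tr_ev. Qed.

(** Both [s_e s_a s_e] and [s_a s_e s_a] are the reflection in [e ∘ a], by commutativity of the
    operation. *)
Lemma tr_cube a : tr a * tr a * tr a = 1.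
Proof.
have E : sr e * sr a * sr e = sr a * sr e * sr a by rewrite -!sr_op opC.
rewrite (_ : _ * _ = (sr e * sr a * sr e) * (sr a * sr e * sr a)); last by rewrite /tr; grp.
by rewrite E -sr_op sr_mul.
Qed.

Lemma trV a : (tr a)^-1 = tr a * tr a.
Proof. by symmetry; apply: inv_eq; exact: tr_cube. Qed.

Lemma sr_tr_sr a : sr e * tr a * sr e = (tr a)^-1. Proof. by hgrp Hop. Qed.

Lemma ev_split f : refl f -> ev f \/ ev (sr e * f).
Proof.
have srev g : ev g -> ev (sr e * g * sr e).
  by move=> Hg; rewrite -{2}(srV e); apply: ev_conj => //; exact: refl_sr.
elim=> {f}.
- by left; exact: span1.
- by move=> f [a ->]; right; exact: tr_ev.
- move=> f g _ [Hf|Hf] _ [Hg|Hg].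
  + by left; exact: spanM.
  + right; rewrite (_ : _ * _ = (sr e * f * sr e) * (sr e * g)); last by hgrp Hop.
    by apply: spanM => //; exact: srev.
  + by right; rewrite mulA; exact: spanM.
  + left; rewrite (_ : _ * _ = (sr e * (sr e * f) * sr e) * (sr e * g)); last by hgrp Hop.
    by apply: spanM => //; exact: srev.
- move=> f _ [Hf|Hf]; first by left; exact: spanV.
  right; rewrite (_ : _ * _ = sr e * (sr e * f)^-1 * sr e); last by hgrp Hop.
  by apply: srev; exact: spanV.
Qed.

Lemma ev_tr : forall f, ev f -> span (fun f => exists a, f = tr a) f.
Proof.
apply: span_mono => f [a [b ->]]; rewrite (_ : _ * _ = (tr a)^-1 * tr b); last by hgrp Hop.
by apply: spanM; [apply: spanV|]; apply: span_in; eexists.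
Qed.

Lemma Js_comm y w : Js y w = (tr y)^-1 * (tr w)^-1 * tr y * tr w.
Proof. by hgrp Hop. Qed.

Lemma JsV y w : (Js y w)^-1 = Js w y. Proof. by hgrp Hop. Qed.
Lemma Js_refl y w : refl (Js y w).
Proof. by rewrite /Js; do !apply: spanM; exact: refl_sr. Qed.
Lemma Js_aut y w : aut (Js y w). Proof. exact/refl_aut/Js_refl. Qed.

Lemma Js_e y w : Js y w e = e.
Proof. by rewrite /= (opC w e) opK (opC y w) opK (opC e y) opK. Qed.

Lemma Js_l y w : Js y w y = y.
Proof.
have E : y ∘ (e ∘ (w ∘ y)) = (y ∘ e) ∘ w by rewrite (opC w) (opD Hop) opK.
by rewrite /= E (opC _ w) opK (opC y e) opK (opI Hop).
Qed.

Lemma Js_r y w : Js y w w = w.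
Proof. by rewrite -JsV; have := fnK (Js w y) w; rewrite Js_l. Qed.

Lemma Js_diag y : Js y y = 1. Proof. by hgrp Hop. Qed.

Lemma aut_tr (f : sym X) a : aut f -> f e = e -> f * tr a * f^-1 = tr (f a).
Proof.
move=> Hf fe; rewrite /tr -!aut_sr // -[in RHS]fe -aut_sr //; grp.
Qed.

Lemma Js_tr y w a : Js y w * tr a * (Js y w)^-1 = tr (Js y w a).
Proof. by rewrite aut_tr //; [exact: Js_aut|exact: Js_e]. Qed.

Lemma asc_Jfix x y w : asc op e x y w <-> Js y w x = x.
Proof.
rewrite /asc /=; split=> [->|E]; first by rewrite !opK.
by rewrite -[in RHS]E !opK.
Qed.

Lemma asc_commutes c z : (forall y, asc op e y c z) <-> commutes (tr c) (tr z).
Proof.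
split=> [H|H y]; first by apply: sym_ext => y /=; rewrite H.
by apply: (opIl Hop e); have := f_equal (fun f : sym X => f y) H.
Qed.

Lemma tr_mul a b : tr (e ∘ (a ∘ b)) = (tr a)^-1 * tr b * (tr a)^-1.
Proof. by rewrite /tr !sr_op !invM !srV; hgrp Hop. Qed.

(** [t_w^-1 t_y t_w = t_y J] has cube 1 like [t_y], and [J] commutes with [t_y] because it fixes
    [y]. *)
Lemma Js_cube y w : Js y w * Js y w * Js y w = 1.
Proof.
have cJ : Js y w * tr y = tr y * Js y w.
  by apply: (@mulIr _ (Js y w)^-1); rewrite mulK aut_tr ?Js_l //; [exact: Js_aut|exact: Js_e].
have E : (tr w)^-1 * tr y * tr w = tr y * Js y w by hgrp Hop.
have : ((tr w)^-1 * tr y * tr w) * ((tr w)^-1 * tr y * tr w) * ((tr w)^-1 * tr y * tr w) = 1.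
  rewrite (_ : _ * _ = (tr w)^-1 * (tr y * tr y * tr y) * tr w); last by hgrp Hop.
  by rewrite tr_cube mulr1 mulVl.
rewrite E; set J := Js y w in cJ *; set t := tr y in cJ *.
rewrite (_ : _ * _ = t * (J * t) * (J * t) * J); last by hgrp Hop.
rewrite cJ (_ : _ * _ = t * t * (J * t) * J * J); last by hgrp Hop.
rewrite cJ (_ : _ * _ = t * t * t * (J * J * J)); last by hgrp Hop.
by rewrite tr_cube mul1.
Qed.

End Reflections.

(** * Commuting conjugates of a translation that is central over a subsystem *)

Section Engine.
Variables (X : Type) (op : X -> X -> X).
Hypothesis Hop : hts op.
Variable e : X.
Local Notation "a ∘ b" := (op a b) (at level 40, left associativity).
Local Notation opK := (opK Hop).
Local Notation opC := (opC Hop).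
Local Notation s := (sr Hop).
Local Notation t := (tr Hop e).
Local Notation J := (Js Hop e).
Local Notation asc := (asc op e).

Variables (A : X -> Prop) (x z : X).
Hypothesis zA : forall a b, A a -> A b -> asc a z b.
Hypothesis genX : forall y, clos op (fun u => A u \/ u = x) y.

(** The point [z] is known to be central only within [A]; [cen] collects the points whose
    translation commutes with [t z] on all of [X]. *)
Definition cen c := forall y, asc y c z.

Lemma cenP c : cen c <-> commutes (t c) (t z). Proof. exact: asc_commutes. Qed.

Lemma cen_fix c : cen c <-> forall y, J y z c = c.
Proof. by split=> H y; move: (H y) => /(asc_Jfix Hop) ?; [apply/(asc_Jfix Hop)|]; apply: (asc_swap Hop); [|apply/(asc_Jfix Hop)]. Qed.

Lemma cen_op a b : cen a -> cen b -> cen (a ∘ b).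
Proof. by move=> /cen_fix Ha /cen_fix Hb; apply/cen_fix => y; apply: fix_closed; [exact: Js_aut|exact: Ha|exact: Hb]. Qed.

Lemma cen_e : cen e. Proof. by apply/cen_fix => y; exact: Js_e. Qed.
Lemma cen_z : cen z. Proof. by apply/cen_fix => y; exact: Js_r. Qed.

(** The points associating with [c] and [n] are the fixed points of the automorphism [J c n], hence
    a subsystem. *)
Lemma asc_gen c n : (forall a, A a -> asc a c n) -> asc x c n -> forall y, asc y c n.
Proof.
move=> HA Hx y; apply/(asc_Jfix Hop); elim: (genX y) => {y} [y [/HA|->]|a b _ Ha _ Hb].
- by move/(asc_Jfix Hop).
- exact/(asc_Jfix Hop).
- by apply: fix_closed => //; exact: Js_aut.
Qed.

Lemma asc_third y c w : asc y c w <-> J y c w = w.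
Proof.
split=> [H|/(asc_Jfix Hop)/(asc_swap Hop)//].
by apply/(asc_Jfix Hop)/(asc_swap Hop).
Qed.

(** The points associating with [q] and [w] form a subsystem, which contains [a] by [asc_J]. The
    same law for the loop product [ca] concerns the same [w], since [J z (ca) = J z a]; so [ca], and
    with it [c], lies in the subsystem. *)
Lemma cen_asc_J c a q : cen c -> A a -> asc q c (J z a q).
Proof.
move=> Cc Aa; set w := J z a q.
have mid y : asc q y w <-> J q w y = y.
  by rewrite -(asc_Jfix Hop); split; exact: (asc_swap Hop).
have clo u v : asc q u w -> asc q v w -> asc q (u ∘ v) w.
  by rewrite !mid => Hu Hv; apply: fix_closed => //; exact: Js_aut.
have Pe : asc q e w by rewrite mid; exact: Js_e.
have Pa : asc q a w by exact: (asc_J Hop).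
suff Pca : asc q (e ∘ (c ∘ a)) w.
  rewrite (_ : c = a ∘ (e ∘ (e ∘ (c ∘ a)))); last by rewrite opK (opC c) opK.
  by apply: (clo) => //; apply: clo.
suff E : J z (e ∘ (c ∘ a)) = J z a by rewrite /w -E; exact: (asc_J Hop).
have Jc : J z a c = c by apply/(asc_Jfix Hop)/asc_flip/(asc_swap Hop).
have cJ : J z a * t c = t c * J z a.
  by apply: (@mulIr _ (J z a)^-1); rewrite Js_tr Jc mulK.
rewrite -[RHS](mulK (t c)) cJ 2!(Js_comm Hop) (tr_mul Hop).
by apply: commutator_twist; apply/cenP.
Qed.

Lemma cen_asc_J' c a q : cen c -> A a -> asc q c (J a z q).
Proof.
move=> Cc Aa; have := cen_asc_J (J a z q) Cc Aa; rewrite -(JsV Hop e a z) invK.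
by move=> H; apply: (asc_swap Hop); apply: asc_flip; apply: (asc_swap Hop).
Qed.

(** The last point is [x^-1 · phi x] in the loop. By [asc_gen] it is tested on generators: on [A] by
    [asc_shift], since [phi] maps [ax] to [a · phi x]; on [x] because the points associating with
    [x] and [c] form a subsystem containing [e], [x] and [phi x]. *)
Lemma cen_quotient (phi : sym X) c : aut op phi -> phi e = e -> (forall a, A a -> phi a = a) ->
  (forall q, asc q c (phi q)) -> commutes (t c) (t (e ∘ ((e ∘ x) ∘ phi x))).
Proof.
move=> Hphi phie phiA H; apply/(asc_commutes Hop); apply: asc_gen => [a Aa|].
  apply: (asc_shift Hop); first exact: H.
  by have := H (e ∘ (a ∘ x)); rewrite !Hphi phie phiA.
have closed_asc : closed op (fun w => asc x c w).
  move=> u v /asc_third Hu /asc_third Hv; apply/asc_third; apply: fix_closed => //; exact: Js_aut.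
have asce : asc x c e by apply/asc_third; exact: Js_e.
have ascx : asc x c x by apply/asc_third; exact: Js_l.
by apply: (closed_asc) => //; apply: (closed_asc) => //; exact: closed_asc.
Qed.

Definition G u := A u \/ u = x.

(** For [g] and [h] in [A], the map [J g h] fixes [z]. If one of them is [x], [J_cycle] turns the
    quotient of [J g h z] by [z] into that of an image of [x] by [x], under [J z g] or [J h z];
    these fix [A] pointwise, and [cen_quotient] applies. *)
Lemma cen_comm_J g h c : G g -> G h -> cen c -> commutes (t c) (t (J g h z)).
Proof.
have A_fix g' h' : A g' -> A h' -> J g' h' z = z.
  by move=> Ag Ah; apply/(asc_Jfix Hop); apply: (asc_swap Hop); exact: zA.
have A_fix' a : A a -> (forall b, A b -> J z a b = b) /\ (forall b, A b -> J a z b = b).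
  by move=> Aa; split=> b Ab; apply/(asc_Jfix Hop); [|apply: asc_flip]; exact: zA.
have shift m : cen c -> commutes (t c) (t (e ∘ ((e ∘ z) ∘ m))) -> commutes (t c) (t m).
  move=> /cenP cz cn; rewrite (_ : m = e ∘ (z ∘ (e ∘ ((e ∘ z) ∘ m)))).
    rewrite (tr_mul Hop); apply: commutesM; [apply: commutesM => //|]; exact: commutesV.
  by rewrite (opD Hop e z) opK !opK.
move=> [Ag|->] [Ah|->] Cc.
- by rewrite A_fix //; apply/cenP.
- apply: shift => //; rewrite -(J_cycle Hop).
  by apply: (@cen_quotient (J z g)) => [||a Aa|q]; [exact: Js_aut|exact: Js_e|exact: (proj1 (A_fix' g Ag))|exact: cen_asc_J].
- apply: shift => //; rewrite -2!(J_cycle Hop).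
  by apply: (@cen_quotient (J h z)) => [||a Aa|q]; [exact: Js_aut|exact: Js_e|exact: (proj2 (A_fix' h Ah))|exact: cen_asc_J'].
- by rewrite Js_diag; apply/cenP.
Qed.

Lemma cen_J g h c : G g -> G h -> cen c -> cen (J g h c).
Proof.
move=> Gg Gh Cc; apply/cenP.
have := commutesJ (J g h) (cen_comm_J Gh Gg Cc).
rewrite !Js_tr.
by rewrite -(JsV Hop e g h) invKr.
Qed.

(** Conjugating [t c] by a generator [t h] gives [t c * J c h], hence the second kind of
    generators. *)
Definition cen_grp_gen (f : sym X) := exists c, cen c /\ (f = t c \/ exists h, G h /\ f = J c h).
Definition cen_grp := span cen_grp_gen.

Lemma cen_grp_commutes f : cen_grp f -> commutes (t z) f.
Proof.
apply: span_commutes => {}f [c [Cc [->|[h [Gh ->]]]]]; first by apply/commutes_sym/cenP.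
have Jz : J c h z = z by apply/(asc_Jfix Hop)/asc_flip; apply: (asc_swap Hop); apply: asc_flip.
apply: (@mulIr _ (J c h)^-1); rewrite mulK.
by rewrite Js_tr Jz.
Qed.

Lemma cen_grp_t c : cen c -> cen_grp (t c).
Proof. by move=> Cc; apply: span_in; exists c; split=> //; left. Qed.

Lemma cen_grp_J c h : cen c -> G h -> cen_grp (J c h).
Proof. by move=> Cc Gh; apply: span_in; exists c; split=> //; right; exists h. Qed.

Lemma cen_grp_conj g f : G g -> cen_grp f -> cen_grp ((t g)^-1 * f * t g).
Proof.
move=> Gg; rewrite -{2}(invV (t g)); apply: span_conj => {}f [c [Cc [->|[h [Gh ->]]]]]; rewrite invV.
  rewrite (_ : _ * _ = t c * J c g); last by hgrp Hop.
  by apply: spanM; [exact: cen_grp_t|exact: cen_grp_J].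
set g1 := J h c g; pose r := (e ∘ g) ∘ g1.
(* Rotated twice, [r] becomes [(e ∘ c) ∘ J g h c], a combination of points of [cen]. *)
have Cr : cen r.
  by rewrite /r /g1 2!(J_cycle Hop); apply: cen_op; [apply: cen_op => //; exact: cen_e|exact: cen_J].
have E : (J c h)^-1 * (t g)^-1 * J c h * t g = t r * J g r.
  have -> : (J c h)^-1 * (t g)^-1 * J c h * t g = (J h c * t g * (J h c)^-1)^-1 * t g by hgrp Hop.
  rewrite Js_tr -/g1.
  by apply: sym_ext => y; have := op_op_translation Hop e g1 g y; rewrite -/r /= => <-; rewrite opK.
rewrite (_ : _ * _ = J c h * ((J c h)^-1 * (t g)^-1 * J c h * t g)); last by hgrp Hop.
rewrite E; apply: spanM; first exact: cen_grp_J.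
apply: spanM; first exact: cen_grp_t.
by rewrite -JsV; apply: spanV; exact: cen_grp_J.
Qed.

Definition normalizes (m : sym X) :=
  (forall f, cen_grp f -> cen_grp (m * f * m^-1)) /\ (forall f, cen_grp f -> cen_grp (m^-1 * f * m)).

Lemma normalizes_subgrp : subgrp normalizes.
Proof.
split; first by split=> f; rewrite ?inv1 mul1 mulr1.
split=> [m n [m1 m2] [n1 n2]|m [m1 m2]].
  split=> f /= Hf.
    by rewrite (_ : _ * _ = m * (n * f * n^-1) * m^-1); [auto|grp].
  by rewrite (_ : _ * _ = n^-1 * (m^-1 * f * m) * n); [auto|grp].
by split=> f Hf; rewrite invV; auto.
Qed.

Lemma normalizes_t a : normalizes (t a).
Proof.
elim: (genX a) => {a} [g Gg|a b _ Ha _ Hb].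
  split=> f Hf; last exact: cen_grp_conj.
  rewrite -(invV (t g)) (trV Hop) invM.
  rewrite (_ : _ * _ = (t g)^-1 * ((t g)^-1 * f * t g) * t g); last by grp.
  by apply: (cen_grp_conj) => //; exact: cen_grp_conj.
have [_ [NM NV]] := normalizes_subgrp.
rewrite (_ : t _ = t a * (t b)^-1 * t a); first by apply: (NM) => //; apply: (NM) => //; exact: NV.
by rewrite {1}/tr (sr_op Hop); hgrp Hop.
Qed.

(* [cen_grp] contains [t z] and is centralized by it; all even products of reflections
   normalize it. *)
Theorem conjugates_commute m : refl Hop m -> commutes (t z) (m * t z * m^-1).
Proof.
have [N1 [NM NV]] := normalizes_subgrp.
have Nev f : ev Hop f -> normalizes f.
  move/(ev_tr e); apply: (span_min normalizes_subgrp) => {}f [a ->]; exact: normalizes_t.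
have tz := cen_grp_t cen_z.
move=> Hm; case: (ev_split e Hm) => [/Nev [H _]|Hev].
  by apply: cen_grp_commutes; exact: H.
(* For odd [m] the product [m * s e] is even, and [s e] inverts [t z]. *)
have /Nev [H _] : ev Hop (m * s e).
  by rewrite (_ : _ * _ = s e * (s e * m) * (s e)^-1); [apply: (ev_conj (refl_sr Hop e))|hgrp Hop].
rewrite (_ : _ * _ = ((m * s e) * t z * (m * s e)^-1)^-1); last by hgrp Hop.
apply: cen_grp_commutes; apply: spanV; exact: H.
Qed.

End Engine.

(** * Central elements of finite systems *)

Lemma sig_eq (X : Type) (P : X -> Prop) (u v : sig P) : proj1_sig u = proj1_sig v -> u = v.
Proof.
case: u v => [u Pu] [v Pv] /= E; subst; f_equal; exact: proof_irrelevance.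
Qed.

Definition sub_op (X : Type) (op : X -> X -> X) (A : X -> Prop) (cA : closed op A) (u v : sig A) : sig A :=
  exist A (op (proj1_sig u) (proj1_sig v)) (cA _ _ (proj2_sig u) (proj2_sig v)).

Lemma sub_hts (X : Type) (op : X -> X -> X) (A : X -> Prop) (cA : closed op A) :
  hts op -> hts (sub_op cA).
Proof.
move=> [C [I [K D]]]; split; first by move=> u v; apply: sig_eq; exact: C.
split; first by move=> u; apply: sig_eq; exact: I.
by split=> [u v|u v w]; apply: sig_eq; [exact: K|exact: D].
Qed.

Lemma sub_clos (X : Type) (op : X -> X -> X) (A B : X -> Prop) (cA : closed op A) :
  (forall x, B x -> A x) ->
  forall x, clos op B x -> forall Ax : A x, clos (sub_op cA) (fun u => B (proj1_sig u)) (exist A x Ax).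
Proof.
move=> sBA x; elim=> {x} [x Bx Ax|a b ca IHa cb IHb Ax]; first exact: clos_in.
have Aa : A a by move: ca; apply: clos_min.
have Ab : A b by move: cb; apply: clos_min.
rewrite (_ : exist _ _ _ = sub_op cA (exist A a Aa) (exist A b Ab)); last exact: sig_eq.
exact: clos_op.
Qed.

Lemma sub_cover (X : Type) (A : X -> Prop) (l : list X) :
  exists l' : list (sig A), length l' <= length l /\
    ((exists x, In x l /\ ~ A x) -> length l' < length l) /\
    forall u, In (proj1_sig u) l -> In u l'.
Proof.
elim: l => [|a l [l' [len [lt Hl']]]]; first by exists []; split=> //; split=> // [[x []]].
case: (classic (A a)) => [Aa|nAa].
  exists (exist A a Aa :: l'); split; first by move=> /=; lia.
  split=> [[x [[E|xl] nAx]]|u /= [E|/Hl' ?]] /=; [by subst| |by left; apply: sig_eq|by right].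
  have : length l' < length l by apply: lt; exists x.
  lia.
exists l'; split; first by move=> /=; lia.
split=> [_|u /= [E|/Hl' //]] /=; first lia.
by case: nAa; rewrite E; exact: proj2_sig.
Qed.

(** The laws are assumed only modulo [R], because in the loop they hold only modulo the centre.
    Classes are represented by chosen members, so that the quotient is a subset type. *)
Lemma hts_quotient (X : Type) (op : X -> X -> X) (R : X -> X -> Prop) :
  (forall x, R x x) -> (forall x y, R x y -> R y x) -> (forall x y z, R x y -> R y z -> R x z) ->
  (forall x x' y y', R x x' -> R y y' -> R (op x y) (op x' y')) ->
  (forall x y, R (op x y) (op y x)) -> (forall x, R (op x x) x) ->
  (forall x y, R (op x (op x y)) y) ->
  (forall x y z, R (op x (op y z)) (op (op x y) (op x z))) ->
  exists (Y : Type) (opY : Y -> Y -> Y) (pi : X -> Y),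
    hts opY /\ (forall y, exists x, pi x = y) /\
    (forall x y, pi (op x y) = opY (pi x) (pi y)) /\ (forall x y, pi x = pi y <-> R x y).
Proof.
move=> Rr Rs Rt Rc RC RI RK RD.
pose rep x := epsilon (inhabits x) (R x).
have Rrep x : R x (rep x) by apply: epsilon_spec; exists x.
have repE x y : R x y -> rep x = rep y.
  move=> Rxy; rewrite /rep (_ : R x = R y); last first.
    apply: functional_extensionality => z; apply: propositional_extensionality.
    by split; [move/Rs in Rxy|]; exact: Rt.
  by rewrite (proof_irrelevance _ (inhabits x) (inhabits y)).
pose Y := {x | rep x = x}.
have repK x : rep (rep x) = rep x by apply: repE; exact: Rs.
pose pi x : Y := exist _ (rep x) (repK x).
have piE x y : pi x = pi y <-> R x y.
  split=> [[E]|/repE E]; last exact: sig_eq.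
  by apply: Rt (Rrep x) _; rewrite E; exact: Rs.
have pis (y : Y) : pi (proj1_sig y) = y by apply: sig_eq; exact: (proj2_sig y).
have [C [I [K D]]] : hts (fun u v : Y => pi (op (proj1_sig u) (proj1_sig v))).
  have E u (y : Y) : R (op u (rep (proj1_sig y))) (op u (proj1_sig y)).
    by apply: Rc => //; exact: Rs.
  split; first by move=> u v; apply/piE.
  split; first by move=> u; rewrite -[RHS]pis; apply/piE.
  split=> [u v|u v w]; first rewrite -[RHS]pis; apply/piE => /=.
    by apply: Rt (RK _ _); apply: Rc => //; exact: Rs.
  apply: (Rt _ (op (proj1_sig u) (op (proj1_sig v) (proj1_sig w)))); first by apply: Rc => //; exact: Rs.
  by apply: Rt (RD _ _ _) _; apply: Rc.
exists Y, (fun u v : Y => pi (op (proj1_sig u) (proj1_sig v))), pi; split=> //.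
split; first by move=> y; exists (proj1_sig y).
by split=> // x y; apply/piE => /=; apply: Rc.
Qed.

(** * Normal subgroups of the reflection group and quotient systems *)

Section Normal.
Variables (X : Type) (op : X -> X -> X).
Hypothesis Hop : hts op.
Local Notation "a ∘ b" := (op a b) (at level 40, left associativity).
Local Notation opK := (opK Hop).
Local Notation opC := (opC Hop).
Local Notation s := (sr Hop).

Definition normal (N : sym X -> Prop) :=
  subgrp N /\ (forall f, N f -> refl Hop f) /\ (forall a f, N f -> N (s a * f * s a)).

Lemma normal_conj N m f : normal N -> refl Hop m -> N f -> N (m * f * m^-1).
Proof.
move=> [_ [_ NJ]] /refl_sw [w ->]; elim: w f => [|a w IH] f Nf /=; first by rewrite inv1 mulr1 mul1.
rewrite invM srV (_ : _ * _ = s a * (sw Hop w * f * (sw Hop w)^-1) * s a); last by rewrite !mulA.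
by apply: NJ; exact: IH.
Qed.

Lemma normal_conjV N m f : normal N -> refl Hop m -> N f -> N (m^-1 * f * m).
Proof. by move=> nN Rm; rewrite -{2}(invV m); apply: normal_conj => //; exact: spanV. Qed.

Lemma normal_quotient N : normal N -> exists (Y : Type) (opY : Y -> Y -> Y) (pi : X -> Y),
    hts opY /\ (forall y, exists x, pi x = y) /\
    (forall x y, pi (x ∘ y) = opY (pi x) (pi y)) /\
    (forall x y, pi x = pi y <-> exists n, N n /\ n x = y).
Proof.
move=> nN; have [[N1 [NM NV]] [NR NJ]] := nN.
have Rt x y z : (exists n, N n /\ n x = y) -> (exists n, N n /\ n y = z) -> exists n, N n /\ n x = z.
  by move=> [n [Nn <-]] [m [Nm <-]]; exists (m * n); split=> //; exact: NM.
have Rs x y : (exists n, N n /\ n x = y) -> exists n, N n /\ n y = x.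
  by move=> [n [Nn <-]]; exists n^-1; split; [exact: NV|rewrite invK].
have Rc x y y' : (exists n, N n /\ n y = y') -> exists n, N n /\ n (x ∘ y) = x ∘ y'.
  by move=> [n [Nn <-]]; exists (s x * n * s x); split; [exact: NJ|rewrite /= opK].
have Rr x y : x = y -> exists n, N n /\ n x = y by move=> <-; exists 1.
apply: hts_quotient.
- by move=> x; exact: Rr.
- exact: Rs.
- exact: Rt.
- move=> x x' y y' Rx Ry; apply: (Rt _ (x ∘ y')); first exact: Rc.
  by rewrite !(opC _ y'); exact: Rc.
- by move=> x y; apply: Rr; exact: opC.
- by move=> x; apply: Rr; exact: opI.
- by move=> x y; apply: Rr; exact: opK.
- by move=> x y z; apply: Rr; exact: opD.
Qed.

(** [k s_a k^-1] is the reflection in [k a = n a], hence equal to [n s_a n^-1], and the commutator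
    of [n] with [s_a] lies in [N]. *)
Lemma normal_sr_sr N k : normal N -> refl Hop k ->
  forall a, (exists n, N n /\ n a = k a) -> N (k * s a * k^-1 * s a).
Proof.
move=> [[N1 [NM NV]] [NR NJ]] Rk a [n [Nn na]].
rewrite aut_sr; last exact: refl_aut Rk.
rewrite -na -aut_sr; last exact: refl_aut (NR n Nn).
rewrite (_ : _ * _ = n * (s a * n^-1 * s a)); last by hgrp Hop.
by apply: NM => //; apply: NJ; exact: NV.
Qed.

Lemma normal_commutator N (S : sym X -> Prop) k : normal N ->
  (forall m, S m -> refl Hop m) -> (forall m, S m -> N (k * m * k^-1 * m^-1)) ->
  forall m, span S m -> N (k * m * k^-1 * m^-1).
Proof.
move=> nN SR SN m Sm; have [[N1 [NM NV]] [NR NJ]] := nN.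
have Rm f : span S f -> refl Hop f by apply: span_mono => {}f; exact: SR.
elim: Sm => {m} [||m n Hm IHm Hn IHn|m Hm IHm].
- by rewrite (_ : _ * _ = 1) //; grp.
- exact: SN.
- rewrite (_ : _ * _ = (k * m * k^-1 * m^-1) * (m * (k * n * k^-1 * n^-1) * m^-1)); last by grp.
  by apply: NM => //; apply: normal_conj => //; exact: Rm.
- rewrite (_ : _ * _ = m^-1 * (k * m * k^-1 * m^-1)^-1 * m); last by grp.
  by apply: normal_conjV => //; [exact: Rm|exact: NV].
Qed.

Definition conjugates (f0 f : sym X) := exists m, refl Hop m /\ f = m * f0 * m^-1.

Lemma conjugates_refl f0 f : refl Hop f0 -> conjugates f0 f -> refl Hop f.
Proof. by move=> R0 [m [Rm ->]]; do !apply: spanM => //; exact: spanV. Qed.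

Lemma normal_closure f0 : refl Hop f0 -> normal (span (conjugates f0)).
Proof.
move=> R0; split; first exact: span_subgrp.
split; first by apply: span_mono => f; exact: conjugates_refl.
move=> a f; rewrite -{2}(srV Hop a); apply: span_conj => {}f [m [Rm ->]].
apply: span_in; exists (s a * m); split; first by apply: spanM => //; exact: refl_sr.
by grp.
Qed.

Lemma closure_abelian f0 : (forall m, refl Hop m -> commutes f0 (m * f0 * m^-1)) ->
  forall f g, span (conjugates f0) f -> span (conjugates f0) g -> commutes f g.
Proof.
move=> H; apply: span_abelian => f g [m [Rm ->]] [m' [Rm' ->]].
have Rmm : refl Hop (m^-1 * m') by apply: spanM => //; exact: spanV.
have := commutesJ m (H _ Rmm).
by rewrite (_ : m * (_ * _ * _) * m^-1 = m' * f0 * m'^-1) //; grp.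
Qed.

Lemma closure_cube f0 : (forall m, refl Hop m -> commutes f0 (m * f0 * m^-1)) ->
  f0 * f0 * f0 = 1 -> forall f, span (conjugates f0) f -> f * f * f = 1.
Proof.
move=> H c3 f; have ab := closure_abelian H; elim=> {f}.
- by rewrite !mul1.
- move=> f [m [_ ->]]; rewrite (_ : _ * _ = m * (f0 * f0 * f0) * m^-1); last by grp.
  by rewrite c3 mulr1 mulV.
- by move=> f g Wf Hf Wg Hg; rewrite (commutes_cube (ab f g Wf Wg)) Hf Hg mul1.
- by move=> f _ Hf; rewrite -!invM mulA Hf inv1.
Qed.

End Normal.

(** * Centralizers of minimal normal subgroups of exponent 3 *)

Section MinimalNormal.
Variables (X : Type) (op : X -> X -> X).
Hypothesis Hop : hts op.
Local Notation s := (sr Hop).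
Variable W : sym X -> Prop.
Hypotheses (nW : normal Hop W) (W_nontrivial : exists w, W w /\ w <> 1).
Hypothesis abW : forall f g, W f -> W g -> commutes f g.
Hypothesis cubeW : forall f, W f -> f * f * f = 1.
Hypothesis minW : forall N, normal Hop N -> (exists w, N w /\ w <> 1) ->
  (forall f, N f -> W f) -> forall f, W f -> N f.

Definition centralizer (f : sym X) := refl Hop f /\ forall w, W w -> commutes f w.

Lemma centralizer_normal : normal Hop centralizer.
Proof.
have [C1 [CM CV]] := centralizer_subgrp W.
split; [split|split].
- by split; [exact: span1|exact: C1].
- split=> [f g [Rf Hf] [Rg Hg]|f [Rf Hf]].
    by split; [exact: spanM|exact: CM].
  by split; [exact: spanV|exact: CV].
- by move=> f [].
- move=> a f [Rf Hf]; split; first by apply: spanM; [apply: spanM => //|]; exact: refl_sr.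
  move=> w Ww; rewrite -{2}(srV Hop a).
  have /(commutesJ (s a)) : commutes f ((s a)^-1 * w * s a).
    by apply: Hf; apply: (normal_conjV _ nW) => //; exact: refl_sr.
  by rewrite !mulA mulV mul1 mulK.
Qed.

(* [k] acts on [W] as an operator of order 3 in characteristic 3, so it has nontrivial
   fixed points; they form a normal subgroup. *)
Lemma centralizer_cube k : refl Hop k -> k * k * k = 1 ->
  (forall a, exists c, centralizer c /\ (s a * k * s a = k * c \/ s a * k * s a = k^-1 * c)) ->
  centralizer k.
Proof.
move=> Rk k3 Hk; split=> //.
have [[W1 [WM WV]] [WR WJ]] := nW.
suff : forall w, W w -> W w /\ commutes k w by move=> H w /H [].
apply: (minW (N := fun w => W w /\ commutes k w)); last by move=> f [].
- split; [split|split].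
  + by split=> //; exact: commutes1.
  + split=> [f g [Wf Hf] [Wg Hg]|f [Wf Hf]]; first by split; [exact: WM|exact: commutesM].
    by split; [exact: WV|exact: commutesV].
  + by move=> f [/WR].
  + move=> a f [Wf kf]; split; first exact: WJ.
    have [c [[_ /(_ f Wf) cf] E]] := Hk a.
    have : commutes (s a * k * s a) f.
      case: E => ->; apply/commutes_sym/commutesM; try exact: commutes_sym.
      by apply: commutesV; exact: commutes_sym.
    move/(commutesJ (s a)); rewrite srV.
    rewrite (_ : s a * (s a * k * s a) * s a = (s a * s a) * k * (s a * s a)); last by rewrite !mulA.
    by rewrite sr_mul mul1 mulr1.
have [w [Ww nw]] := W_nontrivial.
pose b := k * w * k^-1; pose c := k * b * k^-1.
have Wb : W b by exact: (normal_conj _ nW).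
have Wc : W c by exact: (normal_conj _ nW).
have cw : k * c * k^-1 = w.
  rewrite (_ : _ * _ = (k * k * k) * w * (k * k * k)^-1); last by rewrite /c /b; grp.
  by rewrite k3 inv1 mul1 mulr1.
have comm_of f : k * f * k^-1 = f -> commutes k f.
  by move=> E; rewrite /commutes -{2}E mulKV.
have W_wbc : W (w * b * c) by apply: (WM) => //; exact: WM.
have wb := abW Ww Wb; have wc := abW Ww Wc.
(* Additively, [(k - 1)^3 = k^3 - 1 = 0] on [W], while [w^-1 * b] is [(k - 1) w] and [w * b * c] is
   [(k - 1)^2 w]. The last nontrivial one among [w] and these two is fixed by [k]. *)
case: (classic (w * b * c = 1)) => [E|ne]; last first.
  exists (w * b * c); split=> //; split=> //; apply: comm_of.
  rewrite (_ : _ * _ = b * c * (k * c * k^-1)); last by rewrite /c /b; grp.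
  rewrite cw -mulA -wc mulA -wb //.
case: (classic (w^-1 * b = 1)) => [E'|ne].
  have bE : w = b by apply: (@mulIl _ w^-1); rewrite mulVl E'.
  exists w; split=> //; split=> //; apply: comm_of; by rewrite -/b -bE.
exists (w^-1 * b); split=> //; split; first by apply: WM => //; exact: WV.
apply: comm_of.
rewrite (_ : _ * _ = b^-1 * c); last by rewrite /c /b; grp.
have cE : c = (w * b)^-1 by apply: (@mulIl _ (w * b)); rewrite E mulV.
rewrite cE invM mulA; have b3 := cubeW Wb.
rewrite (cube_inv b3).
by apply: commutesV; exact: commutes_sym.
Qed.

End MinimalNormal.

Definition small (X : Type) n := exists l : list X, length l <= n /\ forall x, In x l.

Lemma fin_sym (X : Type) : fin (fun _ : X => True) -> fin (fun _ : sym X => True).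
Proof.
move=> finX; have [l Hl] := finX; have [L HL] := fin_functions l finX.
apply: (@fin_inj _ _ (@fn X) _ (fun _ => True)) => //.
  by move=> f g _ _ E; apply: sym_ext => x; rewrite E.
exists L => f _; have [|g [gL fg]] := HL f; first by [].
rewrite (_ : f = g) //; apply: functional_extensionality => x; apply: fg; exact: Hl.
Qed.

Lemma small_fin X n : small X n -> fin (fun _ : X => True).
Proof. by move=> [l [_ Hl]]; exists l. Qed.

Lemma small_quotient (X Y : Type) (pi : X -> Y) n x y : small X (S n) ->
  (forall y, exists x, pi x = y) -> x <> y -> pi x = pi y -> small Y n.
Proof.
move=> [l [len Hl]] surj ne E; exists (map pi (remove (@eq_dec X) x l)); split.
  by rewrite length_map; have := remove_length_lt (@eq_dec X) l x (Hl x); lia.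
move=> v; have [u <-] := surj v; case: (classic (u = x)) => [->|nu].
  by rewrite E; apply: in_map; apply: in_in_remove => // E'; apply: ne.
by apply: in_map; apply: in_in_remove.
Qed.

Lemma least (P : nat -> Prop) : (exists n, P n) -> exists n, P n /\ forall m, m < n -> ~ P m.
Proof.
move=> [n]; elim/(well_founded_induction lt_wf): n => n IH Pn.
case: (classic (exists m, m < n /\ P m)) => [[m [lt Pm]]|none]; first exact: (IH m).
by exists n; split=> // m lt Pm; apply: none; exists m.
Qed.

Lemma small_sub (X : Type) (A : X -> Prop) n x : small X (S n) -> ~ A x -> small (sig A) n.
Proof.
move=> [l [len Hl]] nAx; have [l' [_ [lt Hl']]] := sub_cover A l.
exists l'; split; last by move=> u; exact: Hl'.
have : length l' < length l by apply: lt; exists x.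
lia.
Qed.

(* With [X] generated by a proper subsystem [A] and one element, a central [z] of [A]
   yields a minimal normal subgroup [W] of exponent 3.  A central element [c] modulo the
   centralizer [C] of [W] would lie in [C], so [C] is transitive and [W] is central. *)
Lemma central_exists n : forall (X : Type) (op : X -> X -> X) (Hop : hts op) (e : X),
  small X n -> (exists x, x <> e) -> exists z, z <> e /\ forall a b, asc op e a z b.
Proof.
elim: n => [|n IH] X op Hop e smX [x0 x0e].
  by case: smX => [[|? ?] [/= len Hl]]; [case: (Hl e)|lia].
(* A generating list of least length, not counting [e]: dropping one member leaves a proper
   subsystem [A], to which induction applies. *)
have [m [[g [gm gen]] gmin]] : exists m, (exists g, length g = m /\ forall y, clos op (fun u => u = e \/ In u g) y) /\
    forall m', m' < m -> ~ exists g, length g = m' /\ forall y, clos op (fun u => u = e \/ In u g) y.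
  apply: least; case: smX => [l [_ Hl]]; exists (length l), l; split=> // y.
  by apply: clos_in; right.
case: g gm gen => [|x g] gm gen.
  case: x0e; elim: (gen x0) => {x0} [a [|[]] //|a b _ -> _ ->]; exact: (opI Hop).
pose A := clos op (fun u => u = e \/ In u g).
have cA : closed op A by move=> a b; exact: clos_op.
have Ae : A e by apply: clos_in; left.
have nAx : ~ A x.
  move=> Ax; apply: (gmin (length g)); first by rewrite -gm /=; lia.
  exists g; split=> // y; elim: (gen y) => {y} [a [->//|[<-//|Ha]]|a b _ Ha _ Hb]; last exact: clos_op.
  by apply: clos_in; right.
have genX y : clos op (fun u => A u \/ u = x) y.
  move: (gen y); apply: clos_mono => u [->|[->|Hu]]; [by left|by right|left].
  by apply: clos_in; right.
case: (classic (exists a, A a /\ a <> e)) => [[a [Aa ae]]|Atriv]; last first.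
  (* [J x b] fixes [e] and [x], hence all of the system that they generate. *)
  exists x; split; first by move=> E; apply: nAx; rewrite E.
  move=> a b; apply/(asc_Jfix Hop); elim: (genX a) => {a} [a [Aa|->]|a c _ Ha _ Hc].
  - rewrite (_ : a = e); last by apply: NNPP => ne; apply: Atriv; exists a.
    exact: Js_e.
  - exact: Js_l.
  - by apply: fix_closed => //; exact: Js_aut.
have [||[z Az] [ze zA]] := IH (sig A) (sub_op cA) (sub_hts cA Hop) (exist A e Ae).
- exact: small_sub smX nAx.
- by exists (exist A a Aa) => -[].
have {}ze : z <> e by move=> E; apply: ze; exact: sig_eq.
have {}zA u v : A u -> A v -> asc op e u z v.
  by move=> Au Av; have := f_equal (@proj1_sig _ _) (zA (exist A u Au) (exist A v Av)).
have zconj := @conjugates_commute X op Hop e A x z zA genX.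
pose W0 := span (conjugates Hop (tr Hop e z)).
have nW0 : normal Hop W0 by apply: normal_closure; exact: refl_tr.
have W0z : W0 (tr Hop e z) by apply: span_in; exists 1; split; [exact: span1|rewrite mul1 inv1 mulr1].
have tz1 : tr Hop e z <> 1.
  by move=> E; apply: ze; rewrite -(tr_e Hop e z) E.
have finX := small_fin smX.
have [||W [[nW Wne] [WW0 Wmin]]] := @fin_minimal _ (fun N => normal Hop N /\ exists w, N w /\ w <> 1) W0.
- by split=> //; exists (tr Hop e z).
- by apply: fin_sub (fin_sym finX).
have abW f f' : W f -> W f' -> commutes f f'.
  by move=> /WW0 Wf /WW0 Wg; exact: (closure_abelian zconj).
have cubeW f : W f -> f * f * f = 1.
  by move=> /WW0; apply: (closure_cube zconj); exact: tr_cube.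
have minW N : normal Hop N -> (exists w, N w /\ w <> 1) -> (forall f, N f -> W f) -> forall f, W f -> N f.
  by move=> nN Nne; exact: Wmin.
pose C := centralizer Hop W.
have nC : normal Hop C := centralizer_normal nW.
have [[C1 [CM CV]] [CR CJ]] := nC.
have CW f : W f -> C f.
  by move=> Wf; split; [case: nW => _ [WR _]; exact: WR|move=> f'; exact: abW].
have [Y [opY [pi [HopY [surj [hom piE]]]]]] := normal_quotient nC.
have [w [Ww w1]] := Wne.
have Rw : refl Hop w by case: nW => _ [WR _]; exact: WR.
(* If [C] is transitive, every translation lies in it and [w e] is central. Otherwise induction
   applies to the quotient by [C], smaller because [w] moves a point, and ends in a
   contradiction. *)
case: (classic (exists y, y <> pi e)) => [ynt|Ytriv]; last first.
  have Ct u : C (tr Hop e u).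
    have [c [Cc ce]] : exists c, C c /\ c e = u.
      by apply/piE; symmetry; apply: NNPP => ne; apply: Ytriv; exists (pi u).
    rewrite (_ : tr Hop e u = (sr Hop e * c * sr Hop e) * c^-1).
      by apply: CM; [exact: CJ|exact: CV].
    rewrite /tr -ce -(aut_sr Hop _ _ (refl_aut (CR c Cc))).
    by rewrite !mulA.
  have wt u : commutes w (tr Hop e u) by apply: commutes_sym; exact: (proj2 (Ct u)).
  exists (w e); split.
    move=> we; apply: w1; apply: sym_ext => u.
    have := f_equal (fun f : sym X => f e) (wt u).
    change (w (tr Hop e u e) = tr Hop e u (w e) -> w u = u).
    by rewrite we tr_e.
  move=> v b; apply: (proj2 (asc_commutes Hop e (w e) b)).
  rewrite (_ : tr Hop e (w e) = (sr Hop e * w * sr Hop e) * w^-1); last first.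
    by rewrite /tr -(aut_sr Hop _ _ (refl_aut Rw)) !mulA.
  apply/commutes_sym/commutesM; last exact/commutesV/commutes_sym.
  have := commutesJ (sr Hop e) (commutesV (wt b)).
  rewrite !srV (_ : sr Hop e * (tr Hop e b)^-1 * sr Hop e = tr Hop e b); first exact: commutes_sym.
  by rewrite -(sr_tr_sr Hop e b) !mulA sr_mul mul1 -mulA sr_mul mulr1.
have [x1 wx1] : exists x1, x1 <> w x1.
  apply: NNPP => none; apply: w1; apply: sym_ext => u /=.
  by apply: NNPP => ne; apply: none; exists u => E; apply: ne.
have smY : small Y n.
  by apply: (small_quotient pi smX surj wx1); apply/piE; exists w; split=> //; exact: CW.
have [c' [c'e Hc']] := IH Y opY HopY (pi e) smY ynt.
have [c cE] := surj c'; rewrite -{}cE in c'e Hc'.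
have kern k : refl Hop k -> (forall u, pi (k u) = pi u) -> forall a, C (k * sr Hop a * k^-1 * sr Hop a).
  move=> Rk Hk u; apply: normal_sr_sr => //; apply/piE; by rewrite Hk.
(* [J c b] induces the identity on the quotient, so it commutes with the reflections modulo [C]. *)
have CJs b : C (Js Hop e c b).
  apply: (centralizer_cube nW _ abW cubeW minW); [by exists w|exact: Js_refl|exact: Js_cube|].
  move=> u; exists ((Js Hop e c b)^-1 * (sr Hop u * Js Hop e c b * sr Hop u)); split; last by left; rewrite mulKl.
  have -> : (Js Hop e c b)^-1 * (sr Hop u * Js Hop e c b * sr Hop u) =
     (Js Hop e c b)^-1 * sr Hop u * (Js Hop e c b)^-1^-1 * sr Hop u by rewrite invV !mulA.
  apply: kern; first by apply: spanV; exact: Js_refl.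
  move=> v; rewrite JsV /= !hom.
  apply/(asc_Jfix HopY (pi e) (pi v) (pi b) (pi c)); apply: asc_flip; exact: Hc'.
(* Each [s_u] inverts [t c] up to a conjugate of the inverse of [J c u], now known to lie in [C]. *)
have : C (tr Hop e c).
  apply: (centralizer_cube nW _ abW cubeW minW); [by exists w|exact: refl_tr|exact: tr_cube|].
  move=> u; exists (tr Hop e c * (Js Hop e c u)^-1 * (tr Hop e c)^-1); split.
    by apply: (normal_conj _ nC); [exact: refl_tr|exact: CV].
  right; rewrite /tr /Js; apply: sym_ext => v /=.
  by do !rewrite (opK Hop).
move=> Cc; case: c'e; apply/piE; exists (tr Hop e c)^-1; split; first exact: CV.
by rewrite -{2}(tr_e Hop e c) invK.
Qed.

(** * Local finiteness and nilpotency *)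

Lemma fin_exact (T : Type) (P : T -> Prop) : fin P -> exists l, forall x, P x <-> In x l.
Proof.
move=> [l]; elim: l P => [|a l IH] P Hl.
  by exists [] => x; split=> [/Hl|].
have [|l' Hl'] := IH (fun x => P x /\ x <> a).
  by move=> x [/Hl [->|]].
case: (classic (P a)) => [Pa|nPa]; last first.
  exists l' => x; rewrite -Hl'; split=> [Px|[]//]; split=> // E; apply: nPa; by rewrite -E.
exists (a :: l') => x /=; rewrite -Hl'; split=> [Px|[<-|[]] //].
by case: (classic (x = a)) => [->|]; [left|right].
Qed.

Lemma fin_words (T : Type) (R : list T) n : fin (fun w => incl w R /\ length w <= n).
Proof.
elim: n => [|n [L HL]].
  by exists [[]] => -[|a w] [_ /= len]; [left|lia].
exists ([] :: flat_map (fun a => map (cons a) L) R) => -[|a w] [inc /= len]; first by left.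
right; apply/in_flat_map; exists a; split; first by apply: inc; left.
by apply/in_map/HL; split; [move=> u Hu; apply: inc; right|lia].
Qed.

(** * Finiteness of a system from finiteness of its orbits *)

Section Extension.
Variables (X : Type) (op : X -> X -> X).
Hypothesis Hop : hts op.
Local Notation s := (sr Hop).
Local Notation "a ∘ b" := (op a b) (at level 40, left associativity).
Variable f0 : sym X.
Hypotheses (R0 : refl Hop f0) (cube0 : f0 * f0 * f0 = 1).
Hypothesis comm0 : forall m, refl Hop m -> commutes f0 (m * f0 * m^-1).
Let W := span (conjugates Hop f0).
Variable R : list X.
Hypothesis repR : forall x, exists r n, In r R /\ W n /\ n r = x.

Let nW : normal Hop W. Proof. exact: normal_closure. Qed.

(** [s (n r) = n s_r n^-1], and [n] centralizes the abelian [W]; so the reflections induce only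
    finitely many maps on [W]. *)
Lemma sr_conj_orbit r n f : W n -> W f -> s (n r) * f * s (n r) = s r * f * s r.
Proof.
move=> Wn Wf; have [[W1 [WM WV]] [WR WJ]] := nW.
have ab := closure_abelian comm0.
rewrite -(aut_sr Hop _ _ (refl_aut (WR n Wn))).
rewrite (_ : _ * _ = n * (s r * (n^-1 * f * n) * s r) * n^-1); last by rewrite !mulA.
rewrite (_ : n^-1 * f * n = f); last by rewrite -mulA (ab f n Wf Wn) mulVK.
by rewrite (ab n _ Wn (WJ r f Wf)) mulK.
Qed.

Lemma word_in_reps w : exists w', incl w' R /\ length w' = length w /\
  forall f, W f -> sw Hop w' * f * (sw Hop w')^-1 = sw Hop w * f * (sw Hop w)^-1.
Proof.
elim: w => [|a w [w' [inc [len Hw']]]]; first by exists []; split.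
have [r [n [Rr [Wn na]]]] := repR a.
exists (r :: w'); split; first by move=> u [<-|/inc].
split=> [|f Wf /=]; first by rewrite /= len.
have E c u g : s c * u * g * (s c * u)^-1 = s c * (u * g * u^-1) * s c by rewrite invM srV !mulA.
rewrite !E Hw' // -na sr_conj_orbit //.
by apply: (normal_conj _ nW) => //; exact: sw_refl.
Qed.

Lemma sw_dup a v : sw Hop (a :: v ++ [a]) = sw Hop (map (op a) v).
Proof.
elim: v => [|b v IH] /=; first by rewrite mulr1 sr_mul.
rewrite -IH /= (sr_op Hop) -!mulA (mulA (s a) (s a)) sr_mul mul1 //.
Qed.

(* Dietzmann's argument: [s_a u s_a] is a product of as many reflections as [u], so a
   word with a repeated letter can be shortened. *)
Lemma short_word k : forall w, length w = k -> exists w', incl w' R /\ NoDup w' /\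
  forall f, W f -> sw Hop w' * f * (sw Hop w')^-1 = sw Hop w * f * (sw Hop w)^-1.
Proof.
elim/(well_founded_induction lt_wf): k => k IH w len.
have [w' [inc [len' Hw']]] := word_in_reps w.
case: (classic (NoDup w')) => [nd|]; first by exists w'.
move=> /not_NoDup [|a [u [v [v' E]]]]; first by move=> x y; exact: classic.
have [||w2 [inc2 [nd2 Hw2]]] := IH (length (u ++ map (op a) v ++ v')) _ (u ++ map (op a) v ++ v').
- by rewrite -len -len' E !length_app /= !length_app /= length_map; lia.
- by [].
exists w2; split=> //; split=> // f Wf; rewrite Hw2 // -Hw' // E.
have -> : u ++ a :: v ++ a :: v' = u ++ (a :: v ++ [a]) ++ v' by rewrite /= -app_assoc.
by rewrite !sw_app sw_dup.
Qed.

Lemma closure_fin : fin W.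
Proof.
have : fin (conjugates Hop f0).
  apply: (@fin_image _ _ (fun w => sw Hop w * f0 * (sw Hop w)^-1) (fun w => incl w R /\ length w <= length R));
    last exact: fin_words.
  move=> f [m [/refl_sw [w ->] ->]]; have [w' [inc [nd Hw']]] := short_word w eq_refl.
  exists w'; split; first by split=> //; exact: NoDup_incl_length.
  symmetry; apply: Hw'; apply: span_in; exists 1; split; first exact: span1.
  by rewrite mul1 inv1 mulr1.
move/fin_exact => [L HL]; apply: (@fin_sub _ _ (span (fun f => In f L))).
  by apply: span_mono => f /HL; exact: span_in.
apply: span_fin3 => [f g /HL Hf /HL Hg|f /HL Hf]; first by apply: (closure_abelian comm0); exact: span_in.
by apply: (closure_cube comm0) => //; exact: span_in.
Qed.

Lemma extension_fin : fin (fun _ : X => True).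
Proof.
apply: (@fin_image _ _ (fun nr : (sym X * X)%type => fst nr (snd nr)) (fun nr => W (fst nr) /\ In (snd nr) R)).
  by move=> x _; have [r [n [Rr [Wn <-]]]] := repR x; exists (n, r).
by apply: (@fin_prod _ _ W (fun x => In x R) closure_fin); exists R.
Qed.

End Extension.

(** Dividing by the normal closure of [t z] identifies [z] with [e], so the image of [A] is smaller;
    [extension_fin] returns from the quotient to [X]. *)
Lemma adjoin_fin n : forall (X : Type) (op : X -> X -> X) (Hop : hts op) (e : X) (A : X -> Prop) (x : X),
  closed op A -> A e -> (exists l, length l <= n /\ forall a, A a -> In a l) ->
  (forall y, clos op (fun u => A u \/ u = x) y) -> fin (fun _ : X => True).
Proof.
elim: n => [|n IH] X op Hop e A x cA Ae [l [len Hl]] genX.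
  by case: l len Hl => [|a l] /= len Hl; [case: (Hl e)|lia].
case: (classic (exists a, A a /\ a <> e)) => [[a [Aa ae]]|Atriv]; last first.
  have A1 a : A a -> a = e by move=> Aa; apply: NNPP => ne; apply: Atriv; exists a.
  exists [e; x; op e x] => y _.
  have cl : closed op (fun y => In y [e; x; op e x]).
    have E1 := opK Hop e x; have E2 : op x (op e x) = e by rewrite (opC Hop e x) (opK Hop).
    by move=> a b [<-|[<-|[<-|[]]]] [<-|[<-|[<-|[]]]] /=;
      rewrite ?(opI Hop) ?(opC Hop x e) ?(opC Hop (op e x) e) ?(opC Hop (op e x) x) ?E1 ?E2; tauto.
  by apply: clos_min cl _ _ (genX y) => a [/A1 ->|->] /=; tauto.
have smA : small (sig A) (S n).
  have [l' [len' [_ Hl']]] := sub_cover A l.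
  by exists l'; split=> [|u]; [lia|apply: Hl'; apply: Hl; exact: proj2_sig].
have [|[z Az] [ze zA]] := @central_exists (S n) _ _ (sub_hts cA Hop) (exist A e Ae) smA.
  by exists (exist A a Aa) => -[].
have {}ze : z <> e by move=> E; apply: ze; exact: sig_eq.
have {}zA u v : A u -> A v -> asc op e u z v.
  by move=> Au Av; have := f_equal (@proj1_sig _ _) (zA (exist A u Au) (exist A v Av)).
have zconj := @conjugates_commute X op Hop e A x z zA genX.
have nW : normal Hop (span (conjugates Hop (tr Hop e z))) by apply: normal_closure; exact: refl_tr.
have [Y [opY [pi [HopY [surj [hom piE]]]]]] := normal_quotient nW.
have piz : pi e = pi z.
  apply/piE; exists (tr Hop e z); split; last exact: tr_e.
  by apply: span_in; exists 1; split; [exact: span1|rewrite mul1 inv1 mulr1].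
have : fin (fun _ : Y => True).
  apply: (IH Y opY HopY (pi e) (fun y => exists a, A a /\ pi a = y) (pi x)).
  - by move=> y y' [u [Au <-]] [v [Av <-]]; exists (op u v); split=> //; exact: cA.
  - by exists e.
  - exists (map pi (remove (@eq_dec X) z l)); split.
      by rewrite length_map; have := remove_length_lt (@eq_dec X) l z (Hl z Az); lia.
    move=> y [u [Au <-]]; case: (classic (u = z)) => [->|uz].
      rewrite -piz; apply: in_map; apply: in_in_remove; [by move=> E; apply: ze|exact: Hl].
    by apply: in_map; apply: in_in_remove => //; exact: Hl.
  - move=> y; have [u <-] := surj y; elim: (genX u) => {u} [u [Au|->]|u v _ Hu _ Hv].
    + by apply: clos_in; left; exists u.
    + by apply: clos_in; right.
    + by rewrite hom; exact: clos_op.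
move=> [LY HLY].
pose rep y := epsilon (inhabits e) (fun x => pi x = y).
have repP y : pi (rep y) = y by apply: (epsilon_spec (inhabits e) (fun x => pi x = y)); exact: surj.
apply: (@extension_fin X op Hop (tr Hop e z) _ _ zconj (map rep LY)).
- exact: refl_tr.
- exact: tr_cube.
move=> u; have /piE [n' [Wn' E]] : pi (rep (pi u)) = pi u by exact: repP.
by exists (rep (pi u)), n'; split=> //; apply: in_map; exact: HLY.
Qed.

Theorem clos_fin (X : Type) (op : X -> X -> X) (Hop : hts op) (l : list X) : fin (clos op (fun x => In x l)).
Proof.
elim: l => [|x l IH]; first by exists [] => x; elim.
case: l IH => [|e l] IH.
  exists [x] => y; apply: (@clos_min _ _ _ (fun y => In y [x])) => // a b [<-|[]] [<-|[]]; by rewrite (opI Hop); left.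
set B := clos op (fun u => In u (x :: e :: l)).
have cB : closed op B by move=> a b; exact: clos_op.
have Be : B e by apply: clos_in; right; left.
have Bx : B x by apply: clos_in; left.
have [L HL] := IH.
suff : fin (fun _ : sig B => True).
  by move=> finB; apply: (@fin_image _ _ (fun u : sig B => proj1_sig u) (fun _ => True) B _ finB) => y By; exists (exist B y By); split.
apply: (@adjoin_fin (length L) _ _ (sub_hts cB Hop) (exist B e Be)
  (fun u : sig B => clos op (fun v => In v (e :: l)) (proj1_sig u)) (exist B x Bx)).
- by move=> u v; exact: clos_op.
- by apply: clos_in; left.
- have [l' [len' [_ Hl']]] := sub_cover B L; exists l'; split=> // u Hu.
  by apply: Hl'; exact: HL.
- move=> [y By]; have := @sub_clos _ _ _ _ cB (fun _ => @clos_in _ op _ _) y By By.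
  apply: clos_mono => -[u Bu] /= [E|Hu]; [right; exact: sig_eq|by left; apply: clos_in].
Qed.

(** * Nilpotency of the even group of a finite system *)

Section Nilpotency.
Variables (X : Type) (op : X -> X -> X).
Hypothesis Hop : hts op.
Variable e : X.
Local Notation s := (sr Hop).
Local Notation t := (tr Hop e).
Local Notation J := (Js Hop e).

Fixpoint upper (i : nat) (f : sym X) : Prop :=
  match i with
  | 0 => f = 1
  | S i => ev Hop f /\ forall m, ev Hop m -> upper i (f^-1 * m^-1 * f * m)
  end.

Lemma upper_ev i f : upper i f -> ev Hop f.
Proof. by case: i => [->|i []] //; exact: span1. Qed.

Lemma upper_normal i : normal Hop (upper i).
Proof.
elim: i => [|i IH].
  split; [split; [|split]|split] => //=.
  - by move=> f g -> ->; rewrite mul1.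
  - by move=> f ->; rewrite inv1.
  - by move=> f ->; exact: span1.
  - by move=> a f ->; rewrite mulr1 sr_mul.
have [[U1 [UM UV]] [UR UJ]] := IH.
split; [split; [|split]|split] => /=.
- by split=> [|m _]; [exact: span1|rewrite (_ : _ * _ = 1) //; grp].
- move=> f g [Ef Hf] [Eg Hg]; split=> [|m Em]; first exact: spanM.
  rewrite (_ : _ * _ = (g^-1 * (f^-1 * m^-1 * f * m) * g) * (g^-1 * m^-1 * g * m)); last by grp.
  apply: (UM); last exact: Hg.
  by apply: (normal_conjV _ IH); [exact: ev_refl|exact: Hf].
- move=> f [Ef Hf]; split=> [|m Em]; first exact: spanV.
  rewrite (_ : _ * _ = f * (f^-1 * m^-1 * f * m)^-1 * f^-1); last by grp.
  by apply: (normal_conj _ IH); [exact: ev_refl|apply: UV; exact: Hf].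
- by move=> f [Ef _]; exact: ev_refl.
- move=> a f [Ef Hf]; rewrite -{2}(srV Hop a); split; first by apply: ev_conj => //; exact: refl_sr.
  have E (c g m : sym X) : (c * g * c^-1)^-1 * m^-1 * (c * g * c^-1) * m =
      c * (g^-1 * (c^-1 * m * c)^-1 * g * (c^-1 * m * c)) * c^-1 by grp.
  move=> m Em; rewrite E.
  apply: (normal_conj _ IH); first exact: refl_sr.
  apply: Hf; rewrite srV -{2}(srV Hop a); apply: ev_conj => //; exact: refl_sr.
Qed.

Lemma upper_step i f : upper i f -> upper (S i) f.
Proof.
move=> Uf; have [[U1 [UM UV]] [UR UJ]] := upper_normal i.
split=> [|m Em]; first exact: upper_ev Uf.
rewrite (_ : _ * _ = f^-1 * (m^-1 * f * m)); last by rewrite !mulA.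
apply: UM; first exact: UV.
by apply: (normal_conjV _ (upper_normal i)) => //; exact: ev_refl.
Qed.

Lemma upper_stable : fin (fun _ : X => True) -> exists n, forall f, upper (S n) f -> upper n f.
Proof.
move=> finX.
have [||P [[n Pn] [_ minP]]] := @fin_minimal _ (fun P => exists n, forall f, P f <-> ~ upper n f) (fun f => ~ upper 0 f).
- by exists 0.
- exact: fin_sub (fin_sym finX).
exists n => f Uf; apply: NNPP => /Pn Pf.
have /(_ f Pf) : forall f, P f -> ~ upper (S n) f; last by [].
apply: minP; first by exists (S n).
by move=> g nUg; apply/Pn => Ug; apply: nUg; exact: upper_step.
Qed.

(** At a stable term [U] of the series, a nontrivial central point [c] of the quotient by [U] would
    put all [J c b], and then [t c], into the next term, which is [U] again. *)
Theorem even_nilpotent : fin (fun _ : X => True) -> exists n, forall f, ev Hop f -> upper n f.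
Proof.
move=> finX; have [n stable] := upper_stable finX; exists n.
have nU := upper_normal n; have [[U1 [UM UV]] [UR UJ]] := nU.
have [Y [opY [pi [HopY [surj [hom piE]]]]]] := normal_quotient nU.
have smY : exists k, small Y k.
  have [l Hl] := finX; exists (length (map pi l)), (map pi l); split=> // y.
  by have [u <-] := surj y; apply: in_map; exact: Hl.
have evtr : forall f, span (fun f => exists a, f = t a) f -> ev Hop f.
  by apply: span_mono => f [a ->]; exact: tr_ev.
have comm_ev k : (forall m, span (fun f => exists a, f = t a) m -> upper n (k * m * k^-1 * m^-1)) ->
    ev Hop k -> upper n k^-1.
  move=> H Ek; apply: stable; split=> [|m /(ev_tr e) Em]; first exact: spanV.
  by rewrite invV; have := H m^-1 (spanV Em); rewrite invV.
case: (classic (exists y, y <> pi e)) => [ynt|Ytriv]; last first.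
  move=> f /(ev_tr e) Ef; apply: (@span_min _ (fun f => exists a, f = t a)) f Ef => // f [u ->].
  have [c [Uc ce]] : exists c, upper n c /\ c e = u.
    by apply/piE; symmetry; apply: NNPP => ne; apply: Ytriv; exists (pi u).
  rewrite (_ : t u = (s e * c * s e) * c^-1).
    by apply: UM; [exact: UJ|exact: UV].
  by rewrite /tr -ce -(aut_sr Hop _ _ (refl_aut (UR c Uc))) !mulA.
have [k smk] := smY.
have [c' [c'e Hc']] := @central_exists k _ _ HopY (pi e) smk ynt.
have [c cE] := surj c'; rewrite -{}cE in c'e Hc'.
have kern f : ev Hop f -> (forall u, pi (f u) = pi u) -> upper n f^-1.
  move=> Ef Hf; apply: comm_ev => // m Sm.
  have : refl Hop m by apply: ev_refl; exact: evtr.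
  apply: (normal_commutator f nU) => [g [a ->]|g [a ->]]; first exact: refl_sr.
  rewrite srV; apply: normal_sr_sr => //; first exact: ev_refl.
  by apply/piE; rewrite Hf.
have UJs b : upper n (J c b).
  rewrite -JsV; apply: kern.
    by rewrite Js_comm; apply: spanM; [apply: spanM; [apply: spanM; apply: spanV|]|]; exact: tr_ev.
  move=> v; rewrite /= !hom.
  apply/(asc_Jfix HopY (pi e) (pi v) (pi b) (pi c)); apply: asc_flip; exact: Hc'.
have : upper n (t c)^-1^-1.
  apply: comm_ev; last by apply: spanV; exact: tr_ev.
  have : forall m, span (fun f => exists a, f = t a) m -> span (fun f => exists a, f = (t a)^-1) m.
    by apply: span_mono => g [a ->]; rewrite -(invV (t a)); apply: spanV; apply: span_in; exists a.
  move=> H m /H Sm; apply: (normal_commutator (t c)^-1 nU _ _ Sm) => g [a ->]; first by apply: spanV; exact: refl_tr.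
  by rewrite !invV -(Js_comm Hop).
rewrite invV => Uc; case: c'e; apply/piE; exists (t c)^-1; split; first exact: UV.
by rewrite -{2}(tr_e Hop e c) invK.
Qed.

End Nilpotency.

(** * Commutative Moufang loops *)

Lemma cube_eq_of_products (X : Type) (a c f : sym X) :
  commutes a c -> c * f = a * a -> a * c = f * f -> a * a * a = c * c * c.
Proof.
move=> ac cf E2; have fE : f = c^-1 * a * a by rewrite -mulA -cf mulVK.
have ca : c * (a * a) = a * a * c by apply/commutesM; exact: commutes_sym.
symmetry; apply: (@mulIl _ a).
transitivity (c * c * (a * c)); first by rewrite !mulA ac -(mulA c a c) ac !mulA.
rewrite E2 fE; transitivity (c * (a * a) * c^-1 * (a * a)); first by grp.
by rewrite ca mulK; grp.
Qed.

Section MoufangLoop.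
Variables (Q : Type) (mul : Q -> Q -> Q) (e : Q).
Hypothesis HQ : is_CML mul e.
Local Notation "x · y" := (mul x y) (at level 40, left associativity).

Lemma loop1 x : e · x = x. Proof. by case: HQ => -[/(_ x) []]. Qed.
Lemma loopC x y : x · y = y · x. Proof. by case: HQ => _ []. Qed.
Lemma loop1r x : x · e = x. Proof. by rewrite loopC loop1. Qed.
Lemma moufang x y z : (x · x) · (y · z) = (x · y) · (x · z). Proof. by case: HQ => _ []. Qed.
Lemma loopI x y z : x · y = x · z -> y = z.
Proof.
case: HQ => -[_ [/(_ x (x · z)) [w [_ uw]] _]] _ E.
by rewrite -(uw y E); exact: uw.
Qed.

Definition iv (x : Q) := epsilon (inhabits e) (fun y => x · y = e).

Lemma ivr x : x · iv x = e.
Proof.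
apply: (epsilon_spec (inhabits e) (fun y => x · y = e)).
by case: HQ => -[_ [/(_ x e) [y [Hy _]] _]] _; exists y.
Qed.

Lemma sqr_mul x z : (x · x) · z = x · (x · z).
Proof. by rewrite -{1}(loop1 z) moufang loop1r. Qed.

Lemma loopK x z : x · (iv x · z) = z.
Proof.
apply: (@loopI x); rewrite -sqr_mul moufang ivr.
by rewrite loop1.
Qed.

Lemma ivK x : iv (iv x) = x.
Proof. by apply: (@loopI (iv x)); rewrite ivr loopC ivr. Qed.

Lemma loopVK x z : iv x · (x · z) = z.
Proof. by rewrite -{2}(ivK x) loopK. Qed.

Lemma iv_e : iv e = e.
Proof. by apply: (@loopI e); rewrite ivr loop1. Qed.

Definition tn (x : Q) : sym Q := Sym (mul x) (mul (iv x)) (loopVK x) (loopK x).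
Local Notation t := tn.

Lemma tn_e x : t x e = x. Proof. exact: loop1r. Qed.
Lemma tn_inj x y : t x = t y -> x = y.
Proof. by move=> E; rewrite -(tn_e x) E tn_e. Qed.
Lemma tn1 : t e = 1. Proof. by apply: sym_ext => x; exact: loop1. Qed.
Lemma tnV x : t (iv x) = (t x)^-1. Proof. by apply: sym_ext. Qed.
Lemma tn_sqr x : t (x · x) = t x * t x.
Proof. by apply: sym_ext => y /=; rewrite sqr_mul. Qed.

(** The Moufang law applied to [(xy)(x · x^-1 z)]. *)
Lemma tn_mul x y : t (x · y) = t x * t x * t y * (t x)^-1.
Proof.
apply: sym_ext => z /=; rewrite -{1}(loopK x z) -moufang -sqr_mul //.
Qed.

Lemma tnE x y : t x y = x · y. Proof. by []. Qed.
Lemma tnVE x y : (t x)^-1 y = iv x · y. Proof. by []. Qed.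

Global Opaque tn.

(** Compares the two expressions that [tn_mul] gives for the translation by [x^-1 y], one for each
    order of the factors. *)
Lemma tn_square_mul x y : t x * t x * t y * t y = t y * t x * t y * t x.
Proof.
have E : (t x)^-1 * (t x)^-1 * t y * t x = t y * t y * (t x)^-1 * (t y)^-1.
  have := tn_mul (iv x) y; rewrite loopC tn_mul !tnV invV => <-; by [].
rewrite (_ : t y * t x * t y * t x = t x * t x * ((t x)^-1 * (t x)^-1 * t y * t x) * t y * t x); last by grp.
rewrite E; grp.
Qed.

Lemma tn_aba x y : t x * t y * t x = t y * t y * t x * t x * (t y)^-1.
Proof. by apply: (@mulIr _ (t y)); rewrite mulKV tn_square_mul. Qed.

Lemma tn_cube_comm_sqr x y : t y * t y * t y * (t x * t x) = t x * t x * (t y * t y * t y).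
Proof.
transitivity (t x * t x * t y * t y * t y); last by grp.
rewrite (tn_square_mul x y); transitivity (t y * (t x * t y * t x) * t y); last by grp.
by rewrite (tn_aba x y); grp.
Qed.

Lemma tn_aba' x y : t x * t y * t x = (t y)^-1 * t x * t x * t y * t y.
Proof.
transitivity ((t y)^-1 * (t x * t x * (t y * t y * t y)) * (t y)^-1); last by grp.
by rewrite -tn_cube_comm_sqr (tn_aba x y); grp.
Qed.

Let conj (b a : sym Q) := b * a * b^-1.

Lemma tn_conj_products x y (a := t x) (b := t y) (c := conj b a) (d := conj b^-1 a) (f := conj b c) :
  a * c = d * d /\ a * c = f * f.
Proof.
split.
  by rewrite /a /c /d /conj !mulA (tn_aba' x y); grp.
by rewrite /a /f /c /conj !mulA (tn_aba x y); grp.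
Qed.

(** With [c] and [f] the conjugates of [a] by [b] and [b * b], one has [a c = f^2]. For [y^-1] in
    place of [y] the other product relation gives [a (b^-1 a b) = c^2], and conjugating it by [b]
    gives [c a = f^2]. *)
Lemma tn_conj_commutes x y : commutes (t x) (conj (t y) (t x)).
Proof.
set a := t x; set b := t y; have [E1 E2] := tn_conj_products x y.
have [E3 _] := tn_conj_products x (iv y).
have {E3} : a * conj b^-1 a = conj b a * conj b a by rewrite /b -tnV /a E3 tnV invV.
move=> /(f_equal (conj b)); rewrite /commutes E2 -/a -/b => E4.
rewrite (_ : conj b a * a = conj b (a * conj b^-1 a)); last by rewrite /conj; grp.
by rewrite E4 /conj; grp.
Qed.

(* With [a], [c], [f] the conjugates of [t x] by the powers 0, 1, 2 of [t y]: they commute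
   consecutively, [c f = a^2] and [a c = f^2], whence [a^3 = c^3]. *)
Lemma tn_cube_central x y : commutes (t x * t x * t x) (t y).
Proof.
set a := t x; set b := t y; set c := conj b a; set f := conj b c.
have ac : commutes a c := tn_conj_commutes x y.
have [E1 E2] := tn_conj_products x y; rewrite -/a -/b -/c -/f in E1 E2.
have cf : c * f = a * a.
  move/(f_equal (conj b)): E1; rewrite (_ : conj b (a * c) = c * f); last by rewrite /f /conj; grp.
  by move=> ->; rewrite /conj; grp.
have E3 := cube_eq_of_products ac cf E2; apply: (@mulIr _ b^-1); rewrite mulK.
by rewrite {1}E3 /c /conj; grp.
Qed.

Definition Jq (x y : Q) := (t x)^-1 * (t y)^-1 * t x * t y.

Lemma JqV x y : (Jq x y)^-1 = Jq y x. Proof. by rewrite /Jq; grp. Qed.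

Lemma Jq_comm_l x y : commutes (Jq x y) (t x).
Proof.
apply/commutes_sym; have := tn_conj_commutes x (iv y); rewrite tnV /conj invV => H.
by rewrite /Jq -!mulA; apply: commutesM; [exact: commutesV|rewrite !mulA].
Qed.

Lemma Jq_comm_r x y : commutes (Jq x y) (t y).
Proof. by rewrite -JqV; apply/commutes_sym/commutesV/commutes_sym; exact: Jq_comm_l. Qed.

Lemma Jq_cube x y : Jq x y * Jq x y * Jq x y = 1.
Proof.
have c3 := tn_cube_central x y; have cJ := Jq_comm_l x y.
have E : (t y)^-1 * t x * t y = t x * Jq x y by rewrite /Jq; grp.
have : ((t y)^-1 * t x * t y) * ((t y)^-1 * t x * t y) * ((t y)^-1 * t x * t y) = t x * t x * t x.
  transitivity ((t y)^-1 * (t x * t x * t x * t y)); first by grp.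
  by rewrite c3 mulVK.
rewrite {}E; move: (t x) (Jq x y) cJ => u v cJ H.
apply: (@mulIl _ (u * u * u)); rewrite mulr1 -[RHS]H.
transitivity (u * (v * u) * (v * u) * v); last by grp.
rewrite cJ; transitivity (u * u * (v * u) * v * v); last by grp.
by rewrite cJ; grp.
Qed.

Definition zc (z : Q) := forall y, commutes (t z) (t y).
Definition mlt := span (fun f => exists x, f = t x).

Lemma mlt_t x : mlt (t x). Proof. by apply: span_in; exists x. Qed.

Lemma zc_mlt z f : zc z -> mlt f -> commutes (t z) f.
Proof. by move=> Zz; apply: span_commutes => g [x ->]. Qed.

Lemma comm_t x y : commutes (t x) (t y) -> t (x · y) = t x * t y.
Proof. by move=> c; rewrite tn_mul -!mulA (commutesV (commutes_sym c)) mulKl. Qed.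

Lemma zc_t z y : zc z -> t (z · y) = t z * t y.
Proof. by move=> Zz; apply: comm_t. Qed.

Lemma zc_e : zc e. Proof. by move=> y; rewrite tn1; apply/commutes_sym/commutes1. Qed.

Lemma zc_mul z z' : zc z -> zc z' -> zc (z · z').
Proof. by move=> Zz Zz' y; rewrite zc_t //; apply/commutes_sym/commutesM; apply: commutes_sym; [exact: Zz|exact: Zz']. Qed.

Lemma zc_iv z : zc z -> zc (iv z).
Proof. by move=> Zz y; rewrite tnV; apply/commutes_sym/commutesV/commutes_sym; exact: Zz. Qed.

Lemma tn_cube x : t ((x · x) · x) = t x * t x * t x.
Proof. by rewrite tn_mul tn_sqr; grp. Qed.

Lemma zc_cube x : zc ((x · x) · x).
Proof. by move=> y; rewrite tn_cube; exact: tn_cube_central. Qed.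

Lemma iv_mul x y : iv (x · y) = iv x · iv y.
Proof.
apply: tn_inj; rewrite tnV !tn_mul !tnV !invM !invV.
apply: (@mulIl _ (t x * t x)); rewrite !mulA.
transitivity ((t x * t x * t x * (t y)^-1) * (t x)^-1 * (t x)^-1); first by grp.
by rewrite (commutesV (tn_cube_central x y)); grp.
Qed.

End MoufangLoop.

Definition fin_mod (T : Type) (E : T -> T -> Prop) (P : T -> Prop) :=
  exists l, forall x, P x -> exists y, In y l /\ E x y.

Lemma fin_mod_inside (T : Type) (E : T -> T -> Prop) (P : T -> Prop) :
  (forall x y, E x y -> E y x) -> (forall x y z, E x y -> E y z -> E x z) ->
  fin_mod E P -> exists l, (forall x, In x l -> P x) /\ forall x, P x -> exists y, In y l /\ E x y.
Proof.
move=> Es Et [l]; elim: l P => [|a l IH] P Hl; first by exists []; split=> // x /Hl.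
have [|l' [lP Hl']] := IH (fun x => P x /\ ~ E x a).
  by move=> x [/Hl [y [[<-|yl] Exy]] nE]; [case: nE|exists y].
case: (classic (exists x, P x /\ E x a)) => [[x0 [Px0 Ex0]]|none].
  exists (x0 :: l'); split=> [x [<-|/lP []] //|x Px].
  case: (classic (E x a)) => [Exa|nE].
    by exists x0; split; [left|apply: Et Exa _; exact: Es].
  by have [y [yl Exy]] := Hl' x (conj Px nE); exists y; split=> //; right.
exists l'; split=> [x /lP [] //|x Px]; apply: Hl'; split=> // Exa; apply: none; by exists x.
Qed.

(** * The loop and its multiplication group modulo the centre *)

Section LoopFiniteness.
Variables (Q : Type) (mul : Q -> Q -> Q) (e : Q).
Hypothesis HQ : is_CML mul e.
Local Notation "x · y" := (mul x y) (at level 40, left associativity).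
Local Notation t := (tn HQ).
Local Notation iv := (iv mul e).
Local Notation zc := (zc HQ).
Local Notation mlt := (mlt HQ).
Local Notation tnE := (tnE HQ).

Lemma zc_assoc z x y : zc z -> (z · x) · y = z · (x · y).
Proof. by move=> Zz; have := f_equal (fun f : sym Q => f y) (zc_t x Zz). Qed.

Lemma zc_assoc' z x y : zc z -> x · (z · y) = z · (x · y).
Proof. by move=> Zz; have := f_equal (fun f : sym Q => f y) (Zz x) => /=; rewrite !tnE. Qed.

Definition eqz (x y : Q) := exists z, zc z /\ x = z · y.

Lemma eqz_refl x : eqz x x.
Proof. by exists e; split; [exact: zc_e|rewrite (loop1 HQ)]. Qed.
Lemma eqz_sym x y : eqz x y -> eqz y x.
Proof. by move=> [z [Zz ->]]; exists (iv z); split; [exact: zc_iv|rewrite (loopVK HQ)]. Qed.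
Lemma eqz_trans x y w : eqz x y -> eqz y w -> eqz x w.
Proof.
move=> [z [Zz ->]] [z' [Zz' ->]]; exists (z · z'); split; first exact: zc_mul.
by rewrite zc_assoc.
Qed.
Lemma eqz_mull x y w : eqz x y -> eqz (w · x) (w · y).
Proof. by move=> [z [Zz ->]]; exists z; split=> //; exact: zc_assoc'. Qed.
Lemma eqz_iv x y : eqz x y -> eqz (iv x) (iv y).
Proof. by move=> [z [Zz ->]]; exists (iv z); split; [exact: zc_iv|rewrite (iv_mul HQ)]. Qed.
Lemma eqz_e x : eqz x e <-> zc x.
Proof.
split=> [[z [Zz ->]]|Zx]; first by rewrite (loop1r HQ).
by exists x; rewrite (loop1r HQ).
Qed.

Lemma eqz_quotient : exists (X : Type) (op : X -> X -> X) (pi : Q -> X), hts op /\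
  (forall u, exists x, pi x = u) /\ (forall x y, op (pi x) (pi y) = pi (iv (x · y))) /\
  (forall x y, pi x = pi y <-> eqz x y).
Proof.
have loopC := loopC HQ.
have [||||||||X [op [pi [H1 [H2 [H3 H4]]]]]] := @hts_quotient Q (fun x y => iv (x · y)) eqz.
- exact: eqz_refl.
- exact: eqz_sym.
- exact: eqz_trans.
- move=> x x' y y' Ex Ey; apply: eqz_iv; apply: (@eqz_trans _ (x · y')); first exact: eqz_mull.
  by rewrite !(loopC _ y'); exact: eqz_mull.
- by move=> x y; rewrite loopC; exact: eqz_refl.
(* Idempotence: [x^-2] and [x] differ by the inverse of the central cube of [x]. *)
- move=> x; exists (iv ((x · x) · x)); split; first exact/zc_iv/zc_cube.
  apply: (@tn_inj _ _ _ HQ); rewrite zc_t; last exact/zc_iv/zc_cube.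
  by rewrite !tnV tn_cube tn_sqr; grp.
- by move=> x y; rewrite (iv_mul HQ x) (ivK HQ) (loopVK HQ); exact: eqz_refl.
- move=> x y z; rewrite (iv_mul HQ x) (ivK HQ) (iv_mul HQ _ (iv _)) !(ivK HQ) -(moufang HQ).
  exists (iv ((x · x) · x)); split; first exact/zc_iv/zc_cube.
  have E : t (iv x) = t (iv ((x · x) · x)) * t (x · x) by rewrite !tnV tn_cube tn_sqr; grp.
  by have := f_equal (fun f : sym Q => f (y · z)) E.
by exists X, op, pi; split=> //; split=> //; split.
Qed.

Definition subl (K : Q -> Prop) :=
  K e /\ (forall x y, K x -> K y -> K (x · y)) /\ (forall x, K x -> K (iv x)).

Inductive gsub (S : Q -> Prop) : Q -> Prop :=
| gsub_e : gsub S e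
| gsub_in x : S x -> gsub S x
| gsub_mul x y : gsub S x -> gsub S y -> gsub S (x · y)
| gsub_iv x : gsub S x -> gsub S (iv x).

Lemma gsub_subl S : subl (gsub S).
Proof. by split; [exact: gsub_e|split; [exact: gsub_mul|exact: gsub_iv]]. Qed.

Lemma gsub_min (S K : Q -> Prop) : subl K -> (forall x, S x -> K x) -> forall x, gsub S x -> K x.
Proof. by move=> [Ke [KM KV]] sSK x; elim=> *; auto. Qed.

(** Taking the whole centre among the generators adds nothing modulo the centre, while [class_bound]
    needs subloops that contain it. *)
Lemma gsub_fin (l : list Q) : fin_mod eqz (gsub (fun x => In x l \/ zc x)).
Proof.
have [X [op [pi [Hop [surj [hom piE]]]]]] := eqz_quotient.
have [L HL] := clos_fin Hop (map pi (e :: l)).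
have pie : pi (iv e) = pi e by rewrite (iv_e HQ).
have inL x : gsub (fun x => In x l \/ zc x) x -> In (pi x) L.
  move=> Kx; apply: HL; elim: Kx => {x} [|x [xl|Zx]|x y _ IHx _ IHy|x _ IHx].
  - by apply: clos_in; left.
  - by apply: clos_in; apply: in_map; right.
  - rewrite (_ : pi x = pi e); first by apply: clos_in; left.
    by apply/piE/eqz_e.
  - rewrite (_ : pi (x · y) = op (pi e) (op (pi x) (pi y))).
      by apply: clos_op; [apply: clos_in; left|exact: clos_op].
    by rewrite !hom (loop1 HQ) (ivK HQ).
  - rewrite (_ : pi (iv x) = op (pi e) (pi x)); first by apply: clos_op => //; apply: clos_in; left.
    by rewrite hom (loop1 HQ).
exists (map (fun u => epsilon (inhabits e) (fun x => pi x = u)) L) => x /inL xL.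
exists (epsilon (inhabits e) (fun y => pi y = pi x)); split.
  exact: (in_map (fun u => epsilon (inhabits e) (fun x => pi x = u))).
apply/piE; symmetry; apply: (epsilon_spec (inhabits e) (fun y => pi y = pi x)); by exists x.
Qed.

Definition tspan (K : Q -> Prop) := span (fun f => exists k, K k /\ f = t k).

Lemma tspan_mlt K f : tspan K f -> mlt f.
Proof. by apply: span_mono => {}f [k [_ ->]]; apply: span_in; exists k. Qed.

Lemma tspan_gsub S f : tspan (gsub S) f -> tspan S f.
Proof.
apply: span_mono => {}f [k [Kk ->]]; elim: Kk => {k} [|x Sx|x y _ Hx _ Hy|x _ Hx].
- by rewrite tn1; exact: span1.
- by apply: span_in; exists x.
- by rewrite tn_mul; do !apply: spanM => //; exact: spanV.
- by rewrite tnV; exact: spanV.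
Qed.

Lemma tspan_mono (S S' : Q -> Prop) f : (forall x, S x -> S' x) -> tspan S f -> tspan S' f.
Proof. by move=> sS; apply: span_mono => {}f [x [/sS S'x ->]]; apply: span_in; exists x. Qed.

Lemma tspan_preserves K f : subl K -> tspan K f -> (forall x, K x -> K (f x)) /\ (forall x, K x -> K (f^-1 x)).
Proof.
move=> [Ke [KM KV]]; elim=> {f} [|f [k [Kk ->]]|f g _ [f1 f2] _ [g1 g2]|f _ [f1 f2]].
- by split.
- by split=> x Kx; rewrite -?tnV !tnE; auto.
- by split=> x Kx; [exact: f1 (g1 x Kx)|exact: g2 (f2 x Kx)].
- by split.
Qed.

Definition zg (f : sym Q) := exists z, zc z /\ f = t z.
Definition eqzg (f g : sym Q) := exists z, zc z /\ f = t z * g.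

Lemma eqzg_refl f : eqzg f f.
Proof. by exists e; split; [exact: zc_e|rewrite tn1 mul1]. Qed.
Lemma eqzg_sym f g : eqzg f g -> eqzg g f.
Proof. by move=> [z [Zz ->]]; exists (iv z); split; [exact: zc_iv|rewrite tnV mulVK]. Qed.
Lemma eqzg_trans f g h : eqzg f g -> eqzg g h -> eqzg f h.
Proof.
move=> [z [Zz ->]] [z' [Zz' ->]]; exists (z · z'); split; first exact: zc_mul.
by rewrite zc_t // mulA.
Qed.

Definition tw (w : list Q) := fold_right (fun a f => t a * f) 1 w.

Lemma tw_app u v : tw (u ++ v) = tw u * tw v.
Proof. by elim: u => [|a u IH] /=; rewrite ?mul1 // IH mulA. Qed.

Lemma tspan_words K f : subl K -> tspan K f -> exists w, (forall x, In x w -> K x) /\ f = tw w.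
Proof.
move=> [Ke [KM KV]]; elim=> {f} [|f [k [Kk ->]]|f g _ [u [Ku ->]] _ [v [Kv ->]]|f _ [u [Ku ->]]].
- by exists [].
- by exists [k]; split; [move=> x [<-|[]]|rewrite /= mulr1].
- exists (u ++ v); split; last by rewrite tw_app.
  by move=> x xuv; case: (in_app_or u v x xuv); auto.
- exists (rev (map iv u)); split.
    move=> x; rewrite -in_rev in_map_iff => -[y [<- yu]]; apply: KV; exact: Ku.
  elim: u {Ku} => [|a u IH] /=; first by rewrite inv1.
  by rewrite invM IH tw_app /= mulr1 tnV.
Qed.

Lemma tn_sandwich a b : t a * t b * t a = t ((a · a) · b).
Proof. by rewrite (loopC HQ) tn_mul tn_sqr !mulA (tn_square_mul HQ b a) mulK. Qed.

(** [t_a t_b = t_{a^2 b} t_a^-1] passes the outer factor on to the rest with opposite sign, which is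
    why the last factor may be [a] or its inverse. In all, at least one factor is saved. *)
Lemma tw_dup K v : subl K -> (forall x, In x v -> K x) ->
  forall a a', K a -> a' = a \/ a' = iv a ->
  exists v', (forall x, In x v' -> K x) /\ length v' <= S (length v) /\ t a * tw v * t a' = tw v'.
Proof.
move=> sK; have [Ke [KM KV]] := sK; elim: v => [|b v IH] Kv a a' Ka Ha.
  case: Ha => ->.
    exists [a · a]; split; first by move=> x [<-|[]]; exact: KM.
    by split=> //=; rewrite !mulr1 tn_sqr.
  by exists []; split=> //; split=> /=; [lia|rewrite mulr1 tnV mulV].
have [||v' [Kv' [len E]]] := IH _ (iv a) a' (KV a Ka).
- by move=> x xv; apply: Kv; right.
- by case: Ha => ->; [right; rewrite (ivK HQ)|left].
exists ((a · a) · b :: v'); split; first by move=> x [<-|/Kv' //]; apply: (KM); [exact: KM|apply: Kv; left].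
split; first by move=> /=; lia.
by rewrite /= -E -tn_sandwich tnV; grp.
Qed.

(* Dietzmann's argument again: modulo the centre, a product of two equal translations
   around a product of [n] translations is a product of [n + 1] translations. *)
Lemma tspan_fin K : subl K -> fin_mod eqz K -> fin_mod eqzg (tspan K).
Proof.
move=> sK /(fin_mod_inside eqz_sym eqz_trans) [R [RK HR]].
have reps w : (forall x, In x w -> K x) ->
    exists w', incl w' R /\ length w' = length w /\ eqzg (tw w) (tw w').
  elim: w => [|a w IH] Kw; first by exists []; split=> //; split=> //; exact: eqzg_refl.
  have [|w' [inc [len [z [Zz E]]]]] := IH; first by move=> x xw; apply: Kw; right.
  have [r [Rr [z' [Zz' Ea]]]] := HR a (Kw a (or_introl eq_refl)).
  exists (r :: w'); split; first by move=> x [<-|/inc].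
  split; first by rewrite /= len.
  exists (z' · z); split; first exact: zc_mul.
  by rewrite /= E Ea !zc_t // -!mulA (mulA (t r) (t z)) -(Zz r) !mulA.
have short n : forall w, (forall x, In x w -> K x) -> length w = n ->
    exists w', incl w' R /\ NoDup w' /\ eqzg (tw w) (tw w').
  elim/(well_founded_induction lt_wf): n => n IH w Kw len.
  have [w' [inc [len' E']]] := reps w Kw.
  case: (classic (NoDup w')) => [nd|]; first by exists w'.
  move=> /not_NoDup [|a [u [v [v' E]]]]; first by move=> x y; exact: classic.
  have Kw' x : In x w' -> K x by move=> /inc; exact: RK.
  have [|||v2 [Kv2 [len2 E2]]] := @tw_dup K v sK _ a a.
  - by move=> x xv; apply: Kw'; rewrite E; apply/in_or_app; right; right; apply/in_or_app; left.
  - by apply: Kw'; rewrite E; apply/in_or_app; right; left.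
  - by left.
  have [|||w2 [inc2 [nd2 Ew2]]] := IH (length (u ++ v2 ++ v')) _ (u ++ v2 ++ v').
  - by rewrite -len -len' E !length_app /= !length_app /=; lia.
  - move=> x xin; case: (in_app_or _ _ _ xin) => [xu|xin2]; last (case: (in_app_or _ _ _ xin2) => [/Kv2 //|xv']); apply: Kw'; rewrite E; apply/in_or_app; [by left|].
    by right; right; apply/in_or_app; right; right.
  - by [].
  exists w2; split=> //; split=> //; apply: eqzg_trans E' _; apply: eqzg_trans Ew2.
  rewrite (_ : tw w' = tw (u ++ v2 ++ v')); first exact: eqzg_refl.
  by rewrite E !tw_app -E2 /= tw_app /= !mulA.
have [L HL] := fin_words R (length R).
exists (map tw L) => f /(tspan_words sK) [w [Kw ->]].
have [w' [inc [nd E]]] := short _ w Kw eq_refl.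
exists (tw w'); split=> //; apply/in_map/HL; split=> //; exact: NoDup_incl_length.
Qed.

End LoopFiniteness.

(** * Inner maps and nilpotency of the translation groups *)

Section InnerMaps.
Variables (Q : Type) (mul : Q -> Q -> Q) (e : Q).
Hypothesis HQ : is_CML mul e.
Local Notation "x · y" := (mul x y) (at level 40, left associativity).
Local Notation t := (tn HQ).
Local Notation J := (Jq HQ).
Local Notation iv := (iv mul e).
Local Notation zc := (zc HQ).
Local Notation mlt := (mlt HQ).
Local Notation tnE := (tnE HQ).
Local Notation eqz := (eqz HQ).
Local Notation eqzg := (eqzg HQ).
Local Notation zg := (zg HQ).
Local Notation tspan := (tspan HQ).

(* [h] twists translations: [h t_q = zeta t_{h' q} h'], starting from
   [t_b t_q = t_{b^2 q} t_b^-1 = t_b^3 t_{b^-1 q} t_b^-1]. *)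
Lemma mlt_twist h : mlt h -> exists (h' : sym Q) z, zc z /\ forall q, h * t q = t z * t (h' q) * h'.
Proof.
elim=> {h} [|h [b ->]|g h Mg [g' [z [Zz Hg]]] Mh [h' [z' [Zz' Hh]]]|h Mh [h' [z [Zz Hh]]]].
- by exists 1, e; split=> [|q]; [exact: zc_e|rewrite mul1 mulr1 tn1 mul1].
- exists (t b)^-1, ((b · b) · b); split=> [|q]; first exact: zc_cube.
  by rewrite tnVE (tn_mul HQ (iv b)) tnV tn_cube !invV; grp.
- exists (g' * h'), (z' · z); split=> [|q]; first exact: zc_mul.
  have c := zc_mlt Zz' Mg.
  rewrite -mulA Hh !mulA -c -(mulA (t z') g) Hg zc_t // !mulA //.
- exists h'^-1, (iv z); split=> [|q]; first exact: zc_iv.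
  have := Hh (h'^-1 q); rewrite invKr => E.
  apply: (@mulIl _ h); rewrite mulKl tnV.
  have c : commutes h (t z)^-1 by apply/commutesV/commutes_sym; exact: zc_mlt.
  by rewrite !mulA c -(mulA _ h) E !mulA mulVl mul1 mulK.
Qed.

(** At [q = e] the twist gives [h = t_z t_{h' e} h']. Evaluated at [e], this makes the square of
    [h' e] central; its cube is central anyway, so [h' e] is central and all central factors
    cancel. *)
Lemma stab_aut h q : mlt h -> h e = e -> h * t q * h^-1 = t (h q).
Proof.
move=> Mh he; have [h' [z [Zz H]]] := mlt_twist Mh.
have H1 : h = t z * t (h' e) * h' by rewrite -H tn1 mulr1.
have sq : zc (h' e · h' e).
  have : t z (t (h' e) (h' e)) = e by rewrite -[RHS]he H1.
  rewrite !tnE => E; rewrite (_ : h' e · h' e = iv z); first exact: zc_iv.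
  by rewrite -[LHS](loopVK HQ z) E (loop1r HQ).
have Zc : zc (h' e).
  rewrite (_ : h' e = iv (h' e · h' e) · ((h' e · h' e) · h' e)); last by rewrite (loopVK HQ).
  by apply: zc_mul; [exact: zc_iv|exact: zc_cube].
have zzc : t z * t (h' e) * t (h' e) = 1.
  rewrite -!zc_t //; last exact: zc_mul.
  rewrite -(tn1 HQ); congr t; rewrite -[RHS]he H1 /= !tnE; by rewrite (@zc_assoc _ _ _ HQ).
have h'E : h' = t (h' e) * h.
  by rewrite H1 !mulA -(zc_mlt Zz (mlt_t HQ (h' e))) zzc mul1.
have tE : t (h' q) = t (h' e) * t (h q) by rewrite -zc_t //; congr t; rewrite {1}h'E /= tnE.
apply: (@mulIr _ h); rewrite mulKV H tE {2}h'E.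
have c1 := zc_mlt Zc (mlt_t HQ (h q)).
by rewrite !mulA -(mulA _ (t (h q)) (t (h' e))) -c1 !mulA zzc mul1.
Qed.

Lemma Jq_mlt x y : mlt (J x y).
Proof. by rewrite /Jq; do !apply: spanM; try apply: spanV; exact: mlt_t. Qed.

Lemma Jq_e x y : J x y e = e.
Proof.
change ((t x)^-1 ((t y)^-1 (t x (t y e))) = e).
by rewrite tn_e !tnVE tnE (loopC HQ x) (loopVK HQ) (loopC HQ) (ivr HQ).
Qed.

(* Translations are conjugated to translations modulo the centre by elements of [mlt]
   fixing the identity modulo the centre. *)
Lemma stab_aut_mod h q : mlt h -> zc (h e) -> h * t q * h^-1 = t (iv (h e) · h q).
Proof.
move=> Mh Zh; have Zi := zc_iv Zh.
have Mj : mlt (t (iv (h e)) * h) by apply: spanM => //; exact: mlt_t.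
have := stab_aut q Mj; rewrite /= !tnE => <-; last by rewrite -{2}(loop1r HQ (h e)) (loopVK HQ).
rewrite invM tnV invV.
transitivity ((t (h e))^-1 * (h * t q * h^-1 * t (h e))); last by rewrite !mulA.
have c : commutes (t (h e)) (h * t q * h^-1).
  by apply: zc_mlt => //; apply: spanM; [apply: spanM => //; exact: mlt_t|exact: spanV].
by rewrite -c mulVK.
Qed.

(* The upper central series of [tspan K], starting from the centre of [mlt]. *)
Fixpoint upz (K : Q -> Prop) (i : nat) (f : sym Q) : Prop :=
  match i with
  | 0 => zg f
  | S i => tspan K f /\ forall k, K k -> upz K i (f^-1 * (t k)^-1 * f * t k)
  end.

(** Elements of [tspan K] induce even maps on the image of [K] in the quotient system, which is
    finite, so [even_nilpotent] applies. The index is one larger, because an element inducing the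
    identity is only shown to commute with the [t k] modulo the centre. *)
Theorem tspan_nilpotent K : subl mul e K -> fin_mod eqz K -> exists n, forall f, tspan K f -> upz K n f.
Proof.
move=> sK finK; have [Ke [KM KV]] := sK.
have [X [op [pi [Hop [surj [hom piE]]]]]] := eqz_quotient HQ.
pose A u := exists k, K k /\ pi k = u.
have cA : closed op A.
  by move=> _ _ [k [Kk <-]] [k' [Kk' <-]]; exists (iv (k · k')); split; [apply: KV; exact: KM|].
have HY := sub_hts cA Hop.
have piA k (Kk : K k) : A (pi k) by exists k.
pose pk k Kk : sig A := exist A (pi k) (piA k Kk).
have finY : fin (fun _ : sig A => True).
  have [R HR] := finK; have [L [_ [_ HL]]] := sub_cover A (map pi R).
  exists L => y _; apply: HL; have [k [Kk <-]] := proj2_sig y.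
  by have [r [Rr /piE ->]] := HR k Kk; exact: in_map.
pose o := pk e Ke.
have [n Hn] := even_nilpotent HY o finY.
pose lift (h : sym Q) (f : sym (sig A)) := ev HY f /\
  forall q y, K q -> pi q = proj1_sig y -> pi (h q) = proj1_sig (f y).
have liftM g g' h h' : tspan K h -> lift g g' -> lift h h' -> lift (g * h) (g' * h').
  move=> Hh [Eg Lg] [Eh Lh]; split=> [|q y Kq E]; first exact: spanM.
  by apply: Lg; [exact: (proj1 (tspan_preserves sK Hh))|exact: Lh].
have liftV h h' : tspan K h -> lift h h' -> lift h^-1 h'^-1.
  move=> Hh [Eh Lh]; split=> [|q y Kq E]; first exact: spanV.
  have Kq' := proj2 (tspan_preserves sK Hh) q Kq.
  have := Lh (h^-1 q) (pk _ Kq') Kq' eq_refl; rewrite invKr E => /sig_eq ->.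
  by rewrite invK.
have lift_t k (Kk : K k) : lift (t k) (tr HY o (pk k Kk)).
  split=> [|q y Kq E]; first exact: tr_ev.
  by rewrite tnE /= -E !hom (loop1 HQ) (ivK HQ).
have lift_ex h : tspan K h -> exists f, lift h f.
  elim=> {h} [|h [k [Kk ->]]|g h Hg [g' Lg] Hh [h' Lh]|h Hh [h' Lh]].
  - by exists 1; split=> //; exact: span1.
  - by exists (tr HY o (pk k Kk)).
  - by exists (g' * h'); exact: liftM.
  - by exists h'^-1; exact: liftV.
exists (S n) => h Hh; have [f Lf] := lift_ex h Hh.
have {Hn} : upper HY n f by apply: Hn; case: Lf.
elim: n h f Hh Lf => [|n IH] h f Hh Lf Uf; split=> // k Kk.
  move: Uf => /= Ef1; subst f.
  have Mh := tspan_mlt Hh.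
  have piz q : K q -> eqz (h q) q by move=> Kq; apply/piE; rewrite (proj2 Lf q (pk q Kq)).
  have Zhe : zc (h e) by apply/(eqz_e HQ); exact: piz.
  have [z [Zz E]] := piz k Kk.
  exists (iv (h e) · z); split; first by apply: zc_mul => //; exact: zc_iv.
  have := stab_aut_mod k Mh Zhe.
  rewrite E -(@zc_assoc _ _ _ HQ); last exact: zc_iv.
  set z' := iv (h e) · z; have Zz' : zc z' by apply: zc_mul => //; exact: zc_iv.
  rewrite zc_t // => /(f_equal (fun g => g * h)); rewrite mulKV => E'.
  apply: (@mulIl _ (t k * h)); transitivity (h * t k); first by grp.
  have c : commutes (t z') (t k * h) by apply: zc_mlt => //; apply: spanM => //; exact: mlt_t.
  by rewrite E' -c mulA.
have tk : tspan K (t k) by apply: span_in; exists k.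
have tkV : tspan K (t k)^-1 by exact: spanV.
have hV : tspan K h^-1 by exact: spanV.
have Lt := lift_t k Kk.
apply: (IH _ (f^-1 * (tr HY o (pk k Kk))^-1 * f * tr HY o (pk k Kk))).
- by do !apply: spanM.
- by apply: (liftM) => //; apply: (liftM) => //; apply: (liftM) => //; exact: liftV.
- by case: Uf => _; apply; exact: tr_ev.
Qed.

End InnerMaps.

(** * Permutation groups with all subgroups finitely generated *)

Lemma list_choice (S T : Type) (R : S -> T -> Prop) (l : list S) :
  exists l', (forall y, In y l' -> exists x, In x l /\ R x y) /\
    forall x, In x l -> (exists y, R x y) -> exists y, In y l' /\ R x y.
Proof.
elim: l => [|a l [l' [H1 H2]]]; first by exists [].
case: (classic (exists y, R a y)) => [[y Ray]|none].
  exists (y :: l'); split=> [y' [<-|/H1 [x [xl Rx]]]|x [<- _|xl /(H2 x xl) [y' [yl Rx]]]].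
  - by exists a; split=> //; left.
  - by exists x; split=> //; right.
  - by exists y; split=> //; left.
  - by exists y'; split=> //; right.
exists l'; split=> [y /H1 [x [xl Rx]]|x [<- //|xl]]; last exact: H2.
by exists x; split=> //; right.
Qed.

Section Noetherian.
Variable X : Type.
Implicit Types (f g h : sym X) (H K N Z : sym X -> Prop).

Definition spanl (l : list (sym X)) := span (fun f => In f l).
Definition fgen H := exists l, forall f, H f <-> spanl l f.
Definition noeth H := forall K, subgrp K -> (forall f, K f -> H f) -> fgen K.

Lemma spanl_min H l : subgrp H -> (forall f, In f l -> H f) -> forall f, spanl l f -> H f.
Proof. exact: span_min. Qed.

Lemma spanl_in l f : In f l -> spanl l f. Proof. exact: span_in. Qed.

Lemma spanl_incl l l' : incl l l' -> forall f, spanl l f -> spanl l' f.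
Proof. by move=> s; apply: span_mono => f /s; exact: span_in. Qed.

Lemma fgen_of H l : subgrp H -> (forall f, In f l -> H f) -> (forall f, H f -> spanl l f) -> fgen H.
Proof. by move=> sH lH Hl; exists l => f; split; [exact: Hl|exact: spanl_min]. Qed.

Lemma subgrp_inter H K : subgrp H -> subgrp K -> subgrp (fun f => H f /\ K f).
Proof.
move=> [H1 [HM HV]] [K1 [KM KV]]; split=> //.
by split=> [f g [? ?] [? ?]|f [? ?]]; split; auto.
Qed.

Fixpoint pw f n := match n with 0 => 1 | S n => f * pw f n end.

Lemma pw_add f n m : pw f (n + m) = pw f n * pw f m.
Proof. by elim: n => [|n IH] /=; rewrite ?mul1 // IH mulA. Qed.

Lemma pw_commutes f g n : commutes g f -> commutes g (pw f n).
Proof. by move=> c; elim: n => [|n IH] /=; [exact: commutes1|exact: commutesM]. Qed.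

(** Besides generators of the part of [K] in [spanl l], one element of [K] with the least positive
    exponent of [a] is enough, by division with remainder. *)
Lemma noeth_abelian l : (forall f g, In f l -> In g l -> commutes f g) -> noeth (spanl l).
Proof.
elim: l => [|a l IH] cl K sK KH.
  by apply: (fgen_of (l := [])) => // f /KH.
have {}IH : noeth (spanl l) by apply: IH => f g fl gl; apply: cl; right.
have [K1 [KM KV]] := sK.
have ca x : spanl l x -> commutes a x.
  by apply: span_commutes => f fl; apply: cl; [left|right].
have cp n x : spanl l x -> commutes x (pw a n).
  by move=> Sx; apply: pw_commutes; apply: commutes_sym; exact: ca.
pose P h := exists n m x, spanl l x /\ h = pw a n * (pw a m)^-1 * x.
have cpp n m : commutes (pw a n) (pw a m).
  by apply: pw_commutes; apply: commutes_sym; exact: pw_commutes.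
have PH h : spanl (a :: l) h -> P h.
  elim=> {h} [|h [<-|hl]|f g _ [n [m [x [Sx ->]]]] _ [n' [m' [x' [Sx' ->]]]]|h _ [n [m [x [Sx ->]]]]].
  - by exists 0, 0, 1; split; [exact: span1|grp].
  - by exists 1%nat, 0, 1; split; [exact: span1|grp].
  - by exists 0, 0, h; split; [exact: span_in|grp].
  - exists (n + n'), (m' + m), (x * x'); split; first exact: spanM.
    have c1 : commutes x (pw a n' * (pw a m')^-1).
      by apply: commutesM; [exact: cp|apply: commutesV; exact: cp].
    have c2 : commutes (pw a m)^-1 (pw a n') by apply/commutes_sym/commutesV.
    transitivity (pw a n * (pw a m)^-1 * (x * (pw a n' * (pw a m')^-1)) * x'); first by grp.
    rewrite c1; transitivity (pw a n * ((pw a m)^-1 * pw a n') * (pw a m')^-1 * (x * x')); first by grp.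
    by rewrite c2 !pw_add; grp.
  - exists m, n, x^-1; split; first exact: spanV.
    have c1 : commutes (pw a m * (pw a n)^-1) x^-1.
      by apply/commutesV/commutes_sym/commutesM; [exact: cp|apply: commutesV; exact: cp].
    by rewrite c1; grp.
have [lk Hlk] : fgen (fun f => K f /\ spanl l f).
  apply: IH; [apply: subgrp_inter => //; exact: span_subgrp|by move=> f []].
have lkK f : In f lk -> K f by move=> /spanl_in/Hlk [].
(* Up to inversion, the exponent of [a] may be taken to be a natural number. *)
have reduce l' :
    (forall d x, K (pw a d * x) -> spanl l x -> spanl l' (pw a d * x)) -> forall f, K f -> spanl l' f.
  move=> Hd f Kf; have [n [m [x [Sx E]]]] := PH f (KH f Kf).
  case: (Nat.le_ge_cases m n) => le.
    have E' : f = pw a (n - m) * x.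
      have en : n = (n - m) + m by lia.
      by rewrite E {1}en pw_add mulK.
    by rewrite E'; apply: Hd => //; rewrite -E'.
  have E' : f^-1 = pw a (m - n) * x^-1.
    have c1 : commutes (pw a (m - n)) x^-1 by apply/commutesV/commutes_sym; exact: cp.
    have em : m = (m - n) + n by lia.
    by rewrite E c1 {1}em pw_add; grp.
  rewrite -(invV f); apply: spanV; rewrite E'; apply: Hd; last exact: spanV.
  by rewrite -E'; exact: KV.
case: (classic (exists n, 0 < n /\ exists x, spanl l x /\ K (pw a n * x))) => [ex|none].
  have [n0 [[n0pos [x0 [Sx0 Kg]]] n0min]] := @least _ ex.
  set g := pw a n0 * x0 in Kg.
  have lkg f : In f lk -> spanl (g :: lk) f by move=> fl; apply: span_in; right.
  apply: (fgen_of (l := g :: lk)) => // [f [<-|/lkK] //|].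
  apply: reduce => // d; elim/(well_founded_induction lt_wf): d => d IHd x Kh Sx.
  case: (Nat.eq_dec d 0) => [d0|dpos].
    subst d; apply: (@span_mono _ (fun f => In f lk)) => [f fl|]; first exact: lkg.
    by apply/Hlk; split=> //; rewrite /= mul1.
  have le : n0 <= d.
    case: (Nat.le_gt_cases n0 d) => // lt; case: (n0min d lt); split; first lia.
    by exists x.
  have E : pw a d * x * g^-1 = pw a (d - n0) * (x * x0^-1).
    have c1 : commutes (x * x0^-1) (pw a n0)^-1.
      by apply/commutesV; apply: cp; apply: spanM => //; exact: spanV.
    transitivity (pw a d * ((x * x0^-1) * (pw a n0)^-1)); first by rewrite /g; grp.
    have ed : d = (d - n0) + n0 by lia.
    by rewrite c1 {1}ed pw_add; grp.
  rewrite -(mulKV g (pw a d * x)); apply: spanM; last by apply: span_in; left.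
  rewrite E; apply: IHd; [lia| |by apply: spanM => //; exact: spanV].
  by rewrite -E; apply: KM => //; exact: KV.
apply: (fgen_of (l := lk)) => //; apply: reduce => -[|d] x Kx Sx; first by apply/Hlk; split=> //; rewrite /= mul1.
by case: none; exists (S d); split; [lia|exists x].
Qed.

Lemma noeth_sub H K : noeth H -> (forall f, K f -> H f) -> noeth K.
Proof. by move=> nH KH N sN NK; apply: nH => // f /NK /KH. Qed.

Lemma noeth_finite_index N H F : subgrp N -> noeth N ->
  (forall h, H h -> exists f, In f F /\ exists n, N n /\ h = n * f) -> noeth H.
Proof.
move=> sN nN HF K sK KH; have [K1 [KM KV]] := sK; have [N1 [NM NV]] := sN.
have [lk Hlk] : fgen (fun f => K f /\ N f).
  by apply: nN; [exact: subgrp_inter|move=> f []].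
have [l' [l'1 l'2]] := list_choice (fun f k => K k /\ exists n, N n /\ k = n * f) F.
apply: (fgen_of (l := lk ++ l')) => // [f fl|h Kh].
  by case: (in_app_or _ _ _ fl) => [/spanl_in/Hlk []//|/l'1 [x [_ []]]].
have [f [fF [n [Nn E]]]] := HF h (KH h Kh).
have [|k [kl' [Kk [n' [Nn' E']]]]] := l'2 f fF; first by exists h; split=> //; exists n.
rewrite -(mulKV k h); apply: spanM; last by apply: span_in; apply/in_or_app; right.
apply: (spanl_incl (l := lk)); first by move=> x xl; apply/in_or_app; left.
apply/Hlk; split; first by apply: KM => //; exact: KV.
by rewrite E E' (_ : _ * _ = n * n'^-1); [apply: NM => //; exact: NV|grp].
Qed.

(* Schreier's lemma for a central subgroup [Z] with transversal [F]: the products of a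
   coset representative and a generator produce generators of [Z]. *)
Lemma fgen_central H Z F : fgen H -> subgrp H -> subgrp Z -> (forall z, Z z -> H z) ->
  (forall z h, Z z -> H h -> commutes z h) ->
  (forall h, H h -> exists f, In f F /\ exists z, Z z /\ h = z * f) -> fgen Z.
Proof.
move=> [l Hl] sH sZ ZH Zc HF; have [H1 [HM HV]] := sH; have [Z1 [ZM ZV]] := sZ.
have [F' HF'] := @fin_exact _ (fun f => In f F /\ H f) (ex_intro _ F (fun f => @proj1 _ _)).
have HFF h : H h -> exists f, In f F' /\ exists z, Z z /\ h = z * f.
  move=> Hh; have [f [fF [z [Zz E]]]] := HF h Hh; exists f; split; last by exists z.
  apply/HF'; split=> //; rewrite -(mulVK z f) -E; apply: HM => //; apply: HV; exact: ZH.
pose G := l ++ map (@sym_inv X) l.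
have GH g : In g G -> H g.
  move=> gG; case: (in_app_or _ _ _ gG) => [gl|]; first by apply/Hl; exact: spanl_in.
  by rewrite in_map_iff => -[g' [<- g'l]]; apply/HV/Hl; exact: spanl_in.
have [zs [zs1 zs2]] := list_choice
  (fun (fg : (sym X * sym X)%type) z => Z z /\ exists f', In f' F' /\ fst fg * snd fg = z * f') (list_prod F' G).
(* The representative of the coset of 1 need not be 1; its defect [z1] has to be among the
   generators. *)
have [f1 [f1F [z1 [Zz1 E1]]]] := HFF 1 H1.
have key h : spanl l h -> exists f, In f F' /\ exists z, spanl (z1 :: zs) z /\ h = z * f.
  have right_mul f g : In f F' -> In g G -> exists f', In f' F' /\ exists z, spanl (z1 :: zs) z /\ f * g = z * f'.
    move=> fF gG; have [|z [zzs [Zz [f' [f'F E]]]]] := zs2 (f, g) (in_prod _ _ _ _ fF gG).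
      have [|f' [f'F [z [Zz E]]]] := HFF (f * g); last by exists z; split=> //; exists f'.
      by apply: HM; [case: (proj2 (HF' f) fF)|exact: GH].
    by exists f'; split=> //; exists z; split=> //; apply: span_in; right.
  pose P h := exists f, In f F' /\ exists z, spanl (z1 :: zs) z /\ h = z * f.
  have PG k g : P k -> In g G -> P (k * g).
    move=> [f [fF [z [Sz ->]]]] gG; have [f' [f'F [z' [Sz' E]]]] := right_mul f g fF gG.
    by exists f'; split=> //; exists (z * z'); split; [exact: spanM|rewrite -!mulA E].
  have Pall k : spanl l k -> forall m, P m -> P (m * k) /\ P (m * k^-1).
    elim=> {k} [|k kl|f g _ IHf _ IHg|f _ IHf] m Pm.
    - by rewrite inv1 mulr1.
    - by split; apply: PG => //; apply/in_or_app; [left|right; exact: in_map].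
    - rewrite invM !mulA; split; first by apply: (proj1 (IHg _ _)); exact: (proj1 (IHf _ Pm)).
      by apply: (proj2 (IHf _ _)); exact: (proj2 (IHg _ Pm)).
    - by rewrite invV; case: (IHf m Pm).
  move=> Sh; rewrite -(mul1 h); apply: (proj1 (Pall h Sh 1 _)).
  by exists f1; split=> //; exists z1; split=> //; apply: span_in; left.
(* An element of [Z] is a product of the generators found so far with a representative that itself
   lies in [Z]. *)
have [FZ HFZ] := @fin_exact _ (fun f => In f F' /\ Z f) (ex_intro _ F' (fun f => @proj1 _ _)).
apply: (fgen_of (l := (z1 :: zs) ++ FZ)) => // [f fl|z Zz].
  case: (in_app_or _ _ _ fl) => [[<- //|/zs1 [x [_ [] //]]]|/HFZ [] //].
have Zs z0 : spanl (z1 :: zs) z0 -> Z z0.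
  by apply: spanl_min => // f [<- //|/zs1 [x [_ [] //]]].
have [f [fF [z0 [Sz0 E]]]] := key z (proj1 (Hl z) (ZH z Zz)).
rewrite E; apply: spanM.
  by apply: spanl_incl Sz0 => x xl; apply/in_or_app; left.
apply: span_in; apply/in_or_app; right; apply/HFZ; split=> //.
by rewrite -(mulVK z0 f) -E; apply: ZM => //; apply: ZV; exact: Zs.
Qed.

(* An ascending chain of finitely generated abelian subgroups is eventually constant,
   as its union is one of the finitely generated abelian subgroups. *)
Lemma max_abelian_exists C : subgrp C ->
  (forall K, subgrp K -> (forall f, K f -> C f) -> (forall f g, K f -> K g -> commutes f g) -> fgen K) ->
  exists D, subgrp D /\ (forall f, D f -> C f) /\ (forall f g, D f -> D g -> commutes f g) /\
    forall x, C x -> (forall f, D f -> commutes x f) -> D x.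
Proof.
move=> sC Hfg; apply: NNPP => none.
pose good l := (forall f, In f l -> C f) /\ (forall f g, In f l -> In g l -> commutes f g).
have next l : good l -> exists x, good (x :: l) /\ ~ spanl l x.
  move=> [lC lc]; apply: NNPP => nx; apply: none; exists (spanl l).
  split; first exact: span_subgrp.
  split; first exact: spanl_min.
  split; first exact: span_abelian.
  move=> x Cx xc; apply: NNPP => nSx; apply: nx; exists x; split=> //.
  have xl f : In f l -> commutes x f by move=> fl; apply: xc; exact: spanl_in.
  split=> [f [<-|/lC]//|f g [<-|fl] [<-|gl]] //; first exact: xl.
  - exact/commutes_sym/xl.
  - exact: lc.
pose pick l := epsilon (inhabits 1) (fun x => good (x :: l) /\ ~ spanl l x).
have pickP l : good l -> good (pick l :: l) /\ ~ spanl l (pick l).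
  by move=> gl; apply: (epsilon_spec (inhabits 1) (fun x => good (x :: l) /\ ~ spanl l x)); exact: next.
pose seq n := Nat.iter n (fun l => pick l :: l) [].
have gseq n : good (seq n).
  by elim: n => [|n IH]; [split|case: (pickP _ IH)].
have mono n m : n <= m -> incl (seq n) (seq m).
  by elim=> [|m' _ IH] x // /IH; right.
pose D f := exists n, spanl (seq n) f.
have up n m f : spanl (seq n) f -> spanl (seq (Nat.max n m)) f /\ spanl (seq (Nat.max m n)) f.
  by move=> Sf; split; apply: spanl_incl Sf; apply: mono; lia.
have sD : subgrp D.
  split; first by exists 0; exact: span1.
  split=> [f g [n Sf] [m Sg]|f [n Sf]]; last by exists n; exact: spanV.
  by exists (Nat.max n m); apply: spanM; [case: (up n m f Sf)|case: (up m n g Sg)].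
have [||ld Hld] := Hfg D sD.
- by move=> f [n]; apply: spanl_min => // g; case: (gseq n) => H _; exact: H.
- move=> f g [n Sf] [m Sg]; have [_ c] := gseq (Nat.max n m).
  apply: (span_abelian (S := fun f => In f (seq (Nat.max n m)))) => //; first by case: (up n m f Sf).
  by case: (up m n g Sg).
have [k Hk] : exists k, forall f, In f ld -> spanl (seq k) f.
  have : forall f, In f ld -> D f by move=> f fl; apply/Hld; exact: spanl_in.
  elim: ld {Hld} => [|a ld IH] ldD; first by exists 0.
  have [n Sa] := ldD a (or_introl eq_refl).
  have [|k Hk] := IH; first by move=> f fl; apply: ldD; right.
  exists (Nat.max n k) => f [<-|/Hk Sf]; first by case: (up n k a Sa).
  by case: (up k n f Sf).
have [_] := pickP _ (gseq k); apply.
apply: (spanl_min (l := ld)) => //; first exact: span_subgrp.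
by apply/Hld; exists (S k); apply: spanl_in; left.
Qed.

End Noetherian.

(** If no finite list generated [H], picking an element outside the closure at each stage would give
    a chain that never stops. The closure is abstract in order to serve both subloops and
    subgroups. *)
Lemma finitely_generated_of_acc (T : Type) (x0 : T) (H : T -> Prop) (cl : list T -> T -> Prop) :
  (forall l x, In x l -> cl l x) ->
  (forall l : nat -> list T, (forall n x, In x (l n) -> H x) -> (forall n, incl (l n) (l (S n))) ->
     exists N, forall x, cl (l (S N)) x -> cl (l N) x) ->
  exists l, (forall x, In x l -> H x) /\ forall x, H x -> cl l x.
Proof.
move=> cl_in acc; apply: NNPP => none.
have next l : (forall x, In x l -> H x) -> exists x, H x /\ ~ cl l x.
  move=> lH; apply: NNPP => nx; apply: none; exists l; split=> // x Hx.
  by apply: NNPP => ncl; apply: nx; exists x.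
pose pick l := epsilon (inhabits x0) (fun x => H x /\ ~ cl l x).
have pickP l : (forall x, In x l -> H x) -> H (pick l) /\ ~ cl l (pick l).
  by move=> lH; apply: (epsilon_spec (inhabits x0) (fun x => H x /\ ~ cl l x)); exact: next.
pose seq n := Nat.iter n (fun l => pick l :: l) [].
have seqH n x : In x (seq n) -> H x.
  by elim: n x => [|n IH] x //= [<-|/IH //]; case: (pickP _ IH).
have [N HN] := acc seq seqH (fun n x => @or_intror _ _).
by case: (pickP _ (seqH N)) => _; apply; apply: HN; apply: cl_in; left.
Qed.

(** * Finitely generated subgroups containing their centralizer *)

Section Finiteness.
Variables (Q : Type) (mul : Q -> Q -> Q) (e : Q).
Hypothesis HQ : is_CML mul e.
Local Notation "x · y" := (mul x y) (at level 40, left associativity).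
Local Notation t := (tn HQ).
Local Notation J := (Jq HQ).
Local Notation iv := (iv mul e).
Local Notation zc := (zc HQ).
Local Notation mlt := (mlt HQ).
Local Notation tnE := (tnE HQ).
Local Notation eqz := (eqz HQ).
Local Notation eqzg := (eqzg HQ).
Local Notation zg := (zg HQ).
Local Notation tspan := (tspan HQ).

Lemma zg_subgrp : subgrp zg.
Proof.
split; first by exists e; split; [exact: zc_e|rewrite tn1].
split=> [_ _ [z [Zz ->]] [z' [Zz' ->]]|_ [z [Zz ->]]].
  by exists (z · z'); split; [exact: zc_mul|rewrite zc_t].
by exists (iv z); split; [exact: zc_iv|rewrite tnV].
Qed.

Lemma zg_mlt f : zg f -> mlt f.
Proof. by move=> [z [_ ->]]; exact: mlt_t. Qed.

Lemma zg_commutes f g : zg f -> mlt g -> commutes f g.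
Proof. by move=> [z [Zz ->]]; exact: zc_mlt. Qed.

Lemma eqzg_zg f g : eqzg f g <-> exists n, zg n /\ f = n * g.
Proof.
split=> [[z [Zz ->]]|[_ [[z [Zz ->]] ->]]]; last by exists z.
by exists (t z); split=> //; exists z.
Qed.

Lemma mlt_subgrp : subgrp mlt. Proof. exact: span_subgrp. Qed.

Lemma mltV f : mlt f -> mlt f^-1. Proof. exact: spanV. Qed.
Lemma mltM f g : mlt f -> mlt g -> mlt (f * g). Proof. exact: spanM. Qed.

Lemma mlt_cube_central b m : mlt m -> commutes (t b * t b * t b) m.
Proof. by rewrite -tn_cube; apply: zc_mlt; exact: zc_cube. Qed.

Lemma mlt_tspan l : (forall f, In f l -> mlt f) -> exists xs, forall f, spanl l f -> tspan (fun x => In x xs) f.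
Proof.
elim: l => [|a l IH] lM.
  exists [] => f; apply: span_min; [exact: span_subgrp|by []].
have [|xs Hxs] := IH; first by move=> f fl; apply: lM; right.
have [w [_ Ea]] : exists w, (forall x, In x w -> True) /\ a = tw HQ w.
  apply: (tspan_words (K := fun _ => True)); first by split.
  by apply: span_mono (lM a (or_introl eq_refl)) => f [x ->]; apply: span_in; exists x.
exists (w ++ xs); apply: span_min; first exact: span_subgrp.
move=> f [<-|fl]; last first.
  by apply: tspan_mono (Hxs f (spanl_in l f fl)) => x xl; apply/in_or_app; right.
rewrite Ea; apply: (@tspan_mono _ _ _ _ (fun x => In x w)); first by move=> x xl; apply/in_or_app; left.
elim: w {Ea} => [|x w IHw] /=; first exact: span1.
apply: spanM; first by apply: span_in; exists x; split=> //; left.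
by apply: tspan_mono IHw => y yw; right.
Qed.

Lemma tspan_list_fin xs : fin_mod eqzg (tspan (fun x => In x xs)).
Proof.
have [F HF] := tspan_fin (gsub_subl _ _ _) (gsub_fin HQ xs).
exists F => f Hf; apply: HF; apply: tspan_mono Hf => x xl; apply: gsub_in; by left.
Qed.

Lemma fin_mod_sub (P P' : sym Q -> Prop) : (forall f, P f -> P' f) -> fin_mod eqzg P' -> fin_mod eqzg P.
Proof. by move=> sPP' [F HF]; exists F => f /sPP'; exact: HF. Qed.

(** The central part of [H] has finite index in [H]; Schreier's lemma makes it finitely generated,
    and being abelian it is noetherian. *)
Lemma noeth_center H : subgrp H -> (forall f, H f -> mlt f) -> fgen H -> fin_mod eqzg H ->
  fgen (fun f => H f /\ zg f) /\ noeth H.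
Proof.
move=> sH HM fgH /(fin_mod_inside (@eqzg_sym _ _ _ HQ) (@eqzg_trans _ _ _ HQ)) [F [FH HF]].
have [H1 [HMul HV]] := sH.
have sZ : subgrp (fun f => H f /\ zg f) by apply: subgrp_inter => //; exact: zg_subgrp.
have HF' h : H h -> exists f, In f F /\ exists z, (H z /\ zg z) /\ h = z * f.
  move=> Hh; have [f [fF /eqzg_zg [z [Zz E]]]] := HF h Hh; exists f; split=> //; exists z; split=> //; split=> //.
  by rewrite -(mulK f z) -E; apply: HMul => //; apply: HV; exact: FH.
have fgZ : fgen (fun f => H f /\ zg f).
  apply: (@fgen_central _ H _ F fgH sH sZ) => // [z [] //|z h [_ Zz] Hh].
  by apply: zg_commutes => //; exact: HM.
split=> //; apply: (@noeth_finite_index _ _ _ F sZ _ HF').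
have [l Hl] := fgZ.
have lZ f : In f l -> zg f by move=> /spanl_in/Hl [].
apply: (noeth_sub (H := spanl l)); last by move=> f /Hl.
by apply: noeth_abelian => f g /lZ Zf /lZ Zg; apply: zg_commutes => //; exact: zg_mlt.
Qed.

Lemma noeth_mlt : fgen mlt -> noeth mlt.
Proof.
move=> fgM; have [l Hl] := fgM.
have [|xs Hxs] := @mlt_tspan l; first by move=> f fl; apply/Hl; exact: spanl_in.
apply: (proj2 (noeth_center mlt_subgrp _ fgM _)) => //.
by apply: fin_mod_sub (tspan_list_fin xs) => f /Hl; exact: Hxs.
Qed.

(** Fix one [m0] in each fibre of [f]; the whole fibre lies in [m0 P1]. *)
Lemma fin_mod_fibres (S : Type) (f : sym Q -> S) (P P1 : sym Q -> Prop) :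
  (forall m, P m -> mlt m) -> (exists L, forall m, P m -> In (f m) L) ->
  (forall m m', P m -> P m' -> f m = f m' -> P1 (m^-1 * m')) -> fin_mod eqzg P1 -> fin_mod eqzg P.
Proof.
move=> PM [L HL] fib [F HF].
exists (flat_map (fun y => map (sym_mul (epsilon (inhabits 1) (fun m => P m /\ f m = y))) F) L) => m Pm.
set m0 := epsilon (inhabits 1) (fun m' => P m' /\ f m' = f m).
have [Pm0 E] : P m0 /\ f m0 = f m.
  by apply: (epsilon_spec (inhabits 1) (fun m' => P m' /\ f m' = f m)); exists m.
have [p [pF /eqzg_zg [z [Zz E']]]] := HF _ (fib m0 m Pm0 Pm E).
exists (m0 * p); split.
  apply/in_flat_map; exists (f m); split; first exact: HL.
  exact: (in_map (sym_mul m0)).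
apply/eqzg_zg; exists z; split=> //.
by rewrite -(mulKl m0 m) E' !mulA (zg_commutes Zz (PM m0 Pm0)).
Qed.

Variable xs : list Q.

(* The iterated commutators with the [t x], [x] in [xs], reach the centre in [j] steps. *)
Fixpoint eng (j : nat) (m : sym Q) : Prop :=
  match j with
  | 0 => zg m
  | S j => mlt m /\ forall x, In x xs -> eng j ((t x)^-1 * m * t x * m^-1)
  end.

Lemma eng_mlt j m : eng j m -> mlt m.
Proof. by case: j => [|j []] //; exact: zg_mlt. Qed.

Lemma eng_zg_mul j z m : zg z -> eng j m -> eng j (z * m).
Proof.
have [_ [ZM _]] := zg_subgrp.
case: j => [|j] Zz; first exact: ZM.
move=> [Mm Hm]; split; first by apply: mltM => //; exact: zg_mlt.
move=> x xl; rewrite (_ : _ * _ = (t x)^-1 * m * t x * m^-1); first exact: Hm.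
have c := zg_commutes Zz (mltV (mlt_t HQ x)).
have MD : mlt ((t x)^-1 * m * t x * m^-1).
  by do !apply: mltM => //; try apply: mltV => //; exact: mlt_t.
transitivity ((t x)^-1 * z * (m * t x * m^-1) * z^-1); first by grp.
rewrite -c; transitivity (z * ((t x)^-1 * m * t x * m^-1) * z^-1); first by grp.
by rewrite (zg_commutes Zz MD) mulK.
Qed.

Lemma eng_step j m : eng j m -> eng (S j) m.
Proof.
elim: j m => [|j IH] m; last by move=> [Mm Hm]; split=> // x xl; apply: IH; exact: Hm.
move=> Zm; split; first exact: zg_mlt.
move=> x _; rewrite -(mulA _ m) (zg_commutes Zm (mlt_t HQ x)) mulA mulVl mul1 mulV.
exact: (proj1 zg_subgrp).
Qed.

Lemma eng_le i j m : i <= j -> eng i m -> eng j m.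
Proof. by move=> le Em; elim: le => // k _; exact: eng_step. Qed.

Hypothesis fgZ : fgen zg.
Hypothesis cent_fin : fin_mod eqzg (fun m => mlt m /\ forall x, In x xs -> commutes m (t x)).

Lemma noeth_zg : noeth zg.
Proof.
have [l Hl] := fgZ; have lZ f : In f l -> zg f by move=> /spanl_in/Hl.
apply: (noeth_sub (H := spanl l)); last by move=> f /Hl.
by apply: noeth_abelian => f g /lZ Zf /lZ Zg; apply: zg_commutes => //; exact: zg_mlt.
Qed.

Lemma torsion_fin : fin (fun f => zg f /\ f * f * f = 1).
Proof.
have [Z1 [ZM ZV]] := zg_subgrp.
have cZ f g : zg f -> zg g -> commutes f g by move=> Zf Zg; apply: zg_commutes => //; exact: zg_mlt.
have [||l Hl] := noeth_zg (K := fun f => zg f /\ f * f * f = 1).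
- split; first by rewrite !mul1.
  split=> [f g [Zf f3] [Zg g3]|f [Zf f3]].
    split; first exact: ZM.
    by rewrite (commutes_cube (cZ f g Zf Zg)) f3 g3 mul1.
  by split; [exact: ZV|rewrite -!invM mulA f3 inv1].
- by move=> f [].
have lP f : In f l -> zg f /\ f * f * f = 1 by move=> /spanl_in/Hl.
apply: (@fin_sub _ _ (spanl l)); first by move=> f /Hl.
by apply: span_fin3 => [f g /lP [Zf _] /lP [Zg _]|f /lP []]; first exact: cZ.
Qed.

(** The commutators of an element of [eng 1] with the [t x] are central, and of exponent 3 since the
    cube of [t x] is central; they determine it up to the centralizer of the [t x]. An element of
    [eng (S j)] is determined up to [eng 1] by its commutators modulo the centre. *)
Lemma eng_fin j : fin_mod eqzg (eng j).
Proof.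
elim: j => [|j IH].
  exists [1] => f Zf; exists 1; split; first by left.
  by apply/eqzg_zg; exists f; rewrite mulr1.
have fin1 : fin_mod eqzg (eng 1).
  have [T HT] := torsion_fin; have [L HL] := fin_words T (length xs).
  apply: (@fin_mod_fibres _ (fun m => map (fun x => (t x)^-1 * m * t x * m^-1) xs) _ _ _ _ _ cent_fin).
  - by move=> m [].
  - exists L => m [Mm Hm]; apply: HL; split; last by rewrite length_map.
    move=> d; rewrite in_map_iff => -[x [<- xl]]; apply: HT; split; first exact: Hm.
    have := Hm x xl => /= Zd; set d' := _ * m^-1 in Zd *.
    have E : (t x)^-1 * m * t x = d' * m by rewrite /d' mulKV.
    clearbody d'.
    have cd := zg_commutes Zd (mltV (mlt_t HQ x)).
    have E3 : (t x)^-1 * ((t x)^-1 * ((t x)^-1 * m * t x) * t x) * t x = d' * d' * d' * m.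
      rewrite E (_ : (t x)^-1 * (d' * m) * t x = d' * ((t x)^-1 * m * t x)); last by rewrite !mulA cd.
      rewrite E (_ : (t x)^-1 * (d' * (d' * m)) * t x = d' * d' * ((t x)^-1 * m * t x)).
        by rewrite E !mulA.
      by rewrite !mulA -cd -(mulA d') -cd !mulA.
    apply: (@mulIr _ m); rewrite mul1 -E3.
    have c3 := mlt_cube_central x Mm.
    transitivity ((t x * t x * t x)^-1 * (m * (t x * t x * t x))); first by grp.
    by rewrite -c3 mulVK.
  - move=> m m' [Mm _] [Mm' _] /map_ext_in_iff E; split; first by apply: mltM => //; exact: mltV.
    move=> x /E; set d := _ * m^-1 => E'.
    have E1 : m = d^-1 * ((t x)^-1 * m * t x) by rewrite /d; grp.
    have E2 : m' = d^-1 * ((t x)^-1 * m' * t x) by rewrite E'; grp.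
    by rewrite /commutes; apply: (@mulIl _ (t x)^-1); rewrite mulA {2}E1 {2}E2; grp.
have [F HF] := IH.
pose pick d := epsilon (inhabits 1) (fun f => In f F /\ eqzg d f).
have pickP d : eng j d -> In (pick d) F /\ eqzg d (pick d).
  by move=> Ed; apply: (epsilon_spec (inhabits 1) (fun f => In f F /\ eqzg d f)); exact: HF.
have [L HL] := fin_words F (length xs).
apply: (@fin_mod_fibres _ (fun m => map (fun x => pick ((t x)^-1 * m * t x * m^-1)) xs) _ _ _ _ _ fin1).
- by move=> m [].
- exists L => m [Mm Hm]; apply: HL; split; last by rewrite length_map.
  by move=> d; rewrite in_map_iff => -[x [<- xl]]; case: (pickP _ (Hm x xl)).
- move=> m m' [Mm Hm] [Mm' Hm'] /map_ext_in_iff E; split; first by apply: mltM => //; exact: mltV.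
  move=> x xl; have := E x xl; set d := _ * m^-1; set d' := _ * m'^-1 => Ed.
  have /eqzg_zg [z [Zz Ez]] : eqzg d' d.
    apply: eqzg_trans (proj2 (pickP _ (Hm' x xl))) _; rewrite -/d' -Ed.
    by apply: eqzg_sym; exact: (proj2 (pickP _ (Hm x xl))).
  have E1 : (t x)^-1 * m * t x = d * m by rewrite /d mulKV.
  have E2 : (t x)^-1 * m' * t x = z * d * m' by rewrite -Ez /d' mulKV.
  rewrite (_ : _ * _ = ((t x)^-1 * m * t x)^-1 * ((t x)^-1 * m' * t x) * m'^-1 * m) /=; last by grp.
  rewrite E1 E2 (_ : _ * _ = m^-1 * (d^-1 * (z * d)) * m); last by grp.
  have Md : mlt d by exact: eng_mlt (Hm x xl).
  rewrite (zg_commutes Zz Md) mulVK -mulA (zg_commutes Zz Mm) mulVK //.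
Qed.

(** * A uniform Engel bound *)

Section UpperCentral.
Variable K : Q -> Prop.
Hypothesis sK : subl mul e K.

Lemma zg_tspan f : (forall z, zc z -> K z) -> zg f -> tspan K f.
Proof. by move=> zK [z [Zz ->]]; apply: span_in; exists z; split=> //; exact: zK. Qed.

Lemma tspan_conj_ind (P : sym Q -> Prop) :
  (forall k f, K k -> P f -> P (t k * f * (t k)^-1)) -> forall h f, tspan K h -> P f -> P (h * f * h^-1).
Proof.
move=> HP h f /(tspan_words sK) [w [Kw ->]] Pf.
elim: w Kw => [|a w IH] Kw /=; first by rewrite inv1 mul1 mulr1.
rewrite invM (_ : _ * _ = t a * (tw HQ w * f * (tw HQ w)^-1) * (t a)^-1); last by rewrite !mulA.
by apply: HP; [apply: Kw; left|apply: IH => x xw; apply: Kw; right].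
Qed.

(** The definition tests commutators with the generators [t k] only; [Hall] extends this to all of
    [tspan K], as conjugation requires. *)
Lemma upz_normal i : subgrp (upz HQ K i) /\
  forall h f, tspan K h -> upz HQ K i f -> upz HQ K i (h * f * h^-1).
Proof.
have HTM g h : tspan K g -> tspan K h -> tspan K (g * h) by exact: spanM.
have HTV g : tspan K g -> tspan K g^-1 by exact: spanV.
have Tt k : K k -> tspan K (t k) by move=> Kk; apply: span_in; exists k.
elim: i => [|i [[U1 [UM UV]] UJ]].
  split; first exact: zg_subgrp.
  move=> h f Th Zf; rewrite -(zg_commutes Zf (tspan_mlt Th)) mulK //.
have UJV h f : tspan K h -> upz HQ K i f -> upz HQ K i (h^-1 * f * h).
  by move=> Th Uf; rewrite -{2}(invV h); apply: UJ => //; exact: HTV.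
have S1 : upz HQ K (S i) 1.
  by split=> [|k _]; [exact: span1|rewrite (_ : _ * _ = 1) //; grp].
split.
  split=> //; split=> [f g [Tf Hf] [Tg Hg]|f [Tf Hf]].
    split=> [|k Kk]; first exact: HTM.
    rewrite (_ : _ * _ = (g^-1 * (f^-1 * (t k)^-1 * f * t k) * g) * (g^-1 * (t k)^-1 * g * t k)); last by grp.
    by apply: UM; [apply: UJV => //; exact: Hf|exact: Hg].
  split=> [|k Kk]; first exact: HTV.
  rewrite (_ : _ * _ = f * (f^-1 * (t k)^-1 * f * t k)^-1 * f^-1); last by grp.
  by apply: UJ => //; apply: UV; exact: Hf.
have Hall f m : upz HQ K (S i) f -> tspan K m -> upz HQ K i (f^-1 * m^-1 * f * m).
  move=> [Tf Hf]; elim=> {m} [|m [k [Kk ->]]|m n Tm IHm Tn IHn|m Tm IHm].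
  - by rewrite (_ : _ * _ = 1) //; grp.
  - exact: Hf.
  - rewrite (_ : _ * _ = (f^-1 * n^-1 * f * n) * (n^-1 * (f^-1 * m^-1 * f * m) * n)); last by grp.
    by apply: UM => //; exact: UJV.
  - rewrite (_ : _ * _ = m * (f^-1 * m^-1 * f * m)^-1 * m^-1); last by grp.
    by apply: UJ => //; exact: UV.
apply: tspan_conj_ind => h f Kh Uf; split=> [|k Kk].
  by apply: (HTM); [apply: (HTM); [exact: Tt|case: Uf]|apply: HTV; exact: Tt].
have Th := Tt h Kh; have Tk := Tt k Kk; move: (t h) (t k) Th Tk => a b Ta Tb.
rewrite (_ : _ * _ = a * (f^-1 * (a^-1 * b * a)^-1 * f * (a^-1 * b * a)) * a^-1); last by grp.
by apply: UJ => //; apply: Hall => //; apply: (HTM) => //; apply: (HTM) => //; exact: HTV.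
Qed.

End UpperCentral.

Definition cover (n : nat) (P : sym Q -> Prop) :=
  exists L, length L <= n /\ forall f, P f -> exists g, In g L /\ eqzg f g.

(* A subgroup [V] of at most [n] classes modulo the centre lies in [eng n]: as long as
   [eng j] misses part of [V], so does [eng (S j)] minus [eng j]. *)
Lemma eng_cover n (V : sym Q -> Prop) : cover n V ->
  (forall j, (exists v, V v /\ ~ eng j v) -> exists v, V v /\ eng (S j) v /\ ~ eng j v) ->
  forall v, V v -> eng n v.
Proof.
move=> cV grow.
have step j : j <= n -> cover (n - j) (fun v => V v /\ ~ eng j v).
  elim: j => [|j IH] le.
    have [L [len HL]] := cV; exists L; split=> [|v [/HL] //]; lia.
  have [|L [len HL]] := IH; first lia.
  case: (classic (exists v, V v /\ ~ eng j v)) => [/grow [w [Vw [Ew nEw]]]|none]; last first.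
    exists []; split=> [|v [Vv nEv]] /=; first lia.
    by case: none; exists v; split=> // Ev; apply: nEv; exact: eng_step.
  have [g [gL wg]] := HL w (conj Vw nEw).
  exists (remove (@eq_dec _) g L); split.
    by have := remove_length_lt (@eq_dec _) L g gL; lia.
  move=> v [Vv nEv]; have [|g' [gL' vg']] := HL v.
    by split=> // Ev; apply: nEv; exact: eng_step.
  exists g'; split=> //; apply: in_in_remove => // E; apply: nEv; rewrite E in vg'.
  have /eqzg_zg [z [Zz ->]] : eqzg v w by apply: eqzg_trans vg' _; exact: eqzg_sym.
  exact: eng_zg_mul.
move=> v Vv; apply: NNPP => nEv; have [L [len HL]] := step n (Nat.le_refl n).
have [g [gL _]] := HL v (conj Vv nEv).
by case: L len gL {HL} => [|? ?] /=; [|lia].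
Qed.

Lemma conj_closed_tspan (W : sym Q -> Prop) :
  (forall x w, In x xs -> W w -> W ((t x)^-1 * w * t x) /\ W (t x * w * (t x)^-1)) ->
  forall h, tspan (fun x => In x xs) h -> forall w, W w -> W (h^-1 * w * h) /\ W (h * w * h^-1).
Proof.
move=> HW h; elim=> {h} [|h [x [xl ->]]|g h _ IHg _ IHh|h _ IHh] w Ww.
- by rewrite inv1 !mul1 !mulr1.
- exact: HW.
- split.
    rewrite (_ : _ * _ = h^-1 * (g^-1 * w * g) * h); last by grp.
    by apply: (proj1 (IHh _ _)); exact: (proj1 (IHg _ Ww)).
  rewrite (_ : _ * _ = g * (h * w * h^-1) * g^-1); last by grp.
  by apply: (proj2 (IHg _ _)); exact: (proj2 (IHh _ Ww)).
- by rewrite !invV; case: (IHh w Ww).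
Qed.

(** The constant [3 ^ length R] bounds the classes of [V]: modulo the centre [w] has at most
    [length R] conjugates under [T], they commute and have central cubes. It does not depend on [K],
    [m] or [W]; nilpotency enters only through the existence of a lowest element. *)
Lemma eng_uniform : exists n, forall (K : Q -> Prop) (m : nat) (W : sym Q -> Prop),
  (forall x, In x xs -> K x) -> subgrp W -> (forall f, zg f -> W f) -> (forall w, W w -> mlt w) ->
  (forall f g, W f -> W g -> commutes f g) -> (forall w, W w -> zg (w * w * w)) ->
  (forall x w, In x xs -> W w -> W ((t x)^-1 * w * t x) /\ W (t x * w * (t x)^-1)) ->
  (forall w, W w -> upz HQ K m w) -> forall w, W w -> eng n w.
Proof.
have [R [RH HR]] := fin_mod_inside (@eqzg_sym _ _ _ HQ) (@eqzg_trans _ _ _ HQ) (tspan_list_fin xs).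
exists (3 ^ length R) => K m W xK sW ZW WM abW cubW conjW upW w Ww.
have [W1 [WMul WV]] := sW; have cW := conj_closed_tspan _ conjW.
pose T := tspan (fun x => In x xs).
pose V := span (fun f => zg f \/ exists h, T h /\ f = h^-1 * w * h).
have VW f : V f -> W f.
  apply: span_min => // {}f [/ZW //|[h [Th ->]]]; exact: (proj1 (cW h Th w Ww)).
have ZV f : zg f -> V f by move=> Zf; apply: span_in; left.
apply: (@eng_cover _ V); last first.
- apply: span_in; right; exists 1; split; first exact: span1.
  by rewrite inv1 mul1 mulr1.
- move=> j [v0 [Vv0 nEv0]].
  (* An element outside [eng j] and lowest in the series [upz]: its commutators with the [t x] are
     lower still, so they lie in [eng j]. *)
  have [i [[v [Vv [nEv Uv]]] imin]] : exists i, (exists v, V v /\ ~ eng j v /\ upz HQ K i v) /\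
      forall i', i' < i -> ~ exists v, V v /\ ~ eng j v /\ upz HQ K i' v.
    by apply: least; exists m, v0; split=> //; split=> //; apply: upW; exact: VW.
  exists v; split=> //; split=> //; split; first by apply: WM; exact: VW.
  case: i Uv imin => [Zv _|i [_ Uv] imin].
    by case: nEv; apply: (@eng_le 0) => //; lia.
  move=> x xl; apply: NNPP => nE; apply: (imin i); first lia.
  have Vc : V ((t x)^-1 * v * t x).
    rewrite -{2}(invV (t x)); move: v Vv {nEv Uv nE}; apply: span_conj => f [Zf|[h [Th ->]]].
      apply: ZV; rewrite invV -(zg_commutes Zf (mltV (mlt_t HQ x))) mulKV //.
    apply: span_in; right; exists (h * t x); split; last by grp.
    by apply: spanM => //; apply: span_in; exists x.
  exists ((t x)^-1 * v * t x * v^-1); split; first by apply: spanM => //; exact: spanV.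
  split=> //; have := Uv x (xK x xl).
  have c : commutes ((t x)^-1 * v * t x) v^-1.
    by apply: commutesV; apply: abW; exact: VW.
  by rewrite c -!mulA.
have [|||L [len HL]] := @span_cover3 _ zg (map (fun r => r^-1 * w * r) R) zg_subgrp.
- move=> n f Zn; rewrite in_map_iff => -[r [<- rR]]; apply: zg_commutes => //; apply: WM.
  by apply: (proj1 (cW r _ w Ww)); exact: RH.
- move=> f g; rewrite !in_map_iff => -[r [<- rR]] [r' [<- rR']].
  by apply: abW; apply: (proj1 (cW _ _ w Ww)); exact: RH.
- by move=> f; rewrite in_map_iff => -[r [<- rR]]; apply: cubW; apply: (proj1 (cW r _ w Ww)); exact: RH.
exists L; split; first by rewrite length_map in len.
move=> f Vf; have [|g [gL E]] := HL f; last by exists g; split=> //; apply/eqzg_zg.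
apply: span_mono Vf => {}f [Zf|[h [Th ->]]]; first by apply: span_in; left.
have [r [rR /eqzg_zg [z [Zz ->]]]] := HR h Th.
apply: span_in; right; apply/in_map_iff; exists r; split=> //.
symmetry; transitivity (r^-1 * (z^-1 * (w * z)) * r); first by grp.
by rewrite -(zg_commutes Zz (WM w Ww)) mulVK.
Qed.

Lemma Jq_tn x y q : J x y * t q * (J x y)^-1 = t (J x y q).
Proof. by apply: stab_aut; [exact: Jq_mlt|exact: Jq_e]. Qed.

Lemma Jq_aut x y p q : J x y (p · q) = J x y p · J x y q.
Proof.
have := f_equal (fun f => f * J x y) (Jq_tn x y p); rewrite mulKV => /(f_equal (fun f : sym Q => f q)).
by [].
Qed.

Lemma Jq_fix x y q : commutes (t x) (t y) -> J x q y = y.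
Proof.
move=> c; change ((t x)^-1 ((t q)^-1 (t x (t q y))) = y).
have E : x · (q · y) = q · (x · y).
  rewrite (loopC HQ q y) (loopC HQ q (x · y)).
  by have := f_equal (fun f : sym Q => f q) (comm_t c).
by rewrite tnE tnE E -!tnE !invK.
Qed.

Lemma Jq_tn_commutes x y q : commutes (t x) (t y) -> commutes (J x q) (t y).
Proof. by move=> c; apply: (@mulIr _ (J x q)^-1); rewrite Jq_tn Jq_fix // mulK. Qed.

Lemma mul_assoc_comm x y q : commutes (t x) (t y) -> (q · x) · y = q · (x · y).
Proof.
move=> c; rewrite (loopC HQ _ y) (loopC HQ q x) (loopC HQ q (x · y)).
have := f_equal (fun f : sym Q => f q) (comm_t c); rewrite tnE => ->.
by rewrite c.
Qed.

Lemma commutator_conj (f g h : sym Q) : commutes f g ->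
  f^-1 * (g * g * h * g^-1)^-1 * f * (g * g * h * g^-1) = g * (f^-1 * h^-1 * f * h) * g^-1.
Proof.
move=> c; have c' : f^-1 * g = g * f^-1 by symmetry; apply: commutesV; exact: commutes_sym.
transitivity (f^-1 * g * h^-1 * g^-1 * (g^-1 * f * (g * g)) * h * g^-1); first by grp.
have -> : g^-1 * f * (g * g) = g * f.
  by rewrite mulA -(mulA g^-1 f g) c mulVK.
by rewrite c'; grp.
Qed.

(** * Maximal abelian normal subloops *)

Section MaximalAbelian.
Variable K : Q -> Prop.
Hypotheses (sK : subl mul e K) (zK : forall z, zc z -> K z) (finK : fin_mod eqz K).
Hypothesis xsK : forall x, In x xs -> K x.

(** Abelian normal subloops of [K] above the centre: the last clause expresses normality through
    associators, and inverses are [b^-3 · b^2] with [b^-3] central. *)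
Definition good (B : Q -> Prop) :=
  (forall b, B b -> K b) /\ (forall z, zc z -> B z) /\ (forall b b', B b -> B b' -> B (b · b')) /\
  (forall b b', B b -> B b' -> commutes (t b) (t b')) /\
  (forall b k k', B b -> K k -> K k' -> B (iv k' · J b k k')).

(** A good [B] is a union of classes modulo the centre, so it is determined by the representatives
    that it misses; a minimal set of these gives a maximal [B]. *)
Lemma good_max : exists B, good B /\
  forall B', good B' -> (forall b, B b -> B' b) -> forall b, B' b -> B b.
Proof.
have [R [RK HR]] := fin_mod_inside (@eqz_sym _ _ _ HQ) (@eqz_trans _ _ _ HQ) finK.
have [||P [[B [gB PB]] [_ Pmin]]] := @fin_minimal _
  (fun P => exists B, good B /\ forall r, P r <-> In r R /\ ~ B r) (fun r => In r R /\ ~ zc r).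
- exists zc; split=> //; split=> //; split=> //; split; first by move=> b b'; exact: zc_mul.
  split; first by move=> b b' Zb _; exact: Zb.
  move=> b k k' Zb _ _; rewrite (_ : J b k k' = k').
    by rewrite (loopC HQ) (ivr HQ); exact: zc_e.
  have c : J b k = 1 by rewrite /Jq -(mulA _ (t b)) Zb; grp.
  by rewrite c.
- by exists R => r [].
exists B; split=> // B' gB' BB' b B'b.
have [KB' [ZB' [MB' _]]] := gB'; have [_ [ZB [MB _]]] := gB.
have [r [rR [z [Zz E]]]] := HR b (KB' b B'b).
rewrite E; apply: MB; first exact: ZB.
apply: NNPP => nBr.
have Pr : P r by apply/PB.
have [_] : In r R /\ ~ B' r; last first.
  apply; rewrite -(loopVK HQ z r) -E; apply: MB' => //; apply: ZB'; exact: zc_iv.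
apply: (Pmin (fun r => In r R /\ ~ B' r)) Pr; first by exists B'.
by move=> r' [r'R nB']; apply/PB; split=> // Br'; apply: nB'; exact: BB'.
Qed.

Section Weights.
Variable B : Q -> Prop.
Hypothesis gB : good B.

(** In effect the normal closure of the translations by [B] in [tspan K], since
    [t_k^-1 t_b t_k = t_b J b k]. *)
Definition wgrp := span (fun f => zg f \/ (exists b, B b /\ f = t b) \/
  exists b k, B b /\ K k /\ f = J b k).

Lemma good_inv b k k' : B b -> K k -> K k' -> B (iv k' · J k b k').
Proof.
have [KB [ZB [MB [cB JB]]]] := gB; move=> Bb Kk Kk'.
set n := iv k' · J b k k'; have Bn : B n by exact: JB.
have E : J b k k' = k' · n by rewrite /n (loopK HQ).
have -> : J k b = J b k * J b k by rewrite -JqV; symmetry; apply: inv_eq; exact: Jq_cube.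
change (B (iv k' · J b k (J b k k'))).
rewrite E Jq_aut (Jq_fix k (cB b n Bb Bn)) E (mul_assoc_comm _ (cB n n Bn Bn)) (loopVK HQ).
exact: MB.
Qed.

Lemma wgrp_tspan f : wgrp f -> tspan K f.
Proof.
have [KB _] := gB.
have Tk k : K k -> tspan K (t k) by move=> Kk; apply: span_in; exists k.
apply: span_mono => {}f [/(zg_tspan _ zK) //|[[b [/KB Kb ->]]|[b [k [/KB Kb [Kk ->]]]]]]; first exact: Tk.
by rewrite /Jq; do !apply: spanM; try apply: spanV; exact: Tk.
Qed.

Lemma wgrp_abelian f g : wgrp f -> wgrp g -> commutes f g.
Proof.
have [KB [ZB [MB [cB JB]]]] := gB.
apply: span_abelian => {}f {}g.
have JtB b k b' : B b -> B b' -> commutes (J b k) (t b').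
  by move=> Bb Bb'; apply: Jq_tn_commutes; exact: cB.
move=> [Zf|Hf] Hg.
  apply: zg_commutes => //; case: Hg => [/zg_mlt //|[[b [_ ->]]|[b [k [_ [_ ->]]]]]]; [exact: mlt_t|exact: Jq_mlt].
case: Hg => [Zg|Hg].
  apply/commutes_sym/zg_commutes => //; case: Hf => [[b [_ ->]]|[b [k [_ [_ ->]]]]]; [exact: mlt_t|exact: Jq_mlt].
move: Hf Hg => [[b [Bb ->]]|[b [k [Bb [Kk ->]]]]] [[b' [Bb' ->]]|[b' [k' [Bb' [Kk' ->]]]]].
- exact: cB.
- exact/commutes_sym/JtB.
- exact: JtB.
(* Conjugation by [J b k] fixes [b'] and sends [k'] to [r · k'] with [r] in [B]; by
   [commutator_conj] such a factor does not change [J b' k']. *)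
set r := iv k' · J b k k'; have Br : B r by exact: JB.
have E : J b k k' = r · k' by rewrite (loopC HQ) /r (loopK HQ).
suff : J b k * J b' k' * (J b k)^-1 = J b' k'.
  by move=> E'; apply: (@mulIr _ (J b k)^-1); rewrite E' mulK.
transitivity ((J b k * t b' * (J b k)^-1)^-1 * (J b k * t k' * (J b k)^-1)^-1 *
   (J b k * t b' * (J b k)^-1) * (J b k * t k' * (J b k)^-1)).
  by rewrite {2}/Jq; move: (J b k) => u; grp.
rewrite !Jq_tn (Jq_fix k (cB b b' Bb Bb')) E tn_mul (commutator_conj _ (cB b' r Bb' Br)).
by rewrite -/(J b' k') -(JtB b' k' r Bb' Br) mulK.
Qed.

Lemma wgrp_conj k f : K k -> wgrp f -> wgrp ((t k)^-1 * f * t k).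
Proof.
have [KB [ZB [MB [cB JB]]]] := gB; move=> Kk.
have Wt b : B b -> wgrp (t b) by move=> Bb; apply: span_in; right; left; exists b.
have WJ b h : B b -> K h -> wgrp (J b h) by move=> Bb Kh; apply: span_in; right; right; exists b, h.
have Wtk b : B b -> wgrp ((t k)^-1 * t b * t k).
  move=> Bb; rewrite (_ : _ * _ = t b * J b k); last by rewrite /Jq; grp.
  by apply: spanM; [exact: Wt|exact: WJ].
rewrite -{2}(invV (t k)); apply: span_conj => {}f.
rewrite invV => -[Zf|[[b [Bb ->]]|[b [h [Bb [Kh ->]]]]]].
- rewrite -(zg_commutes Zf (mltV (mlt_t HQ k))) mulKV; apply: span_in; by left.
- exact: Wtk.
set r := iv k · J h b k; have Br : B r by exact: good_inv.
have E : J h b k = r · k by rewrite (loopC HQ) /r (loopK HQ).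
rewrite (_ : _ * _ = J b h * ((J h b * t k * (J h b)^-1)^-1 * t k)); last by rewrite JqV -(JqV HQ b h); grp.
rewrite Jq_tn E tn_mul; apply: spanM; first exact: WJ.
rewrite (_ : _ * _ = t r * ((t k)^-1 * t r * t k)^-1 * ((t k)^-1 * t r * t k)^-1); last by grp.
by apply: spanM; [apply: spanM; [exact: Wt|]|]; apply: spanV; exact: Wtk.
Qed.

Lemma wgrp_conjV k f : K k -> wgrp f -> wgrp (t k * f * (t k)^-1).
Proof.
have [_ [_ KV]] := sK.
by move=> /KV Kk /(wgrp_conj Kk); rewrite tnV invV.
Qed.

Lemma wgrp_cube f : wgrp f -> zg (f * f * f).
Proof.
have [Z1 [ZM ZV]] := zg_subgrp.
elim=> {f} [|f [Zf|[[b [Bb ->]]|[b [k [Bb [Kk ->]]]]]]|f g Wf Zf Wg Zg|f _ Zf].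
- by rewrite !mul1.
- by apply: (ZM) => //; exact: ZM.
- by rewrite -tn_cube; exists ((b · b) · b); split=> //; exact: zc_cube.
- by rewrite Jq_cube.
- by rewrite (commutes_cube (wgrp_abelian Wf Wg)); exact: ZM.
- by rewrite -!invM mulA; exact: ZV.
Qed.

End Weights.

Lemma mul_order3 (a u : sym Q) : commutes u a -> u * u * u = 1 ->
  a^-1 * u = a * (a * u)^-1 * (a * u)^-1.
Proof.
move=> c u3; apply: (@mulIr _ (a * u * (a * u))).
transitivity a; last by grp.
transitivity (a^-1 * (u * a) * (u * a) * u); first by grp.
rewrite c; transitivity (u * a * (u * u)); first by grp.
by rewrite c; transitivity (a * (u * u * u)); [grp|rewrite u3 mulr1].
Qed.

Lemma clos_commutes (S : Q -> Prop) : (forall x y, S x -> S y -> commutes (t x) (t y)) ->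
  forall x y, clos mul S x -> clos mul S y -> commutes (t x) (t y).
Proof.
move=> HS.
have sp x : clos mul S x -> span (fun f => exists y, S y /\ f = t y) (t x).
  elim=> {x} [x Sx|x y _ Hx _ Hy]; first by apply: span_in; exists x.
  by rewrite tn_mul; do !apply: spanM => //; exact: spanV.
move=> x y /sp Sx /sp Sy; apply: (span_abelian _ Sx Sy) => f g [a [Sa ->]] [b [Sb ->]].
exact: HS.
Qed.

Lemma good_adjoin B c : good B -> K c -> (forall b, B b -> commutes (t c) (t b)) ->
  (forall k k', K k -> K k' -> B (iv k' · J c k k')) -> good (clos mul (fun y => B y \/ y = c)).
Proof.
move=> gB Kc cc Jc; have [KB [ZB [MB [cB JB]]]] := gB; have [Ke [KM KV]] := sK.
have cS x y : B x \/ x = c -> B y \/ y = c -> commutes (t x) (t y).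
  by move=> [Bx|->] [By|->] //; [exact: cB|apply/commutes_sym; exact: cc|exact: cc].
have BS b : B b -> clos mul (fun y => B y \/ y = c) b by move=> Bb; apply: clos_in; left.
split; first by apply: clos_min => // b [/KB //|->].
split; first by move=> z Zz; apply: BS; exact: ZB.
split; first by move=> b b'; exact: clos_op.
split; first exact: clos_commutes.
suff H b : clos mul (fun y => B y \/ y = c) b -> forall k k', K k -> K k' -> B (iv k' · J b k k').
  by move=> b k k' Sb Kk Kk'; apply: BS; exact: H.
elim=> {b} [b [Bb|->]|a b Sa Ha Sb Hb] k k' Kk Kk'; [exact: JB|exact: Jc|].
have cab : commutes (t a) (t b) by exact: (clos_commutes cS).
have -> : J (a · b) k = J a k * J b k.
  rewrite {1}/Jq (comm_t cab); transitivity ((t b)^-1 * (J a k * t b) * J b k); first by rewrite /Jq; grp.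
  by rewrite (Jq_tn_commutes k cab) mulVK.
set n1 := iv k' · J a k k'; set n2 := iv k' · J b k k'.
have Bn1 : B n1 by exact: Ha.
have Bn2 : B n2 by exact: Hb.
have E1 : J a k k' = k' · n1 by rewrite /n1 (loopK HQ).
have E2 : J b k k' = k' · n2 by rewrite /n2 (loopK HQ).
change (B (iv k' · J a k (J b k k'))).
have can2 : commutes (t a) (t n2) by apply: (clos_commutes cS) => //; exact: BS.
rewrite E2 Jq_aut (Jq_fix k can2) E1 (mul_assoc_comm _ (cB n1 n2 Bn1 Bn2)) (loopVK HQ).
exact: MB.
Qed.

(* A maximal good [B] is its own centralizer in [K]: an element [c] of the centralizer
   outside [B] and lowest in the upper central series could be adjoined. *)
Lemma good_max_centralizer B : good B ->
  (forall B', good B' -> (forall b, B b -> B' b) -> forall b, B' b -> B b) ->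
  forall c, K c -> (forall b, B b -> commutes (t c) (t b)) -> B c.
Proof.
move=> gB maxB; have [KB [ZB [MB [cB JB]]]] := gB; have [Ke [KM KV]] := sK.
pose C c := K c /\ forall b, B b -> commutes (t c) (t b).
suff low i : forall c, C c -> upz HQ K i (t c) -> B c.
  move=> c Kc cc; have [n Hn] := tspan_nilpotent sK finK.
  by apply: (low n) => //; apply: Hn; apply: span_in; exists c.
elim: i => [|i IH] c [Kc cc] Uc.
  by have [z [Zz E]] := Uc; rewrite (tn_inj E); exact: ZB.
have [[U1 [UM UV]] UJ] := upz_normal sK i.
have Tk k : K k -> tspan K (t k) by move=> Kk; apply: span_in; exists k.
have UJk k f : K k -> upz HQ K i f -> upz HQ K i ((t k)^-1 * f * t k).
  by move=> Kk Uf; rewrite -{2}(invV (t k)); apply: UJ => //; apply: spanV; exact: Tk.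
pose D f := forall w, wgrp B w -> commutes f w.
have [D1 [DM DV]] : subgrp D := centralizer_subgrp (wgrp B).
have DJk k f : K k -> D f -> D ((t k)^-1 * f * t k).
  move=> Kk Df w Ww; have := commutesJ (t k)^-1 (Df _ (wgrp_conjV gB Kk Ww)).
  by rewrite invV (_ : (t k)^-1 * (t k * w * (t k)^-1) * t k = w) //; grp.
have Dc : D (t c).
  apply: span_commutes => f [Zf|[[b [Bb ->]]|[b [k [Bb [Kk ->]]]]]].
  - by apply/commutes_sym/zg_commutes => //; exact: mlt_t.
  - exact: cc.
  - by apply/commutes_sym/Jq_tn_commutes/commutes_sym; exact: cc.
have key k k' : K k -> K k' -> B (iv k' · J k c k').
  move=> Kk Kk'; set r := iv k' · J k c k'.
  have E : J k c k' = r · k' by rewrite (loopC HQ) /r (loopK HQ).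
  have TJ : tspan K (J k c).
    by rewrite /Jq; do !apply: spanM; try apply: spanV; exact: Tk.
  have Kr : K r by apply: (KM); [exact: KV|exact: (proj1 (tspan_preserves sK TJ))].
  (* [d] gives access to [t r]: by [dE] it is a product of conjugates of [J c k] and its inverse,
     hence it centralizes [wgrp B] and lies in [upz] at level [i]. *)
  set j := J r k'; pose d := (t r)^-1 * j.
  have jr : commutes j (t r) by exact: Jq_comm_l.
  have jk : commutes j (t k') by exact: Jq_comm_r.
  have j3 : j * j * j = 1 by exact: Jq_cube.
  have dE : d = (J c k)^-1 * ((t k')^-1 * J c k * t k').
    transitivity ((J k c * t k' * (J k c)^-1)^-1 * t k'); last by rewrite -(JqV HQ c k); grp.
    rewrite Jq_tn E tn_mul.
    transitivity (t r * (t r * j)^-1 * (t r * j)^-1); last by rewrite /j /Jq; grp.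
    exact: mul_order3.
  have DJ : D (J c k).
    rewrite (_ : J c k = (t c)^-1 * ((t k)^-1 * t c * t k)); last by rewrite /Jq; grp.
    by apply: (DM); [exact: DV|exact: DJk].
  have Dd : D d by rewrite dE; apply: (DM); [exact: DV|exact: DJk].
  (* As [d] commutes with [t b], the maps [j] and [t r] conjugate [t b] alike; evaluation at [e]
     then gives [j b = b]. *)
  have cr b : B b -> commutes (t r) (t b).
    move=> Bb; have Wb : wgrp B (t b) by apply: span_in; right; left; exists b.
    have H : t (j b) = t r * t b * (t r)^-1.
      rewrite -Jq_tn -/j; have := Dd (t b) Wb; rewrite /commutes /d => Ed.
      apply: (@mulIr _ j); rewrite mulKV; apply: (@mulIl _ (t r)^-1).
      by rewrite mulA Ed; grp.
    have jb : j b = b.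
      rewrite -(tn_e HQ (j b)) H.
      change (t r (t b ((t r)^-1 e)) = b).
      by rewrite !tnE (loop1r HQ) (loopC HQ b) (loopK HQ).
    by rewrite jb in H; apply: (@mulIr _ (t r)^-1); rewrite -H mulK.
  apply: IH; first by split.
  have UJc : upz HQ K i (J c k) by exact: (proj2 Uc).
  have Ud : upz HQ K i d by rewrite dE; apply: (UM); [exact: UV|exact: UJk].
  have rE : t r = j * d^-1 by rewrite /d; grp.
  (* In [j = [t_r, t_k']] with [t_r = j d^-1] the factor [j] drops out, since it commutes with
     [t_k']; a commutator of [d] remains. *)
  have Uj : upz HQ K i j.
    have -> : j = d * ((t k')^-1 * d^-1 * t k').
      rewrite {1}/j {1}/Jq rE.
      transitivity (d * (j^-1 * ((t k')^-1 * j * t k')) * ((t k')^-1 * d^-1 * t k')); first by grp.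
      by rewrite -(mulA _ j) jk mulVK mulVl mulr1.
    by apply: (UM) => //; apply: UJk => //; exact: UV.
  by rewrite rE; apply: (UM) => //; exact: UV.
have Jc k k' : K k -> K k' -> B (iv k' · J c k k').
  move=> Kk Kk'; have Bn := key k k' Kk Kk'; set n := iv k' · J k c k' in Bn.
  have E : J k c k' = k' · n by rewrite /n (loopK HQ).
  have -> : J c k = J k c * J k c by rewrite -JqV; symmetry; apply: inv_eq; exact: Jq_cube.
  change (B (iv k' · J k c (J k c k'))).
  have Jn : J k c n = n.
    by rewrite -(JqV HQ c k) -{1}(Jq_fix k (cc n Bn)) invK.
  rewrite E Jq_aut Jn E (mul_assoc_comm _ (cB n n Bn Bn)) (loopVK HQ).
  exact: MB.
apply: (maxB _ (good_adjoin gB Kc cc Jc)); first by move=> b Bb; apply: clos_in; left.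
by apply: clos_in; right.
Qed.

End MaximalAbelian.

(** Two elements of cube 1 in one class differ by a central element of cube 1, and [torsion_fin]
    counts these. *)
Lemma eng_torsion_fin n : fin (fun u => eng n u /\ u * u * u = 1).
Proof.
have [F HF] := eng_fin n; have [T HT] := torsion_fin.
have [U0 [U1 U2]] := list_choice (fun f u => eqzg u f /\ mlt u /\ u * u * u = 1) F.
exists (flat_map (fun z => map (sym_mul z) U0) T) => u [Eu u3].
have [f [fF uf]] := HF u Eu; have Mu := eng_mlt _ _ Eu.
have [|v [vU [vf [Mv v3]]]] := U2 f fF; first by exists u.
have /eqzg_zg [z [Zz E]] : eqzg u v by apply: eqzg_trans uf _; exact: eqzg_sym.
apply/in_flat_map; exists z; split; last by rewrite E; exact: (in_map (sym_mul z)).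
apply: HT; split=> //; rewrite -u3 E (commutes_cube (zg_commutes Zz Mv)) v3 mulr1 //.
Qed.

(* An element of [K] is determined modulo the centre by its action on [B], which takes
   values in the elements of order 3 of [eng n], together with an element of [B]. *)
Lemma class_bound : exists N, forall K, subl mul e K -> (forall z, zc z -> K z) -> fin_mod eqz K ->
  (forall x, In x xs -> K x) -> forall ks, (forall k, In k ks -> K k) -> NoDup ks ->
  (forall k k', In k ks -> In k' ks -> eqz k k' -> k = k') -> length ks <= N.
Proof.
have [n Hn] := eng_uniform; have [F HF] := eng_fin n.
have [T HT] := eng_torsion_fin n; have [L HL] := fin_words T (length F).
(* [n], [F], [T] and [L] are chosen before [K], so the bound is uniform. *)
exists (length (list_prod L F)) => K sK zK finK xsK ks ksK ndks ineq.
have [B [gB maxB]] := good_max zK finK.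
have [KB [ZB [MB [cB JB]]]] := gB; have [Ke [KM KV]] := sK.
have WE w : wgrp K B w -> eng n w.
  have [m Hm] := tspan_nilpotent sK finK.
  have Tw : forall f, wgrp K B f -> tspan K f := wgrp_tspan zK gB.
  apply: (Hn K m (wgrp K B)) => //.
  - exact: span_subgrp.
  - by move=> f Zf; apply: span_in; left.
  - by move=> f /Tw; exact: tspan_mlt.
  - exact: wgrp_abelian.
  - exact: wgrp_cube.
  - by move=> x f /xsK Kx Wf; split; [exact: wgrp_conj|exact: wgrp_conjV].
  - by move=> f /Tw; exact: Hm.
have cent := good_max_centralizer sK finK gB maxB.
(* An element of [B] whose translation lies in the class of [f]; if there is none, an arbitrary
   element of [B]. *)
pose bf f := epsilon (inhabits e) (fun b => B b /\ ((exists b', B b' /\ eqzg (t b') f) -> eqzg (t b) f)).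
have bfP f : B (bf f) /\ ((exists b', B b' /\ eqzg (t b') f) -> eqzg (t (bf f)) f).
  apply: (epsilon_spec (inhabits e) (fun b => B b /\ ((exists b', B b' /\ eqzg (t b') f) -> eqzg (t b) f))).
  case: (classic (exists b', B b' /\ eqzg (t b') f)) => [[b [Bb E]]|none]; first by exists b.
  by exists e; split=> //; apply: ZB; exact: zc_e.
pose code k := map (fun f => J (bf f) k) F.
have codeL k : K k -> In (code k) L.
  move=> Kk; apply: HL; split; last by rewrite length_map.
  move=> u; rewrite in_map_iff => -[f [<- fF]]; apply: HT; split; last exact: Jq_cube.
  by apply: WE; apply: span_in; right; right; exists (bf f), k; split; [case: (bfP f)|].
have code_eq k1 k2 b : code k1 = code k2 -> B b -> J b k1 = J b k2.
  move=> /map_ext_in_iff E Bb.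
  have [f [fF bfE]] : exists f, In f F /\ eqzg (t b) f.
    by apply: HF; apply: WE; apply: span_in; right; left; exists b.
  have [_ /(_ (ex_intro _ b (conj Bb bfE))) H] := bfP f.
  have /eqzg_zg [z [Zz tb]] : eqzg (t b) (t (bf f)) by apply: eqzg_trans bfE _; exact: eqzg_sym.
  have Jb k : J b k = J (bf f) k.
    rewrite /Jq tb invM; transitivity ((t (bf f))^-1 * (z^-1 * ((t k)^-1 * z)) * t (bf f) * t k); first by grp.
    by rewrite -(zg_commutes Zz (mltV (mlt_t HQ k))) mulVK; grp.
  by rewrite !Jb; exact: E.
(* Equal codes mean that [f] commutes with the translations by [B]. The map [j] differs from [f] by
   [t c] and fixes [e], so it is an automorphism; it turns out to fix [b], which carries commutation
   over to [t c]. *)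
have same k1 k2 : K k1 -> K k2 -> code k1 = code k2 -> B (k2 · iv k1).
  move=> Kk1 Kk2 E; apply: cent; first by apply: KM => //; exact: KV.
  move=> b Bb; have EJ := code_eq k1 k2 b E Bb.
  set f := t k2 * (t k1)^-1; set c := k2 · iv k1.
  have fb : f * t b * f^-1 = t b.
    have Ec k : (t k)^-1 * t b * t k = t b * J b k by rewrite /Jq; grp.
    rewrite (_ : f * t b * f^-1 = t k2 * ((t k1)^-1 * t b * t k1) * (t k2)^-1); last by rewrite /f; grp.
    by rewrite Ec EJ -Ec; grp.
  have fe : f e = c.
    by change (t k2 ((t k1)^-1 e) = c); rewrite -tnV !tnE (loop1r HQ).
  have Mf : mlt f by apply: mltM; [|apply: mltV]; exact: mlt_t.
  pose j := (t c)^-1 * f.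
  have Mj : mlt j by apply: mltM => //; apply: mltV; exact: mlt_t.
  have je : j e = e.
    change ((t c)^-1 (f e) = e); rewrite fe -tnV tnE (loopC HQ) (ivr HQ) //.
  have H : t (j b) = (t c)^-1 * t b * t c.
    by rewrite -stab_aut // -{2}fb /j; grp.
  have jb : t c (t (j b) (iv c)) = b.
    by rewrite H; change (t c ((t c)^-1 (t b (t c (iv c)))) = b); rewrite invKr !tnE (ivr HQ) (loop1r HQ).
  rewrite !tnE (loopC HQ (j b)) (loopK HQ) in jb.
  by rewrite jb in H; apply: (@mulIl _ (t c)^-1); rewrite mulVK mulA -H.
pose base cd := epsilon (inhabits e) (fun k => K k /\ code k = cd).
have baseP k : K k -> K (base (code k)) /\ code (base (code k)) = code k.
  by move=> Kk; apply: (epsilon_spec (inhabits e) (fun k' => K k' /\ code k' = code k)); exists k.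
pose pos k := epsilon (inhabits 1) (fun f => In f F /\ eqzg (t (k · iv (base (code k)))) f).
have posP k : K k -> In (pos k) F /\ eqzg (t (k · iv (base (code k)))) (pos k).
  move=> Kk; have [Kb Eb] := baseP k Kk.
  apply: (epsilon_spec (inhabits 1) (fun f => In f F /\ eqzg (t (k · iv (base (code k)))) f)).
  by apply: HF; apply: WE; apply: span_in; right; left; eexists; split=> //; exact: same.
rewrite -(length_map (fun k => (code k, pos k))); apply: NoDup_incl_length.
  apply: Injective_map_NoDup_in => // k k' kl kl' [Ec Ep].
  have Kk := ksK k kl; have Kk' := ksK k' kl'; apply: ineq => //.
  have [_ P1] := posP k Kk; have [_ P2] := posP k' Kk'.
  rewrite -Ep -Ec in P2; move: (base (code k)) P1 P2 => k0 P1 P2.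
  have [z [Zz E]] : eqzg (t (k · iv k0)) (t (k' · iv k0)) by apply: eqzg_trans P1 _; exact: eqzg_sym.
  have {}E : k · iv k0 = z · (k' · iv k0) by rewrite -zc_t // in E; exact: tn_inj E.
  exists z; split=> //; rewrite -(loopK HQ k0 k) (loopC HQ (iv k0)) E (zc_assoc' _ _ Zz).
  by rewrite (loopC HQ k') (loopK HQ).
move=> _ /in_map_iff [k [<- kl]]; have Kk := ksK k kl.
by apply: in_prod; [exact: codeL|case: (posP k Kk)].
Qed.

(** Any list of pairwise inequivalent elements lies in a subloop to which [class_bound] applies; a
    longest such list represents all classes. *)
Lemma loop_fin_mod : fin_mod eqz (fun _ : Q => True).
Proof.
have [N HN] := class_bound.
pose indep ks := NoDup ks /\ forall k k', In k ks -> In k' ks -> eqz k k' -> k = k'.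
have bound ks : indep ks -> length ks <= N.
  move=> [nd ineq]; pose K := gsub mul e (fun x => In x (xs ++ ks) \/ zc x).
  apply: (HN K) => //.
  - exact: gsub_subl.
  - by move=> z Zz; apply: gsub_in; right.
  - exact: gsub_fin.
  - by move=> x xl; apply: gsub_in; left; apply/in_or_app; left.
  - by move=> x xl; apply: gsub_in; left; apply/in_or_app; right.
have [m [[ks [ind len]] mmin]] : exists m, (exists ks, indep ks /\ N - length ks = m) /\
    forall m', m' < m -> ~ exists ks, indep ks /\ N - length ks = m'.
  by apply: least; exists (N - 0), []; split=> //; split; [constructor|].
exists ks => x _; apply: NNPP => none; have [nd ineq] := ind.
have ind' : indep (x :: ks).
  split; first by constructor=> // xl; apply: none; exists x; split=> //; exact: eqz_refl.
  move=> k k' [<-|kl] [<-|kl'] E //; last exact: ineq.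
  - by case: none; exists k'.
  - by case: none; exists k; split=> //; exact: eqz_sym.
apply: (mmin (N - length (x :: ks))); last by exists (x :: ks).
by have := bound _ ind'; rewrite -len /=; lia.
Qed.

End Finiteness.

Section Conditions.
Variables (Q : Type) (mul : Q -> Q -> Q) (e : Q).
Hypothesis HQ : is_CML mul e.
Local Notation t := (tn HQ).
Local Notation mlt := (mlt HQ).
Local Notation zg := (zg HQ).
Local Notation eqz := (eqz HQ).
Local Notation eqzg := (eqzg HQ).
Local Notation tspan := (tspan HQ).

Theorem noeth_of_self_centralizing L : subgrp L -> (forall f, L f -> mlt f) -> fgen L ->
  (forall x, mlt x -> (forall f, L f -> commutes x f) -> L x) -> noeth mlt.
Proof.
move=> sL LM fgL cL; have [l Hl] := fgL.
have [|xs Hxs] := @mlt_tspan _ _ _ HQ l; first by move=> f /spanl_in/Hl /LM.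
have finL : fin_mod eqzg L.
  by apply: fin_mod_sub (tspan_list_fin HQ xs) => f /Hl; exact: Hxs.
have ZL f : zg f -> L f.
  by move=> Zf; apply: cL; [exact: zg_mlt Zf|move=> g /LM Mg; exact: (zg_commutes Zf Mg)].
have fgZ : fgen zg.
  have [[lz Hlz] _] := noeth_center sL LM fgL finL.
  exists lz => f; rewrite -Hlz; split=> [Zf|[]] //; split=> //; exact: ZL.
(* Elements of [L] are products of the [t x] and their inverses, so what commutes with all [t x]
   centralizes [L] and lies in it. *)
have finC : fin_mod eqzg (fun m => mlt m /\ forall x, In x xs -> commutes m (t x)).
  apply: fin_mod_sub finL => m [Mm cm]; apply: cL => // f /Hl/Hxs.
  by apply: span_commutes => {}f [x [xl ->]]; exact: cm.
have [F HF] : fin_mod eqzg mlt.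
  have sQ : subl mul e (fun _ : Q => True) by split.
  apply: fin_mod_sub (tspan_fin sQ (loop_fin_mod xs fgZ finC)) => f.
  by apply: span_mono => {}f [x ->]; apply: span_in; exists x.
apply: (@noeth_finite_index _ _ _ F (zg_subgrp HQ) (noeth_zg fgZ)) => h /HF [f [fF /eqzg_zg [z [Zz E]]]].
by exists f; split=> //; exists z.
Qed.

Lemma fgen_abelian_of_fgen H D : subgrp H -> (forall f, H f -> mlt f) -> fgen H ->
  subgrp D -> (forall f, D f -> H f) -> fgen D.
Proof.
move=> sH HM fgH sD DH; have [l Hl] := fgH.
have [|xs Hxs] := @mlt_tspan _ _ _ HQ l; first by move=> f /spanl_in/Hl /HM.
have finH : fin_mod eqzg H.
  by apply: fin_mod_sub (tspan_list_fin HQ xs) => f /Hl; exact: Hxs.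
by have [_ nH] := noeth_center sH HM fgH finH; exact: nH.
Qed.

End Conditions.

(** * The conditions of the theorem *)

Section Transfer.
Variable Q : Type.

(** [up] and [down] pass between predicates on functions, as in the statement, and predicates on
    [sym Q]. *)
Definition up (H : pset Q) (f : sym Q) : Prop := H (fn f).
Definition down (P : sym Q -> Prop) : pset Q := fun f => exists g : sym Q, P g /\ f = fn g.

Lemma fn_inj (f g : sym Q) : fn f = fn g -> f = g.
Proof. by move=> E; apply: sym_ext => x; rewrite E. Qed.

Lemma up_down P f : up (down P) f <-> P f.
Proof. by split=> [[g [Pg /fn_inj ->]]|Pf] //; exists f. Qed.

Lemma is_inv_sym (f : sym Q) g : is_inv (fn f) g <-> g = fn f^-1.
Proof.
split=> [[H1 H2]|->]; last by split=> x /=; [exact: fnK|exact: fvK].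
by apply: functional_extensionality => x /=; rewrite -{2}(H2 x) fnK.
Qed.

Lemma gen_span (S : pset Q) : (forall f, S f -> exists g : sym Q, f = fn g) ->
  forall f, gen S f <-> exists g : sym Q, f = fn g /\ span (up S) g.
Proof.
move=> HS f; split=> [|[g [-> Sg]]].
  elim=> {f} [|f Sf|f g _ [f' [-> Sf]] _ [g' [-> Sg]]|f g _ [f' [-> Sf]] inv].
  - by exists 1; split=> //; exact: span1.
  - by have [g E] := HS f Sf; subst f; exists g; split=> //; exact: span_in.
  - by exists (f' * g'); split=> //; exact: spanM.
  - by exists f'^-1; split; [exact/is_inv_sym|exact: spanV].
elim: Sg => {g} [|g Sg|g h _ IHg _ IHh|g _ IHg].
- exact: gen_id.
- exact: gen_in.
- exact: (gen_comp IHg IHh).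
- by apply: (gen_inv IHg); apply/is_inv_sym.
Qed.

Lemma gen_min (S H : pset Q) : is_subgroup H -> subset S H -> subset (gen S) H.
Proof. by move=> [H1 [HM HV]] SH f; elim=> {f} *; eauto. Qed.

Variables (G : sym Q -> Prop) (M : pset Q).
Hypotheses (sG : subgrp G) (MG : forall f, M f <-> down G f).

Lemma sub_sym H : subgroup_of M H -> forall f, H f -> exists g : sym Q, f = fn g.
Proof. by move=> [_ HM] f /HM /MG [g [_ ->]]; exists g. Qed.

Lemma up_subgrp H : subgroup_of M H -> subgrp (up H) /\ forall f, up H f -> G f.
Proof.
move=> [[H1 [HMul HV]] HM]; split; last by move=> f /HM /MG /up_down.
split=> //; split=> [f g Hf Hg|f Hf]; first exact: (HMul _ _ Hf Hg).
by apply: (HV _ _ Hf); apply/is_inv_sym.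
Qed.

Lemma down_subgroup P : subgrp P -> (forall f, P f -> G f) -> subgroup_of M (down P).
Proof.
move=> [P1 [PM PV]] PG; split; last by move=> f [g [/PG Gg ->]]; apply/MG; exists g.
split; first by exists 1.
split=> [_ _ [f [Pf ->]] [g [Pg ->]]|_ g [f [Pf ->]] /is_inv_sym ->].
  by exists (f * g); split=> //; exact: PM.
by exists f^-1; split=> //; exact: PV.
Qed.

Lemma fin_gen_up H : subgroup_of M H -> fin_gen H <-> fgen (up H).
Proof.
move=> sH; have Hs := sub_sym sH; split=> [[l Hl]|[l Hl]].
  have [l' [l'1 l'2]] := list_choice (fun f (g : sym Q) => f = fn g) l.
  exists l' => f; have gs : forall g, In g l -> exists g' : sym Q, g = fn g'.
    by move=> g gl; apply: Hs; apply/Hl; exact: gen_in.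
  rewrite /up Hl (gen_span _ gs); split=> [[g [/fn_inj -> Sg]]|Sf].
    apply: span_mono Sg => {}g gl; have [g' [g'l E]] := l'2 _ gl (ex_intro _ g eq_refl).
    by rewrite (fn_inj _ _ E); exact: span_in.
  exists f; split=> //; apply: span_mono Sf => {}g /l'1 [g' [g'l E]].
  by apply: span_in; rewrite /up -E.
exists (map (@fn Q) l) => f.
have gs : forall g, In g (map (@fn Q) l) -> exists g' : sym Q, g = fn g'.
  by move=> g /in_map_iff [g' [<- _]]; exists g'.
have spE g : span (up (fun g => In g (map (@fn Q) l))) g <-> spanl l g.
  split; apply: span_mono => {}g; last by move=> gl; apply: span_in; exact: in_map.
  by rewrite /up in_map_iff => -[g' [/fn_inj <- gl]]; exact: span_in.
rewrite (gen_span _ gs); split=> [Hf|[g [-> /spE /Hl]] //].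
by have [g E] := Hs f Hf; exists g; split=> //; apply/spE/Hl; rewrite /up -E.
Qed.

Lemma chain_stable (C : nat -> pset Q) : noeth G -> (forall i, subgroup_of M (C i)) ->
  (forall i, subset (C i) (C (S i))) -> exists N, forall m, N <= m -> forall f, C m f <-> C N f.
Proof.
move=> nG sC mono.
have up_le i j : i <= j -> subset (C i) (C j).
  by elim=> // k _ IH f /IH; exact: mono.
pose U f := exists i, up (C i) f.
have [||l Hl] := nG U.
- split; first by exists 0; case: (up_subgrp (sC 0)) => -[].
  split=> [f g [i Hf] [j Hg]|f [i Hf]].
    exists (Nat.max i j); have [[_ [HM _]] _] := up_subgrp (sC (Nat.max i j)).
    by apply: HM; [apply: (up_le i)|apply: (up_le j)] => //; lia.
  by exists i; have [[_ [_ HV]] _] := up_subgrp (sC i); exact: HV.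
- by move=> f [i Hf]; case: (up_subgrp (sC i)) => _; exact.
have [N HN] : exists N, forall f, In f l -> up (C N) f.
  have : forall f, In f l -> U f by move=> f fl; apply/Hl; exact: spanl_in.
  elim: l {Hl} => [|a l IH] lU; first by exists 0.
  have [i Ha] := lU a (or_introl eq_refl).
  have [|N HN] := IH; first by move=> f fl; apply: lU; right.
  exists (Nat.max i N) => f [<-|/HN]; first by apply: (up_le i) => //; lia.
  by apply: (up_le N); lia.
exists N => m le f; split; last exact: up_le.
move=> Hf; have [g E] := sub_sym (sC m) _ Hf; subst f.
have [sN _] := up_subgrp (sC N).
by apply: (spanl_min sN HN); apply/Hl; exists m.
Qed.

Definition central_prod (H : pset Q) (D : sym Q -> Prop) (f : sym Q) := exists h d, up H h /\ D d /\ f = h * d.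

Variables (H : pset Q) (D : sym Q -> Prop).
Hypotheses (sH : subgroup_of M H) (sD : subgrp D) (DG : forall f, D f -> G f).
Hypothesis abD : forall f g, D f -> D g -> commutes f g.
Hypothesis cHD : forall f h, D f -> up H h -> commutes f h.

Lemma central_prod_subgrp : subgrp (central_prod H D) /\ forall f, central_prod H D f -> G f.
Proof.
have [[H1 [HM HV]] HG] := up_subgrp sH; have [D1 [DM DV]] := sD; have [G1 [GM GV]] := sG.
split; last by move=> _ [h [d [/HG Gh [/DG Gd ->]]]]; exact: GM.
split; first by exists 1, 1; rewrite mul1.
split=> [_ _ [h [d [Hh [Dd ->]]]] [h' [d' [Hh' [Dd' ->]]]]|_ [h [d [Hh [Dd ->]]]]].
  exists (h * h'), (d * d'); split; first exact: HM.
  by split; [exact: DM|rewrite -!mulA (mulA d) (cHD Dd Hh') !mulA].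
exists h^-1, d^-1; split; first exact: HV.
by split; [exact: DV|rewrite -invM (cHD Dd Hh)].
Qed.

Lemma central_prod_l h : up H h -> central_prod H D h.
Proof. by move=> Hh; exists h, 1; split=> //; split; [case: sD|rewrite mulr1]. Qed.

Lemma central_prod_r d : D d -> central_prod H D d.
Proof. by move=> Dd; exists 1, d; split; [case: (up_subgrp sH) => -[]|split=> //; rewrite mul1]. Qed.

Definition commutators (A B : pset Q) : pset Q := fun h => exists a b ai bi,
  A a /\ B b /\ is_inv a ai /\ is_inv b bi /\ h = comp ai (comp bi (comp a b)).

Lemma pset_ext (A B : pset Q) : (forall f, A f <-> B f) -> A = B.
Proof.
by move=> E; apply: functional_extensionality => f; apply: propositional_extensionality.
Qed.

Lemma subset_central_prod f : H f -> down (central_prod H D) f.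
Proof. by move=> Hf; have [g E] := sub_sym sH _ Hf; subst f; exists g; split=> //; exact: central_prod_l. Qed.

Lemma commutators_central_prod_r A : subset A H -> commutators A (down (central_prod H D)) = commutators A H.
Proof.
move=> AH; apply: pset_ext => f; split; last first.
  move=> [a [b [ai [bi [Aa [Hb [ia [ib ->]]]]]]]]; exists a, b, ai, bi; split=> //; split=> //; exact: subset_central_prod.
move=> [a [b [ai [bi [Aa [[_ [[h [d [Hh [Dd ->]]]] ->]] [ia [ib ->]]]]]]]].
have [g E] := sub_sym sH _ (AH a Aa); subst a.
move/is_inv_sym: ia => ->; move/is_inv_sym: ib => ->.
exists (fn g), (fn h), (fn g^-1), (fn h^-1); split=> //; split=> //.
split; first exact/is_inv_sym; split; first exact/is_inv_sym.
change (fn (g^-1 * ((h * d)^-1 * (g * (h * d)))) = fn (g^-1 * (h^-1 * (g * h)))).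
congr fn; have c : commutes d g := cHD Dd (AH _ Aa).
have c' : commutes d h := cHD Dd Hh.
rewrite -c'; transitivity (g^-1 * (h^-1 * (d^-1 * (g * d) * h))); first by grp.
by rewrite -c mulVK.
Qed.

Lemma commutators_central_prod : commutators (down (central_prod H D)) (down (central_prod H D)) = commutators H H.
Proof.
rewrite -[RHS]commutators_central_prod_r //; apply: pset_ext => f; split; last first.
  move=> [a [b [ai [bi [Ha [Hb [ia [ib ->]]]]]]]]; exists a, b, ai, bi; split=> //; exact: subset_central_prod.
move=> [a [b [ai [bi [[_ [[h [d [Hh [Dd ->]]]] ->]] [[g [Hg ->]] [ia [ib ->]]]]]]]].
move/is_inv_sym: ia => ->; move/is_inv_sym: ib => ->.
exists (fn h), (fn g), (fn h^-1), (fn g^-1); split=> //; split; first by exists g.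
split; first exact/is_inv_sym; split; first exact/is_inv_sym.
change (fn ((h * d)^-1 * (g^-1 * (h * d * g))) = fn (h^-1 * (g^-1 * (h * g)))).
congr fn; have cdh : commutes d h := cHD Dd Hh.
have cdg : commutes d g.
  have [h' [d' [Hh' [Dd' ->]]]] := Hg; apply: commutesM; [exact: cHD|exact: abD].
have cc : commutes d (h^-1 * g^-1 * h * g).
  by do !apply: commutesM => //; apply: commutesV.
transitivity (d^-1 * (h^-1 * g^-1 * h * (d * g))); first by grp.
by rewrite cdg; transitivity (d^-1 * (h^-1 * g^-1 * h * g * d)); [grp|rewrite -cc mulVK !mulA].
Qed.

Lemma commg_commutators A B : commg A B = gen (commutators A B).
Proof. by []. Qed.

Lemma commg_sub A B (K : pset Q) : is_subgroup K -> subset A K -> subset B K -> subset (commg A B) K.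
Proof.
move=> sK AK BK; apply: gen_min => // f [a [b [ai [bi [Aa [Bb [ia [ib ->]]]]]]]].
have [_ [KM KV]] := sK; have Ka := AK a Aa; have Kb := BK b Bb.
by apply: (KM); [exact: KV ia|apply: (KM); [exact: KV ib|exact: KM]].
Qed.

(** From the first commutator on [D] disappears, being abelian and centralizing [H]; at index 0 the
    two series may differ. *)
Lemma lcs_central_prod i : lcs (down (central_prod H D)) (S i) = lcs H (S i).
Proof.
have HH : is_subgroup H by case: sH.
have lcsH j : subset (lcs H j) H.
  by elim: j => [|j IH] //=; apply: commg_sub.
elim: i => [|i IH]; first by rewrite /= !commg_commutators commutators_central_prod.
rewrite -[LHS]/(commg (lcs (down (central_prod H D)) (S i)) (down (central_prod H D))) IH.
by rewrite commg_commutators commutators_central_prod_r //; exact: lcsH.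
Qed.

Lemma dser_central_prod i : dser (down (central_prod H D)) (S i) = dser H (S i).
Proof.
elim: i => [|i IH]; first by rewrite /= !commg_commutators commutators_central_prod.
by rewrite -[LHS]/(commg (dser (down (central_prod H D)) (S i)) (dser (down (central_prod H D)) (S i))) IH.
Qed.

Lemma central_prod_nontrivial : ~ trivial H -> ~ trivial (down (central_prod H D)).
Proof. by move=> nt tr; apply: nt => f /subset_central_prod; exact: tr. Qed.

Lemma nilpotent_class_central_prod n : 0 < n -> nilpotent_class H n -> nilpotent_class (down (central_prod H D)) n.
Proof.
(* Class 0 has to be excluded: [D] may be nontrivial although [H] is trivial. *)
case: n => [|n] n0 [tr nt]; first by case: (Nat.lt_irrefl 0 n0).
split; first by rewrite lcs_central_prod.
move=> [|m] lt; last by rewrite lcs_central_prod; exact: nt.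
by apply: central_prod_nontrivial; apply: (nt 0); lia.
Qed.

Lemma derived_length_central_prod n : 0 < n -> derived_length H n -> derived_length (down (central_prod H D)) n.
Proof.
case: n => [|n] n0 [tr nt]; first by case: (Nat.lt_irrefl 0 n0).
split; first by rewrite dser_central_prod.
move=> [|m] lt; last by rewrite dser_central_prod; exact: nt.
by apply: central_prod_nontrivial; apply: (nt 0); lia.
Qed.

End Transfer.

(** * Each condition against finite generation of all subgroups *)

Section Equivalences.
Variables (Q : Type) (mul : Q -> Q -> Q) (e : Q).
Hypothesis HQ : is_CML mul e.
Local Notation t := (tn HQ).
Local Notation mlt := (mlt HQ).
Local Notation tspan := (tspan HQ).
Local Notation M := (Mlt mul).

Lemma Mlt_mlt f : M f <-> down mlt f.
Proof.
have tL x : fn (t x) = L mul x by apply: functional_extensionality => y; exact: tnE.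
rewrite /Mlt gen_span; last by move=> _ [x ->]; exists (t x).
split=> [[g [-> Sg]]|[g [Sg ->]]]; exists g; split=> //; apply: span_mono Sg => {}g [x Ex]; apply: span_in; exists x.
  by apply: fn_inj; rewrite Ex tL.
by rewrite Ex tL.
Qed.

Lemma Mlt_subgroup : subgroup_of M M.
Proof.
have := down_subgroup _ Mlt_mlt (mlt_subgrp HQ) (fun _ H => H).
by rewrite (_ : down mlt = M) //; apply: pset_ext => f; rewrite Mlt_mlt.
Qed.

Lemma up_Mlt f : up M f <-> mlt f.
Proof. by rewrite /up Mlt_mlt; exact: up_down. Qed.

Lemma fgen_ext (H K : sym Q -> Prop) : (forall f, H f <-> K f) -> fgen H -> fgen K.
Proof. by move=> E [l Hl]; exists l => f; rewrite -E. Qed.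

Lemma fin_gen_Mlt : fin_gen M <-> noeth mlt.
Proof.
rewrite (fin_gen_up Mlt_mlt Mlt_subgroup); split=> [fgM|nM].
  by apply: noeth_mlt; apply: fgen_ext fgM => f; exact: up_Mlt.
have [l Hl] := nM mlt (mlt_subgrp HQ) (fun _ H => H).
by exists l => f; rewrite up_Mlt.
Qed.

Lemma noeth_fin_gen H : noeth mlt -> subgroup_of M H -> fin_gen H.
Proof.
move=> nM sH; apply/(fin_gen_up Mlt_mlt sH).
by have [sub subG] := up_subgrp Mlt_mlt sH; exact: nM.
Qed.

Lemma subloop_subl S : subloop mul e S -> subl mul e S.
Proof.
move=> [Se [SM [SD _]]]; split=> //; split=> // x Sx.
by apply: (SD x e) => //; exact: (ivr HQ).
Qed.

Lemma gsub_subloop S : subloop mul e (gsub mul e S).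
Proof.
have div a b x : gsub mul e S a -> gsub mul e S b -> mul a x = b -> gsub mul e S x.
  by move=> Sa Sb E; rewrite -(loopVK HQ a x) E; apply: gsub_mul => //; exact: gsub_iv.
split; first exact: gsub_e.
split; first exact: gsub_mul.
by split=> // a b y Sa Sb; rewrite (loopC HQ); exact: div.
Qed.

Lemma tspan_loop S x : subl mul e S -> tspan S (t x) -> S x.
Proof.
move=> sS Sx; rewrite -(tn_e HQ x); apply: (proj1 (tspan_preserves sS Sx)).
by case: sS.
Qed.

(** A subloop [S] is recovered from [tspan S] by evaluation at [e], so chains of subloops become
    chains of subgroups. Conversely the maximum condition makes [Q], and with it the multiplication
    group, finitely generated. *)
Lemma loop_max_noeth : loop_max_condition mul e <-> noeth mlt.
Proof.
split=> [mx|nM C sC mono].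
  have [||l [_ Hl]] := @finitely_generated_of_acc Q e (fun _ => True) (fun l => gsub mul e (fun x => In x l)).
  - by move=> l x xl; exact: gsub_in.
  - move=> l _ inc.
    have [||N HN] := mx (fun n => gsub mul e (fun x => In x (l n))); first by move=> i; exact: gsub_subloop.
      move=> i; apply: gsub_min; first exact: gsub_subl.
      by move=> x xl; apply: gsub_in; exact: inc.
    by exists N => x; rewrite (HN (S N)) //; lia.
  apply: noeth_mlt; exists (map t l) => f; split=> [Mf|].
    have : tspan (fun x => In x l) f.
      apply: tspan_gsub; apply: span_mono Mf => {}f [x ->]; apply: span_in; exists x; split=> //; exact: Hl.
    by apply: span_mono => g [x [xl ->]]; apply: span_in; exact: in_map.
  by apply: span_mono => g /in_map_iff [x [<- _]]; exact: mlt_t.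
have sCl i := subloop_subl (sC i).
pose P i := down (tspan (C i)).
have tsub i f : tspan (C i) f -> mlt f by exact: tspan_mlt.
have [||N HN] := chain_stable Mlt_mlt P nM.
- by move=> i; apply: (down_subgroup _ Mlt_mlt); [exact: span_subgrp|exact: tsub].
- by move=> i f [g [Sg ->]]; exists g; split=> //; apply: tspan_mono Sg => x; exact: mono.
exists N => m le x.
have key i j : (forall f, P i f -> P j f) -> C i x -> C j x.
  move=> sub Cx; apply: tspan_loop => //.
  apply/up_down/sub; exists (t x); split=> //; apply: span_in; by exists x.
by split; apply: key => f; rewrite HN.
Qed.

Lemma group_max_noeth : group_max_condition M <-> noeth mlt.
Proof.
split=> [mx|nM C sC mono]; last exact: (chain_stable Mlt_mlt C nM).
have [||l [lM Hl]] := @finitely_generated_of_acc (sym Q) 1 mlt (@spanl Q).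
- by move=> l x; exact: spanl_in.
- move=> l lM inc.
  have [||N HN] := mx (fun n => down (spanl (l n))).
  + move=> i; apply: (down_subgroup _ Mlt_mlt); first exact: span_subgrp.
    by apply: spanl_min; [exact: span_subgrp|exact: lM].
  + by move=> i f [g [Sg ->]]; exists g; split=> //; exact: spanl_incl Sg.
  exists N => x Sx; apply/up_down; rewrite /up -(HN (S N)); last lia.
  by exists x.
apply: noeth_mlt; exists l => f; split; first exact: Hl.
by apply: spanl_min => //; exact: span_subgrp.
Qed.

Lemma normal_noeth : (forall H, normal_subgroup_of M H -> fin_gen H) <-> noeth mlt.
Proof.
split=> [H|nM H [sH _]]; last exact: noeth_fin_gen.
apply/fin_gen_Mlt; apply: H; split; first exact: Mlt_subgroup.
have [[_ [MM MV]] _] := Mlt_subgroup.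
by move=> f fi h Mf inv Mh; apply: (MM); [exact: MV inv|exact: MM].
Qed.

Lemma max_abelian_noeth :
  (exists A, max_abelian_subgroup_of M A /\ fin_gen A) <-> noeth mlt.
Proof.
split=> [[A [[sA [abA maxA]] fgA]]|nM].
  have [sub subG] := up_subgrp Mlt_mlt sA.
  apply: (noeth_of_self_centralizing sub subG); first exact/(fin_gen_up Mlt_mlt sA).
  move=> x Mx cx; pose S := span (fun f => up A f \/ f = x).
  have cS f g : S f -> S g -> commutes f g.
    apply: span_abelian => {}f {}g [Af|->] [Ag|->] //; last exact: cx.
    - by apply: fn_inj; exact: abA.
    - exact/commutes_sym/cx.
  apply: (maxA (down S)).
  - apply: (down_subgroup _ Mlt_mlt); first exact: span_subgrp.
    by apply: span_min; [exact: (mlt_subgrp HQ)|move=> f [/subG|->]].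
  - move=> _ _ [f [Sf ->]] [g [Sg ->]].
    by rewrite -[LHS]/(fn (f * g)) (cS f g Sf Sg).
  - move=> f Af; have [g E] := sub_sym Mlt_mlt sA _ Af; subst f.
    by exists g; split=> //; apply: span_in; left.
  - by exists x; split=> //; apply: span_in; right.
have [|D [sD [DM [abD maxD]]]] := max_abelian_exists (mlt_subgrp HQ).
  by move=> K sK KM _; exact: nM.
have sDM := down_subgroup _ Mlt_mlt sD DM.
exists (down D); split; last exact: noeth_fin_gen.
split=> //; split.
  by move=> _ _ [f [Df ->]] [g [Dg ->]]; rewrite -[LHS]/(fn (f * g)) (abD f g Df Dg).
move=> K sK abK DK f Kf; have [g E] := sub_sym Mlt_mlt sK _ Kf; subst f.
have [_ KM] := up_subgrp Mlt_mlt sK.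
exists g; split=> //; apply: maxD; first exact: KM.
move=> d Dd; apply: fn_inj; apply: (abK (fn g) (fn d)) => //; by apply: DK; exists d.
Qed.

(* If the subgroups of a given class [cls] are finitely generated, take [H] of that class
   and a maximal abelian subgroup [D] of its centralizer; then [H D] has class [cls] and
   contains its own centralizer. *)
Lemma class_noeth (cls : pset Q -> Prop) :
  (forall H D, subgroup_of M H -> cls H -> subgrp D -> (forall f, D f -> mlt f) ->
     (forall f g, D f -> D g -> commutes f g) -> (forall f h, D f -> up H h -> commutes f h) ->
     cls (down (central_prod H D))) ->
  (exists H, subgroup_of M H /\ cls H) ->
  ((forall H, subgroup_of M H -> cls H -> fin_gen H) <-> noeth mlt).
Proof.
move=> cls_prod [H [sH cH]]; split=> [fg|nM K sK _]; last exact: noeth_fin_gen.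
have [subH HM] := up_subgrp Mlt_mlt sH.
pose C f := mlt f /\ forall h, up H h -> commutes f h.
have sC : subgrp C by apply: subgrp_inter; [exact: (mlt_subgrp HQ)|exact: centralizer_subgrp].
(* Used twice: for every abelian [D] in the centralizer, to make it finitely generated so that a
   maximal one exists, and then for the maximal one. *)
have fgHD D : subgrp D -> (forall f, D f -> C f) -> (forall f g, D f -> D g -> commutes f g) ->
    [/\ subgrp (central_prod H D), forall f, central_prod H D f -> mlt f & fgen (central_prod H D)].
  move=> sD DC abD; have DM f : D f -> mlt f by case/DC.
  have cHD f h : D f -> up H h -> commutes f h by move=> /DC [_]; exact.
  have [sHD HDM] := central_prod_subgrp (mlt_subgrp HQ) Mlt_mlt sH sD DM cHD.
  have sub := down_subgroup _ Mlt_mlt sHD HDM.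
  split=> //; apply: (fgen_ext (H := up (down (central_prod H D)))); first by move=> f; exact: up_down.
  by apply/(fin_gen_up Mlt_mlt sub); apply: fg => //; exact: cls_prod.
have [|D [sD [DC [abD maxD]]]] := max_abelian_exists sC.
  move=> D sD DC abD; have [sHD HDM fgD] := fgHD D sD DC abD.
  by apply: (fgen_abelian_of_fgen sHD HDM fgD) => // f; exact: (central_prod_r Mlt_mlt _ sH).
have [sHD HDM fgD] := fgHD D sD DC abD.
apply: (noeth_of_self_centralizing sHD HDM fgD) => x Mx cx.
apply: (central_prod_r Mlt_mlt _ sH); apply: maxD.
  by split=> // h Hh; apply: cx; exact: central_prod_l.
by move=> f Df; apply: cx; exact: (central_prod_r Mlt_mlt _ sH).
Qed.

End Equivalences.

Theorem theorem2 (Q : Type) (mul : Q -> Q -> Q) (e : Q)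
  (HQ : is_CML mul e) (Hna : non_associative mul) :
  let M := Mlt mul in
  ((loop_max_condition mul e <-> fin_gen M) /\
   (loop_max_condition mul e <-> group_max_condition M) /\
   (loop_max_condition mul e <->
      (forall H, normal_subgroup_of M H -> fin_gen H)) /\
   (loop_max_condition mul e <->
      (exists A, max_abelian_subgroup_of M A /\ fin_gen A))) /\
  (forall n, 0 < n ->
     (exists H, subgroup_of M H /\ nilpotent_class H n) ->
     (loop_max_condition mul e <->
        (forall H, subgroup_of M H -> nilpotent_class H n -> fin_gen H))) /\
  (forall s, 0 < s ->
     (exists H, subgroup_of M H /\ derived_length H s) ->
     (loop_max_condition mul e <->
        (forall H, subgroup_of M H -> derived_length H s -> fin_gen H))).
Proof.
(* All conditions are compared with a single one: every subgroup of the multiplication group is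
   finitely generated. *)
move=> M; have E := loop_max_noeth HQ.
split; [split; [|split; [|split]]|split].
- exact: iff_trans E (iff_sym (fin_gen_Mlt HQ)).
- exact: iff_trans E (iff_sym (group_max_noeth HQ)).
- exact: iff_trans E (iff_sym (normal_noeth HQ)).
- exact: iff_trans E (iff_sym (max_abelian_noeth HQ)).
- move=> n n0 exH; apply: iff_trans E (iff_sym _).
  apply: (@class_noeth _ _ _ HQ (fun H => nilpotent_class H n) _ exH) => H D sH cH sD DM abD cHD.
  exact: (nilpotent_class_central_prod (Mlt_mlt HQ)).
- move=> s s0 exH; apply: iff_trans E (iff_sym _).
  apply: (@class_noeth _ _ _ HQ (fun H => derived_length H s) _ exH) => H D sH cH sD DM abD cHD.
  exact: (derived_length_central_prod (Mlt_mlt HQ)).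
Qed.
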